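(* Let $\Omega\subset\mathbb R^d$ be a bounded Lipschitz domain and let $\Delta_N$ denote the Neumann Laplacian on $L^2(\Omega)$. For $k\in\mathbb N$ consider the form $\mathfrak b_k(u,v)=\langle\Delta^ku,\Delta^kv\rangle_\Omega$ on $D(\mathfrak b_k)=D(\Delta_N^k)$. Then $\mathfrak b_k$ is admissible and the operator $B_N$ associated to $\mathfrak b_k$ is $B_N=\Delta_N^{2k}$, whence also $C_c^\infty(\Omega)\subset D(B_N)\cap D(B_D)$ holds; in particular $D(B_D)\cap D(B_N)$ is dense in $L^2(\Omega)$.
   Context: $\mathbb N=\{1,2,\dots\}$. The Neumann Laplacian is given by: $u\in D(\Delta_N)$, $\Delta_Nu=f$ iff $u\in H^1(\Omega)$, $f\in L^2(\Omega)$ and $-\langle\nabla u,\nabla v\rangle_\Omega=\langle f,v\rangle_\Omega$ for all $v\in H^1(\Omega)$; powers $\Delta_N^k$ have their natural domains, and $\Delta^ku$ means $\Delta_N^ku$ for $u\in D(\Delta_N^k)$. $\langle\cdot,\cdot\rangle_\Omega$ is the inner product of $L^2(\Omega)$, $\operatorname{tr}$ is the Dirichlet trace. A sesquilinear form $\mathfrak b$ with domain $D(\mathfrak b)$ in a Hilbert space $H$ is generating if it is densely defined, semi-bounded (there is $\lambda\in\mathbb R$ with $\operatorname{Re}\mathfrak b(u,u)\ge\lambda\|u\|_H^2$), closed ($D(\mathfrak b)$ is complete for $\|u\|_{\mathfrak b}^2=\operatorname{Re}\mathfrak b(u,u)+(1-\lambda)\|u\|_H^2$) and continuous ($|\mathfrak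 b(u,v)|\le M\|u\|_{\mathfrak b}\|v\|_{\mathfrak b}$). Its associated operator $A$ is: $u\in D(A)$, $Au=f$ iff $u\in D(\mathfrak b)$, $f\in H$ and $\mathfrak b(u,v)=\langle f,v\rangle_H$ for all $v\in D(\mathfrak b)$. A form $\mathfrak b$ on $L^2(\Omega)$ is admissible if it is generating, symmetric, and for some $\rho\in(0,1)$ one has $C_c^\infty(\Omega)\subseteq(D(\mathfrak b),\|\cdot\|_{\mathfrak b})\subseteq H^{1/2+\rho}(\Omega)$, where the latter embedding is continuous and dense. $B_N$ is the operator associated to $\mathfrak b=\mathfrak b_k$ on $L^2(\Omega)$; $B_D$ is the operator associated to the restriction of $\mathfrak b_k$ to $\{u\in D(\mathfrak b_k):\operatorname{tr}u=0\}$. *)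

(* Defs.v *)
From HB Require Import structures.
From mathcomp Require Import all_boot all_order all_algebra.
From mathcomp Require Import complex.
From mathcomp Require Import all_classical all_reals all_analysis.

Set Implicit Arguments.
Unset Strict Implicit.
Unset Printing Implicit Defensive.

Import Order.TTheory GRing.Theory Num.Theory.
Import numFieldNormedType.Exports.

Local Open Scope classical_set_scope.
Local Open Scope ring_scope.
Local Open Scope complex_scope.

(* Complex numbers R[i]; the modulus is taken in R rather than in R[i]. *)
Definition cabs {R : rcfType} (z : R[i]) : R :=
  Num.sqrt (complex.Re z ^+ 2 + complex.Im z ^+ 2).

Definition enorm {R : rcfType} {n} (x : 'rV[R]_n) : R :=
  Num.sqrt (\sum_j x 0 j ^+ 2).

(* Outer measures obtained from countable covers by sets [cov i], [i \in P],
   weighted by [g i]. *)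
Section cover_outer.
Local Open Scope ereal_scope.
Context {R : realType} {T I : Type}.
Variables (P : set I) (cov : I -> set T) (g : I -> \bar R).

Definition cover_outer (A : set T) : \bar R :=
  ereal_inf [set \sum_(k <oo) g (c k) | c in
    [set c : nat -> I | (forall k, P (c k)) /\ A `<=` \bigcup_k cov (c k)]].

Hypothesis g_ge0 : forall i, 0 <= g i.

Lemma cover_outer_ge0 A : 0 <= cover_outer A.
Proof.
by apply: le_ereal_inf_tmp => _ [c _ <-]; apply: nneseries_ge0 => k _ _.
Qed.

Lemma cover_outer0 i0 : P i0 -> g i0 = 0 -> cover_outer set0 = 0.
Proof.
move=> Pi0 gi0; apply/eqP; rewrite eq_le cover_outer_ge0 andbT.
apply: ereal_inf_lbound; exists (fun=> i0); first by split.
by rewrite eseries0.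
Qed.

Lemma le_cover_outer : {homo cover_outer : A B / A `<=` B >-> A <= B}.
Proof.
move=> A B AB; apply/ereal_inf_le_tmp => _ [c [Pc Bc] <-].
by exists c => //; split => //; exact: subset_trans AB Bc.
Qed.

Lemma cover_outer_sigma_subadditive : sigma_subadditive cover_outer.
Proof.
move=> A; have [[i ioo]|] := pselect (exists i, cover_outer (A i) = +oo).
  rewrite (eseries_pinfty _ _ ioo) ?leey// => n _.
  by rewrite -ltNye (lt_le_trans _ (cover_outer_ge0 _)).
rewrite -forallNE => Aoo.
suff add2e (e : {posnum R}) : cover_outer (\bigcup_n A n) <=
    \sum_(i <oo) cover_outer (A i) + e%:num%:E.
  by apply/lee_addgt0Pr => _/posnumP[].
rewrite (le_trans _ (epsilon_trick _ _ _))//; last first.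
  by move=> n; exact: cover_outer_ge0.
pose Q n (c : nat -> I) := ((forall k, P (c k)) /\
    A n `<=` \bigcup_k cov (c k)) /\
  \sum_(k <oo) g (c k) <= cover_outer (A n) + (e%:num / (2 ^ n.+1)%:R)%:E.
have [G QG] : {G : nat -> nat -> I & forall n, Q n (G n)}.
  apply: (@choice _ _ Q) => n; rewrite /Q /cover_outer.
  set S := (X in ereal_inf X); move infS : (ereal_inf S) => iS.
  case: iS infS => [r Sr|Soo|Soo].
  - have en1 : (0 < e%:num / (2 ^ n.+1)%:R)%R by [].
    have /(lb_ereal_inf_adherent en1) : ereal_inf S \is a fin_num by rewrite Sr.
    move=> [x [c Pc cx] xS].
    by exists c; split => //; rewrite cx -Sr; exact/ltW.
  - by have := Aoo n; rewrite /cover_outer Soo.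
  - suff : lbound S 0 by move/le_ereal_inf_tmp; rewrite Soo.
    by move=> /= _ [c _ <-]; exact: nneseries_ge0.
have gG_ge0 x : 0 <= (g \o uncurry G) x by exact: g_ge0.
apply: (@le_trans _ _ (\esum_(i in setT) (g \o uncurry G) i)).
  apply: ereal_inf_lbound => /=.
  have /card_esym/ppcard_eqP[f] := card_nat2.
  exists (uncurry G \o f).
    split => [k /=|t [i _ /(QG i).1.2 [j _ Gt]]].
      by rewrite /uncurry; case: (f k) => a b; exact: (QG a).1.1.
    exists (f^-1%FUN (i, j)) => //=.
    by rewrite invK ?inE.
  rewrite -(esum_pred_image (g \o uncurry G) _ xpredT) ?[fun=> _]set_true//.
  by rewrite image_eq.
rewrite (_ : esum _ _ = \sum_(i <oo) \sum_(j <oo ) g (G i j)); last first.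
  pose J : nat -> set (nat * nat) := fun i => [set (i, j) | j in setT].
  rewrite (_ : setT = \bigcup_k J k); last first.
    by rewrite predeqE => -[a b]; split => // _; exists a => //; exists b.
  rewrite esum_bigcupT /=; last 2 first.
    - apply/trivIsetP => i j _ _ ij.
      rewrite predeqE => -[n m] /=; split => //= -[] [_] _ [<-{n} _].
      by move=> [m' _] [] /esym/eqP; rewrite (negbTE ij).
    - by move=> /= [n m]; exact: g_ge0.
  rewrite -(image_id [set: nat]) -fun_true esum_pred_image//; last first.
    by move=> n _; exact: esum_ge0.
  apply: eq_eseriesr => /= j _.
  rewrite -(esum_pred_image (g \o uncurry G) (pair j) predT)//=; last first.
    by move=> ? ? _ _; exact: (@can_inj _ _ _ snd).
  by congr esum; rewrite predeqE => -[a b]; split; move=> [i _ <-]; exists i.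
apply: lee_lim.
- apply: is_cvg_nneseries => n *.
  by apply: nneseries_ge0 => m *; exact: (gG_ge0 (n, m)).
- by apply: is_cvg_nneseries => n *; apply: adde_ge0 => //; exact: cover_outer_ge0.
- by near=> n; apply: lee_sum => i _; exact: (QG i).2.
Unshelve. all: by end_near. Qed.

End cover_outer.

(* Lebesgue measure on R^n: the outer measure generated by the volumes of
   half-open boxes, restricted to its Caratheodory sigma-algebra. *)
Section lebesgue_rV.
Context {R : realType} {n : nat}.
Local Notation E := 'rV[R]_n.+1.

Definition box (c : E * E) : set E :=
  [set x | forall j, c.1 0 j < x 0 j <= c.2 0 j].

Definition box_volume (c : E * E) : \bar R :=
  (\prod_j Num.max 0 (c.2 0 j - c.1 0 j))%:E.

Lemma box_volume_ge0 c : (0 <= box_volume c)%E.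
Proof. by rewrite lee_fin prodr_ge0// => j _; rewrite le_max lexx. Qed.

Lemma box_volume0 : box_volume (0, 0) = 0%E.
Proof. by rewrite /box_volume big_ord_recl/= mxE subrr maxxx mul0r. Qed.

Definition lebesgue_outer : set E -> \bar R := cover_outer setT box box_volume.

Let lebesgue_outer0 : lebesgue_outer set0 = 0%E.
Proof.
exact: (@cover_outer0 _ _ _ setT box _ box_volume_ge0 (0, 0) I box_volume0).
Qed.

HB.instance Definition _ := isOuterMeasure.Build R E lebesgue_outer
  lebesgue_outer0 (cover_outer_ge0 _ _ box_volume_ge0) (@le_cover_outer _ _ _ _ _ _)
  (cover_outer_sigma_subadditive _ _ box_volume_ge0).

Definition lebesgue_om : {outer_measure set E -> \bar R} := lebesgue_outer.

Definition lebesgue_rV :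
    {measure set (caratheodory_type lebesgue_om) -> \bar R} :=
  lebesgue_om : set (caratheodory_type lebesgue_om) -> \bar R.

End lebesgue_rV.
Arguments lebesgue_rV R n : clear implicits.

(* m-dimensional Hausdorff measure on R^(n+1), without the normalizing constant
   omega_m / 2^m, which only rescales the norm of L^2 of the boundary. *)
Section hausdorff.
Context {R : realType} {n : nat} (m : nat).
Local Notation E := 'rV[R]_n.+1.

(* diam(U)^m, with value 0 at U = set0 also when m = 0. *)
Definition diam_pow (U : set E) : \bar R :=
  ereal_sup (0%E |` [set (enorm (p.1 - p.2) ^+ m)%:E | p in U `*` U]).

Lemma diam_pow_ge0 U : (0 <= diam_pow U)%E.
Proof. by apply: ereal_sup_ubound; left. Qed.

Lemma diam_pow0 : diam_pow set0 = 0%E.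
Proof. by rewrite /diam_pow setX0 image_set0 setU0 ereal_sup1. Qed.

Definition small_sets (delta : R) : set (set E) :=
  [set U | forall x y, U x -> U y -> enorm (x - y) <= delta].

Definition hausdorff_outer (A : set E) : \bar R :=
  ereal_sup [set cover_outer (small_sets delta) id diam_pow A
            | delta in [set delta | 0 < delta]].

Let hausdorff_outer_ge0 A : (0 <= hausdorff_outer A)%E.
Proof.
apply: le_trans (cover_outer_ge0 (small_sets 1) id diam_pow_ge0 A) _.
by apply: ereal_sup_ubound; exists 1 => //=.
Qed.

Let hausdorff_outer0 : hausdorff_outer set0 = 0%E.
Proof.
apply/eqP; rewrite eq_le hausdorff_outer_ge0 andbT.
apply: ge_ereal_sup => _ [delta _ <-].
by rewrite (@cover_outer0 _ _ _ _ id _ diam_pow_ge0 set0)// diam_pow0.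
Qed.

Let le_hausdorff_outer :
  {homo hausdorff_outer : A B / A `<=` B >-> (A <= B)%E}.
Proof.
move=> A B AB; apply: ge_ereal_sup => _ [delta d0 <-].
apply: (le_trans (le_cover_outer (small_sets delta) id diam_pow AB)).
by apply: ereal_sup_ubound; exists delta.
Qed.

Let hausdorff_outer_sigma_subadditive : sigma_subadditive hausdorff_outer.
Proof.
move=> A; apply: ge_ereal_sup => _ [delta d0 <-].
apply: (le_trans (cover_outer_sigma_subadditive _ _ diam_pow_ge0 _)).
apply: lee_nneseries => [k _ _|k _].
  exact: (cover_outer_ge0 _ _ diam_pow_ge0).
by apply: ereal_sup_ubound; exists delta.
Qed.

HB.instance Definition _ := isOuterMeasure.Build R E hausdorff_outer
  hausdorff_outer0 hausdorff_outer_ge0 le_hausdorff_outer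
  hausdorff_outer_sigma_subadditive.

Definition hausdorff_om : {outer_measure set E -> \bar R} := hausdorff_outer.

Definition hausdorff_measure :
    {measure set (caratheodory_type hausdorff_om) -> \bar R} :=
  hausdorff_om : set (caratheodory_type hausdorff_om) -> \bar R.

End hausdorff.
Arguments hausdorff_measure R n m : clear implicits.

(* Elements of L^2(D; C) are represented by functions defined on the whole
   ambient type; two representatives u, v stand for the same vector when
   hnorm (u - v) = 0, i.e. when u = v almost everywhere on D. *)
Section L2.
Context d {T : measurableType d} {R : realType}.
Variables (mu : {measure set T -> \bar R}) (D : set T).

Definition L2 : set (T -> R[i]) :=
  [set u : T -> R[i] |
            [/\ measurable_fun D (fun x => complex.Re (u x)),
                measurable_fun D (fun x => complex.Im (u x)) &
                (\int[mu]_(x in D) (cabs (u x) ^+ 2)%:E < +oo)%E]].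

Definition L2ip (u v : T -> R[i]) : R[i] :=
  (\int[mu]_(x in D) complex.Re (u x * (v x)^*)%C) +i*
  (\int[mu]_(x in D) complex.Im (u x * (v x)^*)%C).

End L2.

(* A Hilbert space is given by a set X of vectors and a semi-inner product ip;
   vectors at distance 0 are identified.  Operators are given by their graphs. *)
Section forms.
Context {R : realType} {H : lmodType R[i]}.
Variables (X : set H) (ip : H -> H -> R[i]).

Definition hnorm (u : H) : R := Num.sqrt (complex.Re (ip u u)).

Definition dense_in (D : set H) :=
  D `<=` X /\
  forall u e, X u -> 0 < e -> exists2 v, D v & hnorm (u - v) < e.

Definition operator := H -> H -> Prop.

Definition odom (A : operator) : set H := [set u | exists f, A u f].

Definition oapp (A : operator) (u : H) : H := xget 0 [set f | A u f].

(* Powers with their natural domains. *)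
Fixpoint opow (A : operator) (k : nat) : operator :=
  if k is k'.+1 then fun u f => exists2 g, opow A k' u g & A g f
  else fun u f => [/\ X u, X f & hnorm (u - f) = 0].

Record form := Form { fdom : set H; fval : H -> H -> R[i] }.

Definition restrict_form (b : form) (S : set H) : form :=
  Form (fdom b `&` S) (fval b).

(* The last clause says that the form is well defined modulo vectors of
   norm 0. *)
Definition sesquilinear (b : form) :=
  [/\ fdom b `<=` X,
      fdom b 0 /\
        (forall c u v, fdom b u -> fdom b v -> fdom b (c *: u + v)),
      (forall c u v w, fdom b u -> fdom b v -> fdom b w ->
        fval b (c *: u + v) w = c * fval b u w + fval b v w /\
        fval b w (c *: u + v) = c^* * fval b w u + fval b w v) &
      (forall z, X z -> hnorm z = 0 -> fdom b z /\
        forall v, fdom b v -> fval b z v = 0 /\ fval b v z = 0)].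

Definition semibounded (b : form) (lambda : R) :=
  forall u, fdom b u -> lambda * hnorm u ^+ 2 <= complex.Re (fval b u u).

Definition fnorm (b : form) (lambda : R) (u : H) : R :=
  Num.sqrt (complex.Re (fval b u u) + (1 - lambda) * hnorm u ^+ 2).

Definition closed_form (b : form) (lambda : R) :=
  forall u_ : nat -> H, (forall n, fdom b (u_ n)) ->
    (forall e, 0 < e -> exists N, forall m n, (N <= m)%N -> (N <= n)%N ->
      fnorm b lambda (u_ m - u_ n) < e) ->
    exists2 u, fdom b u & fnorm b lambda (u_ n - u) @[n --> \oo] --> 0.

Definition continuous_form (b : form) (lambda : R) :=
  exists M : R, forall u v, fdom b u -> fdom b v ->
    cabs (fval b u v) <= M * fnorm b lambda u * fnorm b lambda v.

Definition generating (b : form) :=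
  [/\ sesquilinear b, dense_in (fdom b) &
      exists lambda, [/\ semibounded b lambda, closed_form b lambda &
                         continuous_form b lambda]].

Definition symmetric_form (b : form) :=
  forall u v, fdom b u -> fdom b v -> fval b u v = (fval b v u)^*.

Definition associated_operator (b : form) : operator :=
  fun u f => [/\ fdom b u, X f & forall v, fdom b v -> fval b u v = ip f v].

End forms.
Arguments operator {R} H.
Arguments form {R} H.

Section domains.
Context {R : realType} {d : nat}.
Local Notation E := 'rV[R]_d.+1.
Local Notation lambda := (lebesgue_rV R d).
Implicit Types (Omega : set E) (u v f g : E -> R[i]).

Definition bdry Omega : set E := closure Omega `\` interior Omega.

(* Near each boundary point p, after the rigid motion y = (x - p) Q, Omega is
   the strict epigraph of a Lipschitz function of the first d coordinates. *)
Definition lipschitz_boundary Omega :=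
  forall p, bdry Omega p ->
  exists (r L : R) (Q : 'M[R]_d.+1) (gamma : 'rV[R]_d -> R),
    [/\ 0 < r, Q *m Q^T = 1%:M,
        (forall y z, `|gamma y - gamma z| <= L * enorm (y - z)) &
        forall x, enorm (x - p) < r ->
          let y := (x - p) *m Q in
          Omega x <-> gamma (\row_j y 0 (lift ord_max j)) < y 0 ord_max].

Definition bounded_lipschitz_domain Omega :=
  [/\ open Omega, connected Omega, Omega !=set0, bounded_set Omega &
      lipschitz_boundary Omega].

Definition unit_vec (i : 'I_d.+1) : E := delta_mx 0 i.

Fixpoint Cn (m : nat) (h : E -> R) : Prop :=
  if m is m'.+1 then
    forall i, (forall x, derivable h x (unit_vec i)) /\
              Cn m' (fun x => 'D_(unit_vec i) h x)
  else continuous h.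

Definition smooth u :=
  forall m, Cn m (fun x => complex.Re (u x)) /\ Cn m (fun x => complex.Im (u x)).

Definition Cc_infty Omega : set (E -> R[i]) :=
  [set u | [/\ smooth u, compact (closure [set x | u x != 0]) &
               closure [set x | u x != 0] `<=` Omega]].

Definition pderiv (i : 'I_d.+1) u : E -> R[i] := fun x =>
  'D_(unit_vec i) (fun y => complex.Re (u y)) x +i*
  'D_(unit_vec i) (fun y => complex.Im (u y)) x.

Definition L2O Omega : set (E -> R[i]) := L2 lambda Omega.

Definition ipO Omega u v : R[i] := L2ip lambda Omega u v.

Definition weak_pderiv Omega (i : 'I_d.+1) u g :=
  L2O Omega g /\ forall phi, Cc_infty Omega phi ->
    ipO Omega u (pderiv i phi) = - ipO Omega g phi.

Definition wgrad Omega (i : 'I_d.+1) u : E -> R[i] :=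
  xget 0 [set g | weak_pderiv Omega i u g].

Definition H1 Omega : set (E -> R[i]) :=
  [set u | L2O Omega u /\ forall i, exists g, weak_pderiv Omega i u g].

Definition ip_grad Omega u v : R[i] :=
  \sum_i ipO Omega (wgrad Omega i u) (wgrad Omega i v).

(* Square of the Slobodeckij seminorm of order theta. *)
Definition slobodeckij Omega (theta : R) u : \bar R :=
  (\int[lambda]_(x in Omega) \int[lambda]_(y in Omega)
    (cabs (u x - u y) ^+ 2 /
      enorm ((x : E) - (y : E)) `^ (d.+1%:R + 2 * theta))%:E)%E.

(* The Sobolev-Slobodeckij space H^s(Omega), for 0 < s < 2. *)
Definition Hs Omega (s : R) : set (E -> R[i]) :=
  [set u | if s < 1 then L2O Omega u /\ (slobodeckij Omega s u < +oo)%E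
           else H1 Omega u /\ (1 < s -> forall i,
             (slobodeckij Omega (s - 1) (wgrad Omega i u) < +oo)%E)].

Definition Hs_norm Omega (s : R) u : R :=
  Num.sqrt (hnorm (ipO Omega) u ^+ 2 +
    if s < 1 then fine (slobodeckij Omega s u)
    else complex.Re (ip_grad Omega u u) +
      if s == 1 then 0
      else \sum_i fine (slobodeckij Omega (s - 1) (wgrad Omega i u))).

Definition L2bdry Omega : set (E -> R[i]) :=
  L2 (hausdorff_measure R d d) (bdry Omega).

Definition L2bdry_norm Omega u : R :=
  hnorm (L2ip (hausdorff_measure R d d) (bdry Omega)) u.

(* Graph of the Dirichlet trace on H^s(Omega), 1/2 < s < 3/2: the continuous
   extension of the restriction map u |-> u|_(bdry Omega), from functions that
   are smooth up to the boundary, to a map into L^2 of the boundary. *)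
Definition dirichlet_trace Omega (s : R) u g :=
  [/\ Hs Omega s u, L2bdry Omega g &
      exists u_ : nat -> E -> R[i],
        [/\ forall n, smooth (u_ n) /\ Hs Omega s (u_ n),
            Hs_norm Omega s (u_ n - u) @[n --> \oo] --> 0 &
            L2bdry_norm Omega (u_ n - g) @[n --> \oo] --> 0]].

(* The traces on the spaces H^(1/2 + rho)(Omega) agree, so tr u = 0 is
   meaningful as soon as u lies in one of them. *)
Definition trace0 Omega : set (E -> R[i]) :=
  [set u | exists rho, 0 < rho < 1 /\ dirichlet_trace Omega (2^-1 + rho) u 0].

Definition neumann_laplacian Omega : operator (E -> R[i]) :=
  fun u f => [/\ H1 Omega u, L2O Omega f &
    forall v, H1 Omega v -> - ip_grad Omega u v = ipO Omega f v].

Definition neumann_pow Omega (k : nat) : operator (E -> R[i]) :=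
  opow (L2O Omega) (ipO Omega) (neumann_laplacian Omega) k.

(* The continuity of the embedding into H^(1/2 + rho)(Omega) does not depend on
   the lower bound l, since the norms fnorm for different lower bounds are
   equivalent. *)
Definition admissible Omega (b : form (E -> R[i])) :=
  [/\ generating (L2O Omega) (ipO Omega) b, symmetric_form b &
      exists2 rho : R, 0 < rho < 1 & let s := 2^-1 + rho in
      [/\ Cc_infty Omega `<=` fdom b,
          fdom b `<=` Hs Omega s,
          (exists l C : R, semibounded (ipO Omega) b l /\
            forall u, fdom b u ->
              Hs_norm Omega s u <= C * fnorm (ipO Omega) b l u) &
          (forall u e, Hs Omega s u -> 0 < e ->
            exists2 v, fdom b v & Hs_norm Omega s (u - v) < e)]].

Definition neumann_form Omega (k : nat) : form (E -> R[i]) :=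
  Form (odom (neumann_pow Omega k))
    (fun u v => ipO Omega (oapp (neumann_pow Omega k) u)
                          (oapp (neumann_pow Omega k) v)).

Definition B_N Omega (b : form (E -> R[i])) : operator (E -> R[i]) :=
  associated_operator (L2O Omega) (ipO Omega) b.

Definition B_D Omega (b : form (E -> R[i])) : operator (E -> R[i]) :=
  associated_operator (L2O Omega) (ipO Omega) (restrict_form b (trace0 Omega)).

End domains.

(* Main.v *)
(** For [rho = 1/2] the space [H^(1/2 + rho)] is [H^1], and no regularity of the
    boundary is needed: [Omega] open and bounded suffices.  The Neumann Laplacian
    [L] is the operator of a nonnegative closed form on a Hilbert space; by
    Riesz the resolvent [(1 - L)^-1] exists, and induction on [k] shows that
    every power [L ^ k] is self-adjoint, in the strong form that
    [ip g (L ^ k v) = ip f v] for all [v] in the domain forces [L ^ k g = f].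
    With exponent [k] and then again [k] this identifies the operator of the form
    [b_k] as [L ^ (2 k)]; log-convexity of the norms of [u], [L u], ..., [L ^ k u]
    bounds the [H^1] norm by the form norm.  Density statements reduce to
    triviality of orthogonal complements.  Test functions lie in the domain of
    every power, with zero trace, by integration by parts, which is the vanishing
    of [\int 'D_i h] and follows from translation invariance of Lebesgue measure.
    They are dense in [L^2] because the indicator function of an open set is a
    monotone limit of smooth bumps and Lebesgue measure is outer regular. *)

Require Import Defs.
From HB Require Import structures.
From mathcomp Require Import all_boot all_order all_algebra.
From mathcomp Require Import complex.
From mathcomp Require Import all_classical all_reals all_analysis.
From mathcomp Require Import measurable_realfun.
From mathcomp Require Import ring lra.

Set Implicit Arguments.
Unset Strict Implicit.
Unset Printing Implicit Defensive.

Import Order.TTheory GRing.Theory Num.Theory.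
Import numFieldNormedType.Exports.

Local Open Scope classical_set_scope.
Local Open Scope ring_scope.
Local Open Scope complex_scope.

(** Vectors are functions rather than classes: the Hilbert space is a set [X] with a semi-inner
    product, operators are relations, and [oapp] picks a value by choice. Values are thus unique,
    and the chosen ones linear, only up to vectors of norm 0, and much of the work carries
    identities across such changes. The Hilbert space arguments run in an abstract setting whose
    definitions unfold to those of the statement, so the results transfer by conversion.

    The strong form of self-adjointness does double duty: it computes the operator of the form, and
    it makes [L ^ k] closed, because its hypothesis survives limits of pairs in the graph.

    The measure is built from covers by boxes and not as a product, so the analysis avoids Fubini
    and with it mollification by convolution. Difference quotients and explicit bumps take their
    place; they call only for dominated convergence, translation invariance and outer regularity. *)

Section complex_numbers.
Context {R : realType}.
Implicit Types x y : R[i].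

Lemma ReD x y : complex.Re (x + y) = complex.Re x + complex.Re y.
Proof. by case: x y => [? ?] []. Qed.

Lemma ImD x y : complex.Im (x + y) = complex.Im x + complex.Im y.
Proof. by case: x y => [? ?] []. Qed.

Lemma ReN x : complex.Re (- x) = - complex.Re x.
Proof. by case: x. Qed.

Lemma ImN x : complex.Im (- x) = - complex.Im x.
Proof. by case: x. Qed.

Lemma ReM x y :
  complex.Re (x * y) = complex.Re x * complex.Re y - complex.Im x * complex.Im y.
Proof. by case: x y => [? ?] []. Qed.

Lemma ImM x y :
  complex.Im (x * y) = complex.Re x * complex.Im y + complex.Im x * complex.Re y.
Proof. by case: x y => [? ?] []. Qed.

Lemma ReJ x : complex.Re (conjc x) = complex.Re x.
Proof. by case: x. Qed.

Lemma ImJ x : complex.Im (conjc x) = - complex.Im x.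
Proof. by case: x. Qed.

Lemma complex_eq x y :
  complex.Re x = complex.Re y -> complex.Im x = complex.Im y -> x = y.
Proof. by case: x y => [? ?] [? ?] /= -> ->. Qed.

Lemma conjcD x y : conjc (x + y) = conjc x + conjc y.
Proof. by apply: complex_eq; rewrite ?(ReJ, ImJ, ReD, ImD) ?opprD. Qed.

Lemma conjcM x y : conjc (x * y) = conjc x * conjc y.
Proof.
apply: complex_eq; rewrite ?(ReJ, ImJ, ReM, ImM); first by rewrite mulrNN.
by rewrite opprD mulrN mulNr.
Qed.

Lemma conjcN x : conjc (- x) = - conjc x.
Proof. by apply: complex_eq; rewrite ?(ReJ, ImJ, ReN, ImN). Qed.

Lemma cabs_ge0 x : 0 <= cabs x.
Proof. exact: sqrtr_ge0. Qed.

Lemma sqr_cabs x : cabs x ^+ 2 = complex.Re x ^+ 2 + complex.Im x ^+ 2.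
Proof. by rewrite sqr_sqrtr// addr_ge0// sqr_ge0. Qed.

Lemma cabs0 : cabs (0 : R[i]) = 0.
Proof. by rewrite /cabs /= expr0n /= addr0 sqrtr0. Qed.

Lemma cabs_eq0 x : cabs x = 0 -> x = 0.
Proof.
move=> x0; have := sqr_cabs x; rewrite x0 expr0n => /esym/eqP.
rewrite paddr_eq0 ?sqr_ge0// !sqrf_eq0 => /andP[/eqP a /eqP b].
exact: complex_eq.
Qed.

Lemma ler_norm_cabs x : `|complex.Re x| <= cabs x.
Proof.
by rewrite -sqrtr_sqr ler_wsqrtr// lerDl sqr_ge0.
Qed.

End complex_numbers.

(** * Elementary real inequalities and null sequences *)

Section real_sequences.
Context {R : realType}.

(** Evaluation at the vertex [- b / c]. Besides Cauchy-Schwarz it yields the approximate Euler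
    equation of a minimizing sequence, with [a] the excess over the infimum. *)
Lemma discriminant_le (a b c : R) : 0 <= c ->
  (forall t, 0 <= a + 2 * b * t + c * t ^+ 2) -> b ^+ 2 <= a * c.
Proof.
rewrite le_eqVlt => /orP[/eqP <-|c0] h.
  rewrite mulr0; have [->|b0] := eqVneq b 0; first by rewrite expr0n.
  (* At this point the affine function [a + 2 * b * t] takes the value -1. *)
  have := h (- (a + 1) / (2 * b)); rewrite mul0r addr0.
  rewrite mulrCA mulfV ?mulf_neq0// mulr1 => h1.
  by exfalso; move: h1; lra.
have := h (- b / c).
have -> : a + 2 * b * (- b / c) + c * (- b / c) ^+ 2 = (a * c - b ^+ 2) / c.
  by field; rewrite gt_eqF.
by rewrite pmulr_lge0 ?invr_gt0// subr_ge0.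
Qed.

Lemma ler_of_sqr (x y : R) : 0 <= y -> x ^+ 2 <= y ^+ 2 -> x <= y.
Proof. by move=> y0; apply: contraTT; rewrite -!ltNge => xy; nra. Qed.

Lemma ltr_of_sqr (x y : R) : 0 <= y -> x ^+ 2 < y ^+ 2 -> x < y.
Proof. by move=> y0; apply: contraTT; rewrite -!leNgt => xy; nra. Qed.

Lemma eqr_of_sqr (x y : R) : 0 <= x -> 0 <= y -> x ^+ 2 = y ^+ 2 -> x = y.
Proof.
by move=> x0 y0 xy; apply/eqP; rewrite eq_le; apply/andP; split; apply: ler_of_sqr; rewrite ?xy.
Qed.

Lemma cvg0P (x : nat -> R) : (forall n, 0 <= x n) ->
  (x @ \oo --> 0) <->
  (forall e, 0 < e -> exists N, forall n, (N <= n)%N -> x n < e).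
Proof.
move=> x0; split => [/cvgrPdist_lt h e e0|h].
  have [N _ hN] := h _ e0; exists N => n Nn.
  by have := hN n Nn; rewrite /= sub0r normrN ger0_norm.
apply/cvgrPdist_lt => e e0; have [N hN] := h _ e0; exists N => // n /= Nn.
by rewrite sub0r normrN ger0_norm// hN.
Qed.

Lemma cvg0_sqr (x : nat -> R) : x @ \oo --> 0 -> x n ^+ 2 @[n --> \oo] --> 0.
Proof.
move=> x0; have h : x n * x n @[n --> \oo] --> 0 * (0 : R) by apply: cvgM.
by rewrite mulr0 in h; under eq_fun do rewrite expr2.
Qed.

Lemma cvg0_sum (I : Type) (s : seq I) (F : I -> nat -> R) :
  (forall i, F i @ \oo --> 0) -> \sum_(i <- s) F i n @[n --> \oo] --> 0.
Proof.
move=> F0; elim: s => [|i s IH].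
  by under eq_fun do rewrite big_nil; exact: cvg_cst.
have h : F i n + \sum_(j <- s) F j n @[n --> \oo] --> 0 + (0 : R) by apply: cvgD.
by rewrite addr0 in h; under eq_fun do rewrite big_cons.
Qed.

Lemma invn_small (e : R) : 0 < e ->
  exists N, forall n, (N <= n)%N -> (n.+1%:R)^-1 < e.
Proof.
move=> e0; exists (Num.truncn e^-1) => n Nn.
rewrite invf_plt ?posrE//.
by rewrite (lt_le_trans (truncnS_gt _))// ler_nat ltnS.
Qed.

End real_sequences.

(** * Pre-Hilbert spaces *)

Section pre_hilbert_space.
Context {R : realType} {H : lmodType R[i]}.

(** The form is only semi-definite, because representatives that agree almost everywhere are
    distinct elements of [H]. The laws are restricted to [X], since integrals of products carry no
    meaning outside L2. *)
Record pre_hilbert (X : set H) (ip : H -> H -> R[i]) : Prop := PreHilbert {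
  ph_mem0 : X 0;
  ph_memZD : forall c u v, X u -> X v -> X (c *: u + v);
  ph_linear : forall c u v w, X u -> X v -> X w ->
    ip (c *: u + v) w = c * ip u w + ip v w;
  ph_conj : forall u v, X u -> X v -> ip u v = conjc (ip v u);
  ph_ge0 : forall u, X u -> 0 <= complex.Re (ip u u) }.

Definition cauchy_for (N : H -> R) (u : nat -> H) :=
  forall e, 0 < e -> exists n0, forall m n, (n0 <= m)%N -> (n0 <= n)%N ->
    N (u m - u n) < e.

Definition complete_for (X : set H) (N : H -> R) :=
  forall u : nat -> H, (forall n, X (u n)) -> cauchy_for N u ->
    exists2 l, X l & N (u n - l) @[n --> \oo] --> 0.

Variables (X : set H) (ip : H -> H -> R[i]).
Hypothesis HX : pre_hilbert X ip.
Local Notation nrm := (hnorm ip).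

Lemma mem0 : X 0. Proof. exact: ph_mem0 HX. Qed.

Lemma memD u v : X u -> X v -> X (u + v).
Proof. by move=> Xu Xv; rewrite -[u]scale1r; apply: (ph_memZD HX). Qed.

Lemma memZ c u : X u -> X (c *: u).
Proof.
by move=> Xu; rewrite -[c *: u]addr0; apply: (ph_memZD HX) => //; exact: mem0.
Qed.

Lemma memN u : X u -> X (- u).
Proof. by rewrite -scaleN1r; exact: memZ. Qed.

Lemma memB u v : X u -> X v -> X (u - v).
Proof. by move=> Xu Xv; apply: memD => //; exact: memN. Qed.

Lemma ipDl u v w : X u -> X v -> X w -> ip (u + v) w = ip u w + ip v w.
Proof. by move=> *; rewrite -[u in LHS]scale1r (ph_linear HX)// mul1r. Qed.

Lemma ip0l w : X w -> ip 0 w = 0.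
Proof.
move=> Xw; have := ipDl mem0 mem0 Xw.
by rewrite addr0 -{1}[ip 0 w]addr0 => /addrI.
Qed.

Lemma ipZl c u w : X u -> X w -> ip (c *: u) w = c * ip u w.
Proof.
move=> Xu Xw; rewrite -[c *: u]addr0 (ph_linear HX) ?ip0l ?addr0//.
exact: mem0.
Qed.

Lemma ipNl u w : X u -> X w -> ip (- u) w = - ip u w.
Proof. by move=> *; rewrite -scaleN1r ipZl// mulN1r. Qed.

Lemma ipBl u v w : X u -> X v -> X w -> ip (u - v) w = ip u w - ip v w.
Proof. by move=> *; rewrite ipDl ?ipNl//; exact: memN. Qed.

Lemma ipC u v : X u -> X v -> ip u v = conjc (ip v u).
Proof. exact: (ph_conj HX). Qed.

Lemma ipDr u v w : X u -> X v -> X w -> ip w (u + v) = ip w u + ip w v.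
Proof.
move=> Xu Xv Xw; rewrite ipC ?ipDl ?conjcD//; last exact: memD.
by rewrite -(ipC Xw Xu) -(ipC Xw Xv).
Qed.

Lemma ipZr c u w : X u -> X w -> ip w (c *: u) = conjc c * ip w u.
Proof.
move=> Xu Xw; rewrite ipC ?ipZl ?conjcM//; last exact: memZ.
by rewrite -(ipC Xw Xu).
Qed.

Lemma ipNr u w : X u -> X w -> ip w (- u) = - ip w u.
Proof.
move=> Xu Xw; rewrite ipC ?ipNl ?conjcN//; last exact: memN.
by rewrite -(ipC Xw Xu).
Qed.

Lemma ipBr u v w : X u -> X v -> X w -> ip w (u - v) = ip w u - ip w v.
Proof. by move=> *; rewrite ipDr ?ipNr//; exact: memN. Qed.

Lemma Re_ipC u v : X u -> X v -> complex.Re (ip u v) = complex.Re (ip v u).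
Proof. by move=> Xu Xv; rewrite ipC// ReJ. Qed.

(** Over a complex subspace this reduces an identity of inner products to its real part, which is
    why minimization and limits are carried out for real parts only. *)
Lemma Im_ip u v : X u -> X v ->
  complex.Im (ip u v) = complex.Re (ip u ('i *: v)).
Proof. by move=> Xu Xv; rewrite ipZr// ReM ReJ ImJ /=; ring. Qed.

Lemma Im_ip_self u : X u -> complex.Im (ip u u) = 0.
Proof.
move=> Xu; have /(congr1 (@complex.Im R)) := ipC Xu Xu.
by rewrite ImJ; lra.
Qed.

Lemma hnorm_ge0 u : 0 <= nrm u.
Proof. exact: sqrtr_ge0. Qed.

Lemma sqr_hnorm u : X u -> nrm u ^+ 2 = complex.Re (ip u u).
Proof. by move=> Xu; rewrite sqr_sqrtr//; exact: ph_ge0 HX _ _. Qed.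

Lemma sqr_hnormD u v : X u -> X v ->
  nrm (u + v) ^+ 2 = nrm u ^+ 2 + 2 * complex.Re (ip u v) + nrm v ^+ 2.
Proof.
move=> Xu Xv; have XD := memD Xu Xv; rewrite !sqr_hnorm//.
rewrite ipDl// !ipDr// !ReD [complex.Re (ip v u)]Re_ipC//; ring.
Qed.

Lemma sqr_hnormZ c u : X u -> nrm (c *: u) ^+ 2 = cabs c ^+ 2 * nrm u ^+ 2.
Proof.
move=> Xu; have XZ := memZ c Xu; rewrite !sqr_hnorm//.
rewrite ipZl// ipZr// sqr_cabs !(ReM, ImM, ReJ, ImJ) Im_ip_self//; ring.
Qed.

Lemma hnormZ c u : X u -> nrm (c *: u) = cabs c * nrm u.
Proof.
move=> Xu; apply: eqr_of_sqr; rewrite ?mulr_ge0 ?cabs_ge0 ?hnorm_ge0//.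
by rewrite sqr_hnormZ// exprMn.
Qed.

Lemma hnormN u : X u -> nrm (- u) = nrm u.
Proof.
move=> Xu; have XN := memN Xu.
apply: eqr_of_sqr; rewrite ?hnorm_ge0// !sqr_hnorm//.
by rewrite ipNl// ipNr// opprK.
Qed.

Lemma hnormBC u v : X u -> X v -> nrm (u - v) = nrm (v - u).
Proof. by move=> Xu Xv; rewrite -hnormN ?opprB//; exact: memB. Qed.

Lemma hnorm0 : nrm 0 = 0.
Proof. by rewrite /hnorm ip0l ?sqrtr0//; exact: mem0. Qed.

Lemma re_cauchy_schwarz u v : X u -> X v ->
  complex.Re (ip u v) ^+ 2 <= nrm u ^+ 2 * nrm v ^+ 2.
Proof.
move=> Xu Xv; apply: discriminant_le => [|t]; first exact: sqr_ge0.
have Xt := memZ t%:C Xv.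
have := sqr_ge0 (nrm (u + t%:C *: v)); rewrite sqr_hnormD// sqr_hnormZ//.
rewrite sqr_cabs ipZr// ReM ReJ ImJ /=; congr (0 <= _); ring.
Qed.

(* The phase of [ip u v] is absorbed into [v]. *)
Lemma cauchy_schwarz u v : X u -> X v -> cabs (ip u v) <= nrm u * nrm v.
Proof.
move=> Xu Xv; set z := ip u v.
have [->|z0] := eqVneq (cabs z) 0; first by rewrite mulr_ge0 ?hnorm_ge0.
have zp : 0 < cabs z by rewrite lt_neqAle eq_sym z0 cabs_ge0.
have Xz := memZ z Xv.
have := re_cauchy_schwarz Xu Xz; rewrite sqr_hnormZ// ipZr// -/z.
have -> : complex.Re (conjc z * z) = cabs z ^+ 2.
  by rewrite sqr_cabs ReM ReJ ImJ; ring.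
have -> : nrm u ^+ 2 * (cabs z ^+ 2 * nrm v ^+ 2) =
  (nrm u * nrm v) ^+ 2 * cabs z ^+ 2 by ring.
rewrite {1}expr2 ler_pM2r ?exprn_gt0//; apply: ler_of_sqr.
by rewrite mulr_ge0 ?hnorm_ge0.
Qed.

Lemma ler_Re_ip u v : X u -> X v -> `|complex.Re (ip u v)| <= nrm u * nrm v.
Proof.
by move=> Xu Xv; apply: le_trans (cauchy_schwarz Xu Xv); exact: ler_norm_cabs.
Qed.

Lemma ler_hnormD u v : X u -> X v -> nrm (u + v) <= nrm u + nrm v.
Proof.
move=> Xu Xv; apply: ler_of_sqr; first by rewrite addr_ge0 ?hnorm_ge0.
rewrite sqr_hnormD// sqrrD lerD2r lerD2l -[leRHS]mulr_natl.
by rewrite ler_wpM2l// (le_trans (ler_norm _) (ler_Re_ip Xu Xv)).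
Qed.

Lemma ler_hnormB_add u v w : X u -> X v -> X w ->
  nrm (u - w) <= nrm (u - v) + nrm (v - w).
Proof.
move=> Xu Xv Xw; have -> : u - w = (u - v) + (v - w) by rewrite addrA subrK.
by apply: ler_hnormD; exact: memB.
Qed.

Lemma ler_hnorm_null u v : X u -> X v -> nrm (u - v) = 0 -> nrm u <= nrm v.
Proof.
move=> Xu Xv uv; have := ler_hnormD (memB Xu Xv) Xv.
by rewrite subrK uv add0r.
Qed.

Lemma eq_hnorm_null u v : X u -> X v -> nrm (u - v) = 0 -> nrm u = nrm v.
Proof.
move=> Xu Xv uv; apply/eqP; rewrite eq_le !ler_hnorm_null//.
by rewrite hnormBC.
Qed.

(** By Cauchy-Schwarz, null vectors are invisible to the inner product; this and [null_ipr] justify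
    replacing one representative by another. *)
Lemma null_ipl u v : X u -> X v -> nrm u = 0 -> ip u v = 0.
Proof.
move=> Xu Xv u0; apply: cabs_eq0; apply/eqP; rewrite eq_le cabs_ge0 andbT.
by rewrite (le_trans (cauchy_schwarz Xu Xv))// u0 mul0r.
Qed.

Lemma null_ipr u v : X u -> X v -> nrm v = 0 -> ip u v = 0.
Proof.
move=> Xu Xv u0; apply: cabs_eq0; apply/eqP; rewrite eq_le cabs_ge0 andbT.
by rewrite (le_trans (cauchy_schwarz Xu Xv))// u0 mulr0.
Qed.

Lemma nullD u v : X u -> X v -> nrm u = 0 -> nrm v = 0 -> nrm (u + v) = 0.
Proof.
move=> Xu Xv u0 v0; apply/eqP; rewrite eq_le hnorm_ge0 andbT.
by rewrite (le_trans (ler_hnormD Xu Xv))// u0 v0 addr0.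
Qed.

Lemma nullZ c u : X u -> nrm u = 0 -> nrm (c *: u) = 0.
Proof. by move=> Xu u0; rewrite hnormZ// u0 mulr0. Qed.

Lemma ip_eq_Re (S : set H) (f g : H) :
  (forall c v, S v -> S (c *: v)) -> (forall v, S v -> X v) -> X f -> X g ->
  (forall v, S v -> complex.Re (ip f v) = complex.Re (ip g v)) ->
  forall v, S v -> ip f v = ip g v.
Proof.
move=> SZ SX Xf Xg h v Sv; apply: complex_eq; first exact: h.
by rewrite !Im_ip//; [exact/h/SZ|exact: SX..].
Qed.

Section minimization.
Variables (l : H -> R) (M : R).
Hypothesis l_linear : forall (t : R) u v, X u -> X v ->
  l (u + t%:C *: v) = l u + t * l v.
Hypothesis l_bounded : forall u, X u -> `|l u| <= M * nrm u.

Let J u := nrm u ^+ 2 - 2 * l u.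

Let J_ge u : X u -> - M ^+ 2 <= J u.
Proof.
move=> Xu; have := l_bounded Xu; rewrite ler_norml => /andP[_ h].
by have := sqr_ge0 (nrm u - M); rewrite /J sqrrB; lra.
Qed.

(* A minimizing sequence of [nrm u ^+ 2 - 2 * l u] is Cauchy by the
   parallelogram law and satisfies the Euler equation in the limit. *)
Lemma riesz_sequence : exists u : nat -> H,
  [/\ forall n, X (u n), cauchy_for nrm u &
      forall n v, X v ->
        (complex.Re (ip (u n) v) - l v) ^+ 2 <= n.+1%:R^-1 * nrm v ^+ 2].
Proof.
have hinf : has_inf (J @` X).
  split; first by exists (J 0); exists 0 => //; exact: mem0.
  by exists (- M ^+ 2) => _ [u Xu <-]; exact: J_ge.
set m := inf (J @` X).
have mJ u : X u -> m <= J u.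
  by move=> Xu; apply: ge_inf; [exact: hinf.2|exists u].
have hu n : exists u, X u /\ J u < m + n.+1%:R^-1.
  have e0 : (0 : R) < n.+1%:R^-1 by rewrite invr_gt0.
  by have [_ [u Xu <-] h] := inf_adherent e0 hinf; exists u.
have [u uP] := choice hu.
have Xu n : X (u n) by have [] := uP n.
exists u; split=> //; last first.
  move=> n v Xv.
  have Ju := (uP n).2.
  apply: (@le_trans _ _ ((J (u n) - m) * nrm v ^+ 2)); last first.
    by apply: ler_wpM2r; [exact: sqr_ge0|rewrite lerBlDl ltW].
  (* The quadratic polynomial [J (u n + t v) - m] in [t] is nonnegative, and its constant term is
     below [n.+1%:R^-1]. *)
  apply: discriminant_le => [|t]; first exact: sqr_ge0.
  have Xt := memZ t%:C Xv.
  have /mJ := memD (Xu n) Xt.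
  rewrite /J sqr_hnormD// sqr_hnormZ// l_linear// sqr_cabs ipZr//.
  rewrite ReM ReJ ImJ /=.
  by rewrite expr0n /= addr0 oppr0 mul0r subr0 => h; nra.
(* The parallelogram law reads [nrm (u p - u q) ^+ 2 = 2 * J (u p) + 2 * J (u q) - 4 * J h] with [h]
   the midpoint, and [m <= J h]. *)
clearbody m; have close p q : nrm (u p - u q) ^+ 2 < 2 * (p.+1%:R^-1 + q.+1%:R^-1).
  have XD := memD (Xu p) (Xu q).
  have Xh := memZ (2^-1)%:C XD.
  have XN := memN (Xu q).
  have := mJ _ Xh; rewrite /J -[X in l X]add0r l_linear ?sqr_hnormZ//; last exact: mem0.
  have l0 : l 0 = 0.
    have := l_linear 1 mem0 mem0; rewrite scaler0 addr0 mul1r.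
    by move=> h; lra.
  have -> : l (u p + u q) = l (u p) + l (u q).
    by have := l_linear 1 (Xu p) (Xu q); rewrite scale1r mul1r.
  have := (uP p).2; have := (uP q).2; rewrite /J.
  rewrite sqr_cabs /= expr0n /= addr0 l0 add0r !sqr_hnormD// hnormN// ipNr// ReN.
  move: (p.+1%:R^-1) (q.+1%:R^-1) => a b.
  by move=> *; lra.
move=> e e0.
(* Two terms below [e ^+ 2 / 4], doubled by [close], stay below [e ^+ 2]. *)
have e4 : 0 < e ^+ 2 / 4 by rewrite divr_gt0// exprn_gt0.
have [N hN] := invn_small e4; exists N => p q /hN hp /hN hq.
apply: ltr_of_sqr; first exact: ltW.
apply: lt_trans (close p q) _.
by move: hp hq; move: (p.+1%:R^-1) (q.+1%:R^-1) => a b; lra.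
Qed.

End minimization.

Lemma hnorm_cvg_ip (u : nat -> H) f v : (forall n, X (u n)) -> X f -> X v ->
  nrm (u n - f) @[n --> \oo] --> 0 ->
  complex.Re (ip (u n) v) @[n --> \oo] --> complex.Re (ip f v).
Proof.
move=> Xu Xf Xv uf; apply/subr_cvg0; apply/norm_cvg0P.
have XB n : X (u n - f) by exact: memB.
apply: (@squeeze_cvgr _ _ _ _ (fun=> 0) (fun n => nrm (u n - f) * nrm v)).
- apply: nearW => n; rewrite normr_ge0 /= -ReN -ReD -ipBl//.
  exact: ler_Re_ip.
- exact: cvg_cst.
- by rewrite -[X in _ --> X](mul0r (nrm v)); apply: cvgMl.
Qed.

End pre_hilbert_space.

(** * The Riesz representation theorem and density from trivial orthogonal complements *)

Section hilbert_density.
Context {R : realType} {H : lmodType R[i]}.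
Variables (X : set H) (ip : H -> H -> R[i]).
Hypothesis HX : pre_hilbert X ip.
Hypothesis cX : complete_for X (hnorm ip).
Local Notation nrm := (hnorm ip).

Lemma sub_pre_hilbert (S : set H) : S `<=` X -> S 0 ->
  (forall c u v, S u -> S v -> S (c *: u + v)) -> pre_hilbert S ip.
Proof.
move=> SX S0 SZD; split => // [c u v w Su Sv Sw|u v Su Sv|u Su].
- by apply: (ph_linear HX); exact: SX.
- by apply: (ph_conj HX); exact: SX.
- by apply: (ph_ge0 HX); exact: SX.
Qed.

Lemma Re_ip_linear f (t : R) u v : X f -> X u -> X v ->
  complex.Re (ip f (u + t%:C *: v)) =
  complex.Re (ip f u) + t * complex.Re (ip f v).
Proof.
move=> Xf Xu Xv; have Xt := memZ HX t%:C Xv.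
by rewrite (ipDr HX)// (ipZr HX)// ReD ReM ReJ ImJ /= oppr0 mul0r subr0.
Qed.

(** Completeness gives the minimizing sequence a limit, and the approximate Euler equations pass to
    it by continuity of the inner product. *)
Lemma riesz (l : H -> R) (M : R) :
  (forall (t : R) u v, X u -> X v -> l (u + t%:C *: v) = l u + t * l v) ->
  (forall u, X u -> `|l u| <= M * nrm u) ->
  exists2 u, X u & forall v, X v -> complex.Re (ip u v) = l v.
Proof.
move=> ll lb; have [u [Xu cu hu]] := riesz_sequence HX ll lb.
have [f Xf uf] := cX Xu cu; exists f => // v Xv.
have /cvgrPdist_lt h := hnorm_cvg_ip HX Xu Xf Xv uf.
apply/eqP; rewrite -subr_eq0 -normr_eq0; apply/eqP.
apply/eqP; rewrite eq_le normr_ge0 andbT; apply/ler_addgt0Pl => e e0.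
rewrite addr0; have e2 : 0 < e / 2 by rewrite divr_gt0.
have [N _ hN] := h _ e2.
(* The summand 1 keeps the denominator positive when [v] is null. *)
have d0 : 0 < (e / 2) ^+ 2 / (nrm v ^+ 2 + 1).
  by rewrite divr_gt0 ?exprn_gt0// ltr_wpDl ?sqr_ge0.
have [N' hN'] := invn_small d0.
set n := maxn N N'.
have h1 := hN n (leq_maxl _ _).
have h2 : `|complex.Re (ip (u n) v) - l v| < e / 2.
  apply: ltr_of_sqr; first exact: ltW.
  rewrite real_normK ?num_real//.
  apply: le_lt_trans (hu n v Xv) _.
  have := hN' n (leq_maxr _ _); rewrite ltr_pdivlMr ?ltr_wpDl ?sqr_ge0//.
  apply: le_lt_trans; rewrite ler_wpM2l ?invr_ge0// lerDl//.
have := ltW (ltrD h1 h2); rewrite -splitr; apply: le_trans.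
have -> : complex.Re (ip f v) - l v = complex.Re (ip f v) -
  complex.Re (ip (u n) v) + (complex.Re (ip (u n) v) - l v) by ring.
exact: ler_normD.
Qed.

(* The Riesz sequence of [ip f _] in [S] converges to the orthogonal projection
   of [f] on the closure of [S]. *)
Lemma orthogonal_dense (S : set H) : S `<=` X -> S 0 ->
  (forall c u v, S u -> S v -> S (c *: u + v)) ->
  (forall f, X f -> (forall v, S v -> ip f v = 0) -> nrm f = 0) ->
  forall f e, X f -> 0 < e -> exists2 v, S v & nrm (f - v) < e.
Proof.
move=> SX S0 SZD hS f e Xf e0.
have HS := sub_pre_hilbert SX S0 SZD.
have [|u [Su cu hu]] := @riesz_sequence _ _ S ip HS
    (fun v => complex.Re (ip f v)) (nrm f) _ (fun v Sv => ler_Re_ip HX Xf (SX _ Sv)).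
  by move=> t v w /SX Xv /SX Xw; exact: Re_ip_linear.
have Xu n : X (u n) by exact: SX.
have [g Xg ug] := cX Xu cu.
have Xfg := memB HX Xf Xg.
have Xgf := memB HX Xg Xf.
have nfg : nrm (f - g) = 0.
  rewrite (hnormBC HX)//; apply: hS => // v Sv.
  have <- := ip0l HX (SX _ Sv).
  apply: (ip_eq_Re HX (S := S)) => //; [exact: memZ HS|exact: mem0 HX|].
  move=> {Sv}v Sv; have Xv := SX _ Sv.
  rewrite (ip0l HX)//= (ipBl HX)// ReD ReN; apply/eqP.
  rewrite subr_eq0; apply/eqP.
  have h1 := hnorm_cvg_ip HX Xu Xg Xv ug.
  apply: (cvg_unique _ h1) => //; apply/cvgrPdist_lt => d d0.
  have d1 : 0 < d ^+ 2 / (nrm v ^+ 2 + 1).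
    by rewrite divr_gt0 ?exprn_gt0// ltr_wpDl ?sqr_ge0.
  have [N hN] := invn_small d1; exists N => // n /= Nn.
  rewrite distrC; apply: ltr_of_sqr; first exact: ltW.
  rewrite real_normK ?num_real//; apply: le_lt_trans (hu n v Sv) _.
  have := hN n Nn; rewrite ltr_pdivlMr ?ltr_wpDl ?sqr_ge0//.
  by apply: le_lt_trans; rewrite ler_wpM2l ?invr_ge0// lerDl//.
have /cvg0P h : nrm (u n - g) @[n --> \oo] --> 0 := ug.
have [|N hN] := h _ e e0; first by move=> n; exact: hnorm_ge0.
exists (u N) => //; apply: le_lt_trans (ler_hnormB_add HX Xf Xg (Xu N)) _.
by rewrite nfg add0r (hnormBC HX)//; exact: hN.
Qed.

End hilbert_density.

(** * Powers of the operator of a closed form *)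

Section energy_space.
Context {R : realType} {H : lmodType R[i]}.

Definition energy_ip (ip q : H -> H -> R[i]) u v := ip u v + q u v.

(* A nonnegative closed form [q] with domain [V] in the Hilbert space [X], up to
   vectors of norm 0; density of [V] is used through its trivial orthogonal. *)
Record energy_form (X V : set H) (ip q : H -> H -> R[i]) : Prop := EnergyForm {
  ef_X : pre_hilbert X ip;
  ef_complete : complete_for X (hnorm ip);
  ef_sub : V `<=` X;
  ef_V : pre_hilbert V q;
  ef_dense : forall f, X f -> (forall v, V v -> ip f v = 0) -> hnorm ip f = 0;
  ef_null : forall z, X z -> hnorm ip z = 0 -> V z /\ hnorm q z = 0;
  ef_closed : complete_for V (hnorm (energy_ip ip q)) }.

Definition energy_operator (X V : set H) (ip q : H -> H -> R[i]) : operator H :=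
  fun u f => [/\ V u, X f & forall v, V v -> - q u v = ip f v].

Variables (X V : set H) (ip q : H -> H -> R[i]).
Hypothesis E : energy_form X V ip q.
Local Notation nrm := (hnorm ip).
Local Notation L := (energy_operator X V ip q).
Local Notation P := (opow X ip L).
Let HX := ef_X E.
Let cX := ef_complete E.
Let HV := ef_V E.
Let VX := ef_sub E.
Let eip := energy_ip ip q.
Let XB := memB HX.
Let XN := memN HX.
Let XZ := memZ HX.

Lemma energy_pre_hilbert : pre_hilbert V eip.
Proof.
split; [exact: mem0 HV|exact: (ph_memZD HV)| | |].
- move=> c u v w Vu Vv Vw; rewrite /eip /energy_ip.
  by rewrite (ph_linear HX) ?(ph_linear HV)//; [ring|exact: VX..].
- move=> u v Vu Vv; rewrite /eip /energy_ip conjcD.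
  by rewrite -(ph_conj HV)// -(ph_conj HX)//; exact: VX.
- move=> u Vu; rewrite ReD addr_ge0//; first exact: ph_ge0 HX _ (VX Vu).
  exact: ph_ge0 HV _ Vu.
Qed.
Let HE := energy_pre_hilbert.

Lemma sqr_energy_norm u : V u ->
  hnorm eip u ^+ 2 = nrm u ^+ 2 + complex.Re (q u u).
Proof.
move=> Vu; rewrite (sqr_hnorm HE)// (sqr_hnorm HX) ?ReD//.
exact: VX.
Qed.

Lemma energy_op_dom u f : L u f -> X u /\ X f.
Proof. by case=> /VX. Qed.

Lemma energy_op_linear c u f v g : L u f -> L v g ->
  L (c *: u + v) (c *: f + g).
Proof.
move=> [Vu Xf uf] [Vv Xg vg]; split.
- exact: (ph_memZD HV).
- exact: (ph_memZD HX).
- move=> w Vw; rewrite (ph_linear HV)// (ph_linear HX)//; last exact: VX.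
  by rewrite -uf// -vg//; ring.
Qed.

Lemma energy_op_null z w : X z -> X w -> nrm z = 0 -> nrm w = 0 -> L z w.
Proof.
move=> Xz Xw z0 w0; have [Vz qz0] := ef_null E Xz z0.
split=> // v Vv; have Xv := VX Vv.
by rewrite (null_ipl HV)// (null_ipl HX)// oppr0.
Qed.

(** Density of [V] enters here: together with linearity it makes [L] single-valued modulo null
    vectors. *)
Lemma energy_op_fun u f : L u f -> nrm u = 0 -> nrm f = 0.
Proof.
move=> [Vu Xf uf] u0; apply: (ef_dense E) => // v Vv; rewrite -uf//.
have [_ qu0] := ef_null E (VX Vu) u0.
by rewrite (null_ipl HV)// oppr0.
Qed.

Lemma energy_op_sym u f v g : L u f -> L v g -> ip f v = ip u g.
Proof.
move=> [Vu Xf uf] [Vv Xg vg]; rewrite -uf// (ph_conj HX) -?vg//; last exact: VX.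
by rewrite conjcN -(ph_conj HV).
Qed.

Lemma energy_op_neg u f : L u f -> complex.Re (ip f u) = - complex.Re (q u u).
Proof. by move=> [Vu Xf uf]; rewrite -uf// ReN. Qed.

(** The relation [L u (u - f)] encodes [(1 - L) u = f]. Riesz in the energy space represents the
    functional [ip f], whose bound holds because the energy norm dominates [nrm]. *)
Lemma resolvent_exists f : X f -> exists u, L u (u - f).
Proof.
move=> Xf.
have [| |u Vu hu] := @riesz _ _ V eip HE (ef_closed E)
    (fun v => complex.Re (ip f v)) (nrm f).
- by move=> t u v /VX Xu /VX Xv; exact: (Re_ip_linear HX).
- move=> u Vu; apply: le_trans (ler_Re_ip HX Xf (VX Vu)) _.
  apply: ler_wpM2l; first exact: hnorm_ge0.
  apply: ler_of_sqr; first exact: hnorm_ge0.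
  by rewrite sqr_energy_norm// lerDl (ph_ge0 HV).
have Xu := VX Vu.
exists u; split=> //; first exact: XB.
have h v : V v -> eip u v = ip f v.
  move=> Vv; apply: complex_eq; first exact: hu.
  rewrite (Im_ip HE)// (Im_ip HX)//; last exact: VX.
  by apply: hu; exact: memZ HV _ _ Vv.
move=> v Vv; rewrite (ipBl HX)//; last exact: VX.
by rewrite -h// /eip /energy_ip; ring.
Qed.

(** The kernel of [1 - L] is trivial because [L] is nonpositive: [nrm u ^+ 2] equals minus the
    nonnegative real part of [q u u]. *)
Lemma resolvent_unique u : L u u -> nrm u = 0.
Proof.
move=> Lu; have [Xu _] := energy_op_dom Lu.
have := energy_op_neg Lu; rewrite -(sqr_hnorm HX)//.
case: Lu => Vu _ _; have q0 := ph_ge0 HV Vu.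
move=> h; apply/eqP; rewrite -sqrf_eq0 eq_le sqr_ge0 andbT h oppr_le0//.
Qed.

Lemma opow_dom k u f : P k u f -> X u /\ X f.
Proof.
elim: k u f => [|k IH] u f /=; first by case.
by move=> [g /IH[Xu _] /energy_op_dom[_]].
Qed.

Lemma opow_linear k c u f v g : P k u f -> P k v g ->
  P k (c *: u + v) (c *: f + g).
Proof.
elim: k u f v g => [|k IH] u f v g /=.
  move=> [Xu Xf uf] [Xv Xg vg]; split; [exact: (ph_memZD HX)..|].
  rewrite opprD addrACA -scalerBr; apply: (nullD HX) => //.
  - by apply: XZ; exact: XB.
  - exact: XB.
  - by apply: (nullZ HX) => //; exact: XB.
move=> [u' uu' u'f] [v' vv' v'g].
exists (c *: u' + v'); first exact: IH.
exact: energy_op_linear.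
Qed.

Lemma opowB k u f v g : P k u f -> P k v g -> P k (u - v) (f - g).
Proof.
move=> uf vg; have := opow_linear (-1) vg uf.
by rewrite !scaleN1r ![- _ + _]addrC.
Qed.

Lemma opow_null k z w : X z -> X w -> nrm z = 0 -> nrm w = 0 -> P k z w.
Proof.
elim: k z w => [|k IH] z w Xz Xw z0 w0 /=.
  by split=> //; apply: (nullD HX) => //;
    [exact: XN|rewrite (hnormN HX)].
by exists w; [exact: IH|exact: energy_op_null].
Qed.

Lemma opow_fun k u f : P k u f -> nrm u = 0 -> nrm f = 0.
Proof.
elim: k f => [|k IH] f /=; last first.
  by move=> [g /IH ug gf] /ug; exact: energy_op_fun.
move=> [Xu Xf uf] u0; have -> : f = - (u - f) + u by rewrite opprB subrK.
apply: (nullD HX) => //; last by rewrite (hnormN HX)//; exact: XB.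
by apply: XN; exact: XB.
Qed.

Lemma opow_unique k u f g : P k u f -> P k u g -> nrm (f - g) = 0.
Proof.
move=> uf ug; apply: opow_fun (opowB uf ug) _; rewrite subrr; exact: hnorm0 HX.
Qed.

(** Pairs of null vectors lie in every power, so subtracting one changes representatives on both
    sides. *)
Lemma opow_subst k u f u' f' : P k u f -> X u' -> X f' ->
  nrm (u - u') = 0 -> nrm (f - f') = 0 -> P k u' f'.
Proof.
move=> uf Xu' Xf' uu' ff'; have [Xu Xf] := opow_dom uf.
have N : P k (u - u') (f - f').
  by apply: opow_null => //; exact: XB.
by have := opowB uf N; rewrite !subKr.
Qed.

Lemma energy_op_subst u f u' f' : L u f -> X u' -> X f' ->
  nrm (u - u') = 0 -> nrm (f - f') = 0 -> L u' f'.
Proof.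
move=> uf Xu' Xf' uu' ff'; have [Xu Xf] := energy_op_dom uf.
have N : L (u - u') (f - f') by apply: energy_op_null => //; exact: XB.
have := energy_op_linear (-1) N uf.
by rewrite !scaleN1r ![- _ + _]addrC !subKr.
Qed.

Lemma opow0 u : X u -> P 0 u u.
Proof. by move=> Xu; split=> //; rewrite subrr; exact: hnorm0 HX. Qed.

Lemma opow1 u f : L u f -> P 1 u f.
Proof. by move=> uf; exists u => //; apply: opow0; have [] := energy_op_dom uf. Qed.

Lemma opow_add m n u f g : P m u g -> P n g f -> P (m + n) u f.
Proof.
move=> ug; elim: n f => [|n IH] f /=.
  move=> [Xg Xf gf]; rewrite addn0; have [Xu _] := opow_dom ug.
  apply: opow_subst ug _ _ _ _ => //.
  by rewrite subrr; exact: hnorm0 HX.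
by move=> [h /IH uh hf]; rewrite addnS; exists h.
Qed.

Lemma opow_split m n u f : P (m + n) u f -> exists2 g, P m u g & P n g f.
Proof.
elim: n f => [|n IH] f /=.
  by rewrite addn0 => uf; exists f => //; apply: opow0; have [] := opow_dom uf.
rewrite addnS /= => -[h /IH[g ug gh] hf].
by exists g => //; exists h.
Qed.

Lemma opow1_inv u f : P 1 u f -> L u f.
Proof.
move=> [g [Xu Xg ug] gf]; have [_ Xf] := energy_op_dom gf.
apply: energy_op_subst gf _ _ _ _ => //; first by rewrite (hnormBC HX).
by rewrite subrr; exact: hnorm0 HX.
Qed.

(** By definition [opow] unfolds at the last application of [L]; this and [opowSl_inv] give access
    to the first one. *)
Lemma opowSl k u f g : L u g -> P k g f -> P k.+1 u f.
Proof. by move=> /opow1 ug gf; have := opow_add ug gf. Qed.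

Lemma opowSl_inv k u f : P k.+1 u f -> exists2 g, L u g & P k g f.
Proof.
by rewrite -add1n => /opow_split[g /opow1_inv ug gf]; exists g.
Qed.

(** The last [L] on the side of [u] is moved over to become the first one on the side of [v]. *)
Lemma opow_symmetric k u f v g : P k u f -> P k v g -> ip f v = ip u g.
Proof.
elim: k u f v g => [|k IH] u f v g.
  move=> [Xu Xf uf] [Xv Xg vg].
  have h1 : ip (u - f) v = 0 by apply: (null_ipl HX) => //; exact: XB.
  have h2 : ip u (v - g) = 0 by apply: (null_ipr HX) => //; exact: XB.
  move/eqP: h1; move/eqP: h2; rewrite (ipBl HX)// (ipBr HX)//.
  by rewrite !subr_eq0 => /eqP <- /eqP <-.
move=> [u' uu' u'f] /opowSl_inv[v' vv' v'g].
by rewrite (energy_op_sym u'f vv'); exact: IH.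
Qed.

(** The resolvent commutes with [L ^ k]: here [v] and [psi] are the resolvents of [w] and of
    [phi = L ^ k w]. In particular it maps the domain of [L ^ k] into that of [L ^ k.+1]. *)
Lemma opow_resolvent k w phi v psi : P k w phi -> L v (v - w) ->
  L psi (psi - phi) -> P k v psi.
Proof.
elim: k phi psi => [|k IH] phi psi.
  move=> [Xw Xphi wphi] Lv Lpsi.
  have [Xv _] := energy_op_dom Lv; have [Xpsi _] := energy_op_dom Lpsi.
  split=> //; apply: resolvent_unique.
  have Lw := energy_op_linear (-1) Lpsi Lv.
  apply: energy_op_subst Lw _ _ _ _; rewrite ?scaleN1r; [exact: XB..| |].
    rewrite [- _ + _]addrC subrr; exact: hnorm0 HX.
  have -> : - (psi - phi) + (v - w) - (v - psi) = - (w - phi).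
    apply/eqP; rewrite subr_eq addrC !opprB addrACA [v + phi]addrC.
    by rewrite -addrACA.
  by rewrite (hnormN HX)//; exact: XB.
move=> [phi' wphi' phi'phi] Lv Lpsi.
have [_ Xphi'] := opow_dom wphi'.
have [psi' Lpsi'] := resolvent_exists Xphi'.
exists psi'; first exact: IH Lpsi'.
have [Xpsi' _] := energy_op_dom Lpsi'; have [Xpsi Xpp] := energy_op_dom Lpsi.
apply: (energy_op_subst Lpsi') => //.
  by rewrite subrr; exact: hnorm0 HX.
(* The discrepancy [psi' - phi' - psi] between the two candidates for [L psi'] is fixed by [L],
   hence null. *)
apply: resolvent_unique.
have L1 := energy_op_linear (-1) phi'phi Lpsi'.
have L2 := energy_op_linear (-1) Lpsi L1.
move: L2; rewrite !scaleN1r ![- _ + _]addrC; congr (L _ _).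
by rewrite opprB addrA subrK.
Qed.

(* With [R] the resolvent [(1 - L)^-1], the hypothesis applied to [R w] for [w]
   in the domain of [L ^ k] becomes the same hypothesis for [R g - g], [R f] and
   the exponent [k]; one then recovers [g] as [R g - (R g - g)]. *)
Lemma opow_self_adjoint k g f : X g -> X f ->
  (forall v phi, P k v phi -> ip g phi = ip f v) -> P k g f.
Proof.
elim: k g f => [|k IH] g f Xg Xf h.
  split=> //; apply/eqP; rewrite -sqrf_eq0 (sqr_hnorm HX); last exact: XB.
  have Xgf := XB Xg Xf.
  by rewrite (ipBl HX)// (h _ _ (opow0 Xgf)) subrr.
have [y Ly] := resolvent_exists Xg; have [z Lz] := resolvent_exists Xf.
have [Xy Xyg] := energy_op_dom Ly; have [Xz Xzf] := energy_op_dom Lz.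
have Pyz : P k (y - g) z.
  apply: IH => // w phi wphi; have [Xw Xphi] := opow_dom wphi.
  have [v Lv] := resolvent_exists Xw; have [psi Lpsi] := resolvent_exists Xphi.
  have [Xv Xvw] := energy_op_dom Lv; have [Xpsi Xpp] := energy_op_dom Lpsi.
  have := h v (psi - phi); have Pv := opow_resolvent wphi Lv Lpsi.
  have P1 : P k.+1 v (psi - phi) by exists psi.
  move=> /(_ P1).
  (* Symmetry of [L] becomes symmetry of the resolvent: [ip z w = ip f v] and
     [ip y phi = ip g psi]. *)
  have := energy_op_sym Ly Lpsi; have := energy_op_sym Lz Lv.
  rewrite !(ipBl HX, ipBr HX)// => e1 e2 e3.
  have -> : ip z w = ip f v.
    by apply: oppr_inj; apply: (addrI (ip z v)); rewrite e1.
  rewrite -e3.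
  have -> : ip g psi = ip y phi.
    by apply: oppr_inj; apply: (addrI (ip y psi)); rewrite e2.
  by [].
have P1 : P k.+1 (y - g) (z - f) by exists z.
have P2 : P k.+1 y z by apply: opowSl Ly _.
by have := opowB P2 P1; rewrite !subKr.
Qed.

(** Shaped like [neumann_form], so that the two are convertible once [L] is the Neumann
    Laplacian. *)
Definition opow_form k  : Defs.form H :=
 Form (odom (P k)) (fun u v => ip (Defs.oapp (P k) u) (Defs.oapp (P k) v)).
Local Notation A k := (Defs.oapp (P k)).
Local Notation b k := (opow_form k).

Lemma oapp_opow k u : odom (P k) u -> P k u (A k u).
Proof. by move=> [f uf]; apply: xgetPex; exists f. Qed.

Lemma oapp_opow_mem k u : odom (P k) u -> X u /\ X (A k u).
Proof. by move=> /oapp_opow/opow_dom. Qed.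

Lemma odom_opow_sub k : odom (P k) `<=` X.
Proof. by move=> u /oapp_opow_mem[]. Qed.

Lemma odom_opow0 k : odom (P k) 0.
Proof.
by exists 0; apply: opow_null; rewrite ?(hnorm0 HX)//; exact: mem0 HX.
Qed.

Lemma odom_opow_linear k c u v : odom (P k) u -> odom (P k) v ->
  odom (P k) (c *: u + v).
Proof. by move=> [f uf] [g vg]; exists (c *: f + g); exact: opow_linear. Qed.

Lemma odom_opowB k u v : odom (P k) u -> odom (P k) v -> odom (P k) (u - v).
Proof. by move=> [f uf] [g vg]; exists (f - g); exact: opowB. Qed.

Lemma opow_oapp_null k u f : P k u f -> nrm (A k u - f) = 0.
Proof.
move=> uf; have du : odom (P k) u by exists f.
exact: opow_unique (oapp_opow du) uf.
Qed.

(** Inside an inner product the value chosen by [oapp] may be replaced by any other value of the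
    relation. *)
Lemma ip_oapp k u f v : P k u f -> X v -> ip (A k u) v = ip f v.
Proof.
move=> uf Xv; have du : odom (P k) u by exists f.
have [_ XA] := oapp_opow_mem du; have [_ Xf] := opow_dom uf.
apply/eqP; rewrite -subr_eq0 -(ipBl HX)//; apply/eqP.
by apply: (null_ipl HX) => //; [exact: XB|exact: opow_oapp_null].
Qed.

(** With lower bound 0 the form norm is the graph norm of [L ^ k]. *)
Lemma sqr_fnorm_opow k u : odom (P k) u ->
  fnorm ip (b k) 0 u ^+ 2 = nrm (A k u) ^+ 2 + nrm u ^+ 2.
Proof.
move=> du; have [Xu XA] := oapp_opow_mem du.
rewrite /fnorm /= subr0 mul1r -(sqr_hnorm HX)// sqr_sqrtr//.
by rewrite addr_ge0// sqr_ge0.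
Qed.

Lemma fnorm_ge0 (B  : Defs.form H) l u : 0 <= fnorm ip B l u.
Proof. exact: sqrtr_ge0. Qed.

Lemma nrm_oapp_le_fnorm k u : odom (P k) u -> nrm (A k u) <= fnorm ip (b k) 0 u.
Proof.
move=> du; apply: ler_of_sqr; first exact: fnorm_ge0.
by rewrite sqr_fnorm_opow// lerDl sqr_ge0.
Qed.

Lemma nrm_le_fnorm k u : odom (P k) u -> nrm u <= fnorm ip (b k) 0 u.
Proof.
move=> du; apply: ler_of_sqr; first exact: fnorm_ge0.
by rewrite sqr_fnorm_opow// lerDr sqr_ge0.
Qed.

(** If [f] is orthogonal to the domain of [L ^ k.+1], its resolvent [y] is orthogonal to the domain
    of [L ^ k], since the resolvent is symmetric and raises the exponent. So [y] is null, and with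
    it [f = y - L y]. *)
Lemma opow_orthogonal k f : X f ->
  (forall v, odom (P k) v -> ip f v = 0) -> nrm f = 0.
Proof.
elim: k f => [|k IH] f Xf h.
  apply/eqP; rewrite -sqrf_eq0 (sqr_hnorm HX)// h//.
  by exists f; exact: opow0.
have [y Ly] := resolvent_exists Xf; have [Xy Xyf] := energy_op_dom Ly.
have y0 : nrm y = 0.
  apply: IH => // w [phi wphi]; have [Xw Xphi] := opow_dom wphi.
  have [v Lv] := resolvent_exists Xw; have [psi Lpsi] := resolvent_exists Xphi.
  have [Xv Xvw] := energy_op_dom Lv.
  have := energy_op_sym Ly Lv; rewrite (ipBl HX)// (ipBr HX)// => /addrI.
  move=> /oppr_inj <-; apply: h; exists (psi - phi); exists psi => //.
  exact: opow_resolvent wphi Lv Lpsi.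
rewrite -(subKr y f); apply: (nullD HX) => //; first exact: XN.
rewrite (hnormN HX)//; exact: energy_op_fun Ly y0.
Qed.

Lemma opow_dense k f e : X f -> 0 < e ->
  exists2 v, odom (P k) v & nrm (f - v) < e.
Proof.
apply: (orthogonal_dense HX cX); [exact: odom_opow_sub|exact: odom_opow0|
  exact: odom_opow_linear|exact: opow_orthogonal].
Qed.

Lemma odom_opow_form k : odom (P k.+1) `<=` V.
Proof. by move=> u [f /opowSl_inv[g [Vu _ _] _]]. Qed.

(** For [v] the resolvent of [w] one has [eip v f = ip w f]. Energy-orthogonality to the domain of
    [L ^ k.+1] thus becomes orthogonality in [X] to the domain of [L ^ k]. *)
Lemma opow_energy_dense k f e : V f -> 0 < e ->
  exists2 v, odom (P k.+1) v & hnorm eip (f - v) < e.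
Proof.
apply: (orthogonal_dense HE (ef_closed E)); [exact: odom_opow_form|
  exact: odom_opow0|exact: odom_opow_linear|].
move=> {}f Vf h; have Xf := VX Vf.
have f0 : nrm f = 0.
  apply: (opow_orthogonal (k := k)) => // w [phi wphi].
  have [Xw Xphi] := opow_dom wphi.
  have [v Lv] := resolvent_exists Xw; have [psi Lpsi] := resolvent_exists Xphi.
  have dv : odom (P k.+1) v.
    exists (psi - phi); exists psi => //.
    exact: opow_resolvent wphi Lv Lpsi.
  have Vv := odom_opow_form dv; have Xv := VX Vv.
  have [_ _ hv] := Lv; have := h _ dv; rewrite /eip /energy_ip.
  rewrite (ph_conj HX)// (ph_conj HV)// -conjcD.
  have := hv _ Vf; rewrite (ipBl HX)// => /(congr1 -%R); rewrite opprK => ->.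
  rewrite opprB addrC subrK => h1.
  by rewrite (ph_conj HX).
have [_ q0] := ef_null E Xf f0.
apply/eqP; rewrite -sqrf_eq0 sqr_energy_norm// f0 -(sqr_hnorm HV)// q0.
by rewrite expr0n addr0.
Qed.

(* Log-convexity: [nrm (L u) ^+ 2 <= nrm u * nrm (L (L u))]. *)
Lemma opow_interpolation k u g f : L u g -> P k g f ->
  nrm g <= Num.max (nrm u) (nrm f).
Proof.
elim: k u g => [|k IH] u g ug.
  move=> [Xg Xf gf]; rewrite le_max; apply/orP; right.
  have := ler_hnormD HX (XB Xg Xf) Xf; by rewrite subrK gf add0r.
move=> /opowSl_inv[h gh hf]; have [Xu Xg] := energy_op_dom ug.
have [_ Xh] := energy_op_dom gh.
have := IH _ _ gh hf; have e : nrm g ^+ 2 <= nrm u * nrm h.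
  rewrite (sqr_hnorm HX)// (energy_op_sym ug gh).
  exact: le_trans (ler_norm _) (ler_Re_ip HX Xu Xh).
have g0 := hnorm_ge0 ip g; have u0 := hnorm_ge0 ip u.
have f0 := hnorm_ge0 ip f.
(* The induction hypothesis bounds [nrm h] by [nrm g] or by [nrm f]. In the first case divide
   [nrm g ^+ 2 <= nrm u * nrm g] by [nrm g]; in the second, [nrm g] exceeding both [nrm u] and
   [nrm f] would contradict [e]. *)
rewrite le_max => /orP[hg|hf'].
  have [->|gn0] := eqVneq (nrm g) 0; first by rewrite le_max u0.
  rewrite le_max -(ler_pM2r (x := nrm g)) ?lt_neqAle ?[0 == _]eq_sym ?gn0//.
  by rewrite -expr2 (le_trans e)// ler_wpM2l.
rewrite leNgt gt_max; apply/negP => /andP[h1 h2].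
by have : nrm u * nrm h < nrm g ^+ 2; nra.
Qed.

(** With [a] the norm of [L ^ k.+1 u], interpolation gives [q u u <= nrm (L u) * nrm u <= (nrm u +
    a) * nrm u]. The squared energy norm is then at most [4 * (nrm u ^+ 2 + a ^+ 2)], whence the
    constant 2. *)
Lemma energy_norm_le_fnorm k u : odom (P k.+1) u ->
  hnorm eip u <= 2 * fnorm ip (b k.+1) 0 u.
Proof.
move=> du; have Vu := odom_opow_form du; have Xu := VX Vu.
apply: ler_of_sqr; first by rewrite mulr_ge0// fnorm_ge0.
rewrite exprMn sqr_fnorm_opow// sqr_energy_norm//.
have [g ug gf] := opowSl_inv (oapp_opow du).
have := energy_op_neg ug; have [_ Xg] := energy_op_dom ug.
have := ler_Re_ip HX Xg Xu; rewrite ler_norml => /andP[h1 _] h2.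
have := opow_interpolation ug gf; rewrite le_max => h3.
have u0 := hnorm_ge0 ip u; have a0 := hnorm_ge0 ip (A k.+1 u).
have g0 := hnorm_ge0 ip g.
have : nrm g * nrm u <= (nrm u + nrm (A k.+1 u)) * nrm u.
  by apply: ler_wpM2r => //; case/orP: h3 => h3; lra.
have := sqr_ge0 (nrm u - nrm (A k.+1 u)); rewrite sqrrB.
by have := sqr_ge0 (nrm u); have := sqr_ge0 (nrm (A k.+1 u)); nra.
Qed.

Lemma opow_form_sesquilinear k : Defs.sesquilinear X ip (b k).
Proof.
split; [exact: odom_opow_sub|split; [exact: odom_opow0|exact: odom_opow_linear]| |].
- move=> c u v w du dv dw /=.
  have [_ Au] := oapp_opow_mem du; have [_ Av] := oapp_opow_mem dv.
  have [_ Aw] := oapp_opow_mem dw.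
  have Puv := opow_linear c (oapp_opow du) (oapp_opow dv).
  have duv := odom_opow_linear c du dv; have [_ Auv] := oapp_opow_mem duv.
  have e : ip (A k (c *: u + v)) (A k w) = c * ip (A k u) (A k w) + ip (A k v) (A k w).
    by rewrite (ip_oapp Puv)// (ph_linear HX).
  split=> //; rewrite (ph_conj HX)// e conjcD conjcM.
  by rewrite -!(ph_conj HX).
- move=> z Xz z0; have Pz : P k z 0.
    by apply: opow_null; rewrite ?(hnorm0 HX)//; exact: mem0 HX.
  split; first by exists 0.
  move=> v dv /=; have [_ Av] := oapp_opow_mem dv.
  have e : ip (A k z) (A k v) = 0 by rewrite (ip_oapp Pz)// (ip0l HX).
  split=> //; rewrite (ph_conj HX)// ?e; last first.
    by have [] := @oapp_opow_mem k z (ex_intro _ _ Pz).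
  by apply: complex_eq; rewrite ?ReJ ?ImJ//= oppr0.
Qed.

Lemma opow_form_semibounded k : semibounded ip (b k) 0.
Proof.
move=> u du; have [_ Au] := oapp_opow_mem du.
by rewrite mul0r -(sqr_hnorm HX)// sqr_ge0.
Qed.

Lemma opow_form_continuous k : continuous_form ip (b k) 0.
Proof.
exists 1 => u v du dv; rewrite mul1r.
have [_ Au] := oapp_opow_mem du; have [_ Av] := oapp_opow_mem dv.
apply: le_trans (cauchy_schwarz HX Au Av) _.
by apply: ler_pM; rewrite ?hnorm_ge0 ?nrm_oapp_le_fnorm.
Qed.

(** A Cauchy sequence for the graph norm has limits [u] of the vectors and [g] of their images.
    Symmetry passes to the limit and is then the hypothesis of [opow_self_adjoint] for [u] and
    [g]. *)
Lemma opow_form_closed k : closed_form ip (b k) 0.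
Proof.
move=> u_ du cu.
(* The chosen values are additive only modulo null vectors, so just the norms agree. *)
have nA m n : nrm (A k (u_ m) - A k (u_ n)) = nrm (A k (u_ m - u_ n)).
  have dB := odom_opowB (du m) (du n).
  have [_ Xm] := oapp_opow_mem (du m); have [_ Xn] := oapp_opow_mem (du n).
  have [_ Xd] := oapp_opow_mem dB.
  have e := opow_oapp_null (opowB (oapp_opow (du m)) (oapp_opow (du n))).
  by apply/esym/(eq_hnorm_null HX) => //; exact: XB.
have Xu n : X (u_ n) by have [] := oapp_opow_mem (du n).
have XA n : X (A k (u_ n)) by have [] := oapp_opow_mem (du n).
have [|u Xu' hu] := cX Xu.
  move=> e /cu[n0 hn0]; exists n0 => m n hm hn.
  apply: le_lt_trans (hn0 m n hm hn); apply: nrm_le_fnorm.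
  exact: (odom_opowB (du m) (du n)).
have [|g Xg hg] := cX XA.
  move=> e /cu[n0 hn0]; exists n0 => m n hm hn.
  apply: le_lt_trans (hn0 m n hm hn); rewrite nA; apply: nrm_oapp_le_fnorm.
  exact: (odom_opowB (du m) (du n)).
have Pug : P k u g.
  apply: opow_self_adjoint => // v phi vphi; have [Xv Xphi] := opow_dom vphi.
  have hRe w psi : P k w psi -> complex.Re (ip u psi) = complex.Re (ip g w).
    move=> wpsi; have [Xw Xpsi] := opow_dom wpsi.
    have h1 := hnorm_cvg_ip HX Xu Xu' Xpsi hu.
    have h2 := hnorm_cvg_ip HX XA Xg Xw hg.
    apply: (cvg_unique _ h1) => //; rewrite (_ : (fun n => _) =
      (fun n => complex.Re (ip (A k (u_ n)) w))) //.
    by apply/funext => n; rewrite (opow_symmetric (oapp_opow (du n)) wpsi).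
  apply: complex_eq; first exact: hRe.
  rewrite !(Im_ip HX)//; apply: hRe.
  have P0 : P k 0 0 by apply: opow_null; rewrite ?(hnorm0 HX)//; exact: mem0 HX.
  by have := opow_linear 'i vphi P0; rewrite !addr0.
have du' : odom (P k) u by exists g.
exists u => //.
have nAu n : nrm (A k (u_ n - u)) <= nrm (A k (u_ n) - g).
  have dB := odom_opowB (du n) du'; have [_ Xd] := oapp_opow_mem dB.
  have e := opow_oapp_null (opowB (oapp_opow (du n)) Pug).
  by apply: (ler_hnorm_null HX) => //; exact: XB.
apply/cvg0P => [n|e e0]; first exact: fnorm_ge0.
have e2 : 0 < e / 2 by rewrite divr_gt0.
have /cvg0P hu' := hu; have /cvg0P hg' := hg.
have [|N1 hN1] := hu' _ _ e2; first by move=> n; exact: hnorm_ge0.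
have [|N2 hN2] := hg' _ _ e2; first by move=> n; exact: hnorm_ge0.
exists (maxn N1 N2) => n; rewrite geq_max => /andP[/hN1 h1 /hN2 h2].
apply: ltr_of_sqr; first exact: ltW.
rewrite sqr_fnorm_opow; last exact: (odom_opowB (du n) du').
have h3 := le_lt_trans (nAu n) h2.
have a0 := hnorm_ge0 ip (A k (u_ n - u)); have b0 := hnorm_ge0 ip (u_ n - u).
have -> : e = e / 2 + e / 2 by rewrite -splitr.
have : nrm (A k (u_ n - u)) ^+ 2 < (e / 2) ^+ 2 by rewrite ltr_pXn2r ?nnegrE// ltW.
have : nrm (u_ n - u) ^+ 2 < (e / 2) ^+ 2 by rewrite ltr_pXn2r ?nnegrE// ltW.
have := sqr_ge0 (e / 2); move: (e / 2) => t; rewrite sqrrD.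
by rewrite -mulr_natl; move: (nrm _ ^+ 2) (nrm _ ^+ 2) => a b; rewrite -expr2; lra.
Qed.

Lemma opow_form_generating k : generating X ip (b k).
Proof.
split; first exact: opow_form_sesquilinear.
  split; first exact: odom_opow_sub.
  by move=> u e Xu e0; exact: opow_dense.
exists 0; split; [exact: opow_form_semibounded|exact: opow_form_closed|
  exact: opow_form_continuous].
Qed.

Lemma opow_form_symmetric k : Defs.symmetric_form (b k).
Proof.
move=> u v du dv; apply: (ph_conj HX).
  by have [] := oapp_opow_mem du.
by have [] := oapp_opow_mem dv.
Qed.

Lemma ip_oapp_opow k u g f v : P k u g -> P k g f -> odom (P k) v ->
  ip (A k u) (A k v) = ip f v.
Proof.
move=> ug gf dv; have [_ Av] := oapp_opow_mem dv.
by rewrite (ip_oapp ug)// -(opow_symmetric gf (oapp_opow dv)).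
Qed.

(** The equation [ip (A k u) (A k v) = ip f v] for all [v] in the domain is the hypothesis of
    [opow_self_adjoint] for the pair [A k u], [f]; the converse is symmetry. *)
Lemma associated_opow_form k u f :
  associated_operator X ip (b k) u f <-> P (2 * k) u f.
Proof.
rewrite mul2n -addnn; split.
  move=> [du Xf h]; apply: opow_add (oapp_opow du) _.
  have [_ Au] := oapp_opow_mem du.
  apply: opow_self_adjoint => // v phi vphi.
  have dv : odom (P k) v by exists phi.
  have [Xv Xphi] := opow_dom vphi.
  by rewrite -h//= (ph_conj HX)// -(ip_oapp vphi)// -(ph_conj HX)//; have [] := oapp_opow_mem dv.
move=> /opow_split[g ug gf]; split; [by exists g|by have [] := opow_dom gf|].
by move=> v dv; exact: ip_oapp_opow ug gf dv.
Qed.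

End energy_space.

(** * Weak derivatives and the Dirichlet form *)

Section weak_derivatives.
Context {R : realType} {H : lmodType R[i]} {I : finType}.

(* Test vectors [T] with derivations [D i], as seen by the inner product. *)
Record test_space (X : set H) (ip : H -> H -> R[i]) (T : set H)
    (D : I -> H -> H) : Prop := TestSpace {
  ts_sub : T `<=` X;
  ts_0 : T 0;
  ts_linear : forall c u v, T u -> T v -> T (c *: u + v);
  ts_derive : forall i u, T u -> T (D i u);
  ts_parts : forall i u v, T u -> T v -> ip u (D i v) = - ip (D i u) v;
  ts_total : forall f, X f -> (forall v, T v -> ip f v = 0) -> hnorm ip f = 0 }.

Variables (X : set H) (ip : H -> H -> R[i]) (T : set H) (D : I -> H -> H).
Hypothesis HX : pre_hilbert X ip.
Hypothesis cX : complete_for X (hnorm ip).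
Hypothesis HT : test_space X ip T D.
Local Notation nrm := (hnorm ip).
Let TX := ts_sub HT.

(** This definition and the three after it copy [weak_pderiv], [wgrad], [H1] and [ip_grad], so that
    [dirichlet_energy_form] applies to [Omega] by conversion. *)
Definition weak_derivative (i : I) (u g : H) :=
  X g /\ forall phi, T phi -> ip u (D i phi) = - ip g phi.

Definition weak_gradient (i : I) (u : H) : H :=
  xget 0 [set g | weak_derivative i u g].

Definition sobolev : set H :=
  [set u | X u /\ forall i, exists g, weak_derivative i u g].

Definition dirichlet_form (u v : H) : R[i] :=
  \sum_i ip (weak_gradient i u) (weak_gradient i v).

Lemma test_derivative i phi : T phi -> X (D i phi).
Proof. by move=> Tphi; apply/TX/(ts_derive HT). Qed.

Lemma weak_derivative_test i phi : T phi -> weak_derivative i phi (D i phi).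
Proof.
move=> Tphi; split; first exact: test_derivative.
by move=> psi Tpsi; exact: (ts_parts HT).
Qed.

Lemma weak_derivative_linear i (c : R[i]) u g v f : X u -> X v ->
  weak_derivative i u g -> weak_derivative i v f ->
  weak_derivative i (c *: u + v) (c *: g + f).
Proof.
move=> Xu Xv [Xg ug] [Xf vf]; split; first exact: (ph_memZD HX).
move=> phi Tphi; have Xphi := TX Tphi; have Xd := test_derivative i Tphi.
by rewrite !(ph_linear HX)// ug// vf// mulrN opprD.
Qed.

Lemma weak_derivative_null i z w : X z -> X w -> nrm z = 0 -> nrm w = 0 ->
  weak_derivative i z w.
Proof.
move=> Xz Xw z0 w0; split=> // phi Tphi.
have Xphi := TX Tphi; have Xd := test_derivative i Tphi.
by rewrite !(null_ipl HX)// oppr0.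
Qed.

Lemma weak_derivative_unique i u g f : X u ->
  weak_derivative i u g -> weak_derivative i u f -> nrm (g - f) = 0.
Proof.
move=> Xu [Xg ug] [Xf uf]; apply: (ts_total HT); first exact: (memB HX).
move=> phi Tphi; have Xphi := TX Tphi.
rewrite (ipBl HX)//; apply/eqP; rewrite subr_eq0 -eqr_opp; apply/eqP.
by rewrite -ug// -uf.
Qed.

Lemma weak_gradientP i u : sobolev u -> weak_derivative i u (weak_gradient i u).
Proof. by move=> [_ /(_ i) hg]; exact: xgetPex hg. Qed.

Lemma weak_gradient_mem i u : sobolev u -> X (weak_gradient i u).
Proof. by move=> /(weak_gradientP i)[]. Qed.

Lemma sobolev_sub : sobolev `<=` X.
Proof. by move=> u []. Qed.

Lemma sobolev_linear (c : R[i]) u v : sobolev u -> sobolev v -> sobolev (c *: u + v).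
Proof.
move=> Hu Hv; have Xu := sobolev_sub Hu; have Xv := sobolev_sub Hv.
split; first exact: (ph_memZD HX).
move=> i; exists (c *: weak_gradient i u + weak_gradient i v).
by apply: weak_derivative_linear => //; exact: weak_gradientP.
Qed.

Lemma weak_gradient_unique i u g : sobolev u -> weak_derivative i u g ->
  nrm (weak_gradient i u - g) = 0.
Proof.
move=> Hu ug; have Xu := sobolev_sub Hu.
exact: weak_derivative_unique (weak_gradientP i Hu) ug.
Qed.

Lemma ip_weak_gradient i u g v : sobolev u -> weak_derivative i u g -> X v ->
  ip (weak_gradient i u) v = ip g v.
Proof.
move=> Hu ug Xv; have [Xg _] := ug; have Xw := weak_gradient_mem i Hu.
apply/eqP; rewrite -subr_eq0 -(ipBl HX)//; apply/eqP.
by apply: (null_ipl HX) => //; [exact: (memB HX)|exact: weak_gradient_unique].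
Qed.

Lemma sobolev_null z : X z -> nrm z = 0 -> sobolev z.
Proof.
move=> Xz z0; split=> // i; exists 0.
by apply: weak_derivative_null; rewrite ?(hnorm0 HX)//; exact: mem0 HX.
Qed.

Lemma sobolev0 : sobolev 0.
Proof. by apply: sobolev_null; [exact: mem0 HX|exact: hnorm0 HX]. Qed.

Lemma test_sobolev : T `<=` sobolev.
Proof.
move=> phi Tphi; split; first exact: TX.
by move=> i; exists (D i phi); exact: weak_derivative_test.
Qed.

Lemma Re_sum (s : seq I) (F : I -> R[i]) :
  complex.Re (\sum_(i <- s) F i) = \sum_(i <- s) complex.Re (F i).
Proof. by elim: s => [|i s IH]; rewrite ?big_nil// !big_cons ReD IH. Qed.

Lemma conjc_sum (s : seq I) (F : I -> R[i]) :
  conjc (\sum_(i <- s) F i) = \sum_(i <- s) conjc (F i).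
Proof.
elim: s => [|i s IH]; last by rewrite !big_cons conjcD IH.
by rewrite !big_nil; apply: complex_eq; rewrite ?ReJ ?ImJ//= oppr0.
Qed.

Lemma Re_dirichlet_form u : sobolev u ->
  complex.Re (dirichlet_form u u) = \sum_i nrm (weak_gradient i u) ^+ 2.
Proof.
move=> Hu; rewrite /dirichlet_form Re_sum; apply: eq_bigr => i _.
by rewrite (sqr_hnorm HX)//; exact: weak_gradient_mem.
Qed.

Lemma sobolev_pre_hilbert : pre_hilbert sobolev dirichlet_form.
Proof.
split; [exact: sobolev0|exact: sobolev_linear| | |].
- move=> c u v w Hu Hv Hw; rewrite /dirichlet_form mulr_sumr -big_split.
  apply: eq_bigr => i _ /=; have Xw := weak_gradient_mem i Hw.
  have Xu := weak_gradient_mem i Hu; have Xv := weak_gradient_mem i Hv.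
  rewrite (ip_weak_gradient (sobolev_linear c Hu Hv) (weak_derivative_linear c
    (sobolev_sub Hu) (sobolev_sub Hv) (weak_gradientP i Hu) (weak_gradientP i Hv)))//.
  by rewrite (ph_linear HX).
- move=> u v Hu Hv; rewrite /dirichlet_form conjc_sum; apply: eq_bigr => i _.
  by rewrite (ph_conj HX)//; exact: weak_gradient_mem.
- by move=> u Hu; rewrite Re_dirichlet_form// sumr_ge0// => i _; exact: sqr_ge0.
Qed.

Lemma weak_derivative_closed i (u g : nat -> H) v f :
  (forall n, X (u n)) -> (forall n, weak_derivative i (u n) (g n)) ->
  X v -> X f -> nrm (u n - v) @[n --> \oo] --> 0 -> nrm (g n - f) @[n --> \oo] --> 0 ->
  weak_derivative i v f.
Proof.
move=> Xu ug Xv Xf uv gf; split=> // phi Tphi.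
have Xphi := TX Tphi; have Xd := test_derivative i Tphi.
have Xg n : X (g n) by have [] := ug n.
have e n : ip (u n) (D i phi) = - ip (g n) phi by have [_ ->] := ug n.
(* The scalar 1 gives the real part of the claim and the scalar ['i] its imaginary part. *)
have hRe (c : R[i]) : complex.Re (ip v (c *: D i phi)) = - complex.Re (ip f (c *: phi)).
  have Xcd := memZ HX c Xd; have Xcphi := memZ HX c Xphi.
  have h1 := hnorm_cvg_ip HX Xu Xv Xcd uv.
  have h2 := hnorm_cvg_ip HX Xg Xf Xcphi gf.
  apply: (cvg_unique _ h1) => //.
  rewrite (_ : (fun n => _) = (fun n => - complex.Re (ip (g n) (c *: phi)))).
    by apply: cvgN.
  by apply/funext => n; rewrite !(ipZr HX)// e mulrN ReN.
apply: complex_eq; first by have := hRe 1; rewrite !scale1r ReN.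
by rewrite ImN !(Im_ip HX).
Qed.

Lemma sqr_dirichlet_norm u : sobolev u ->
  hnorm (energy_ip ip dirichlet_form) u ^+ 2 =
  nrm u ^+ 2 + \sum_i nrm (weak_gradient i u) ^+ 2.
Proof.
move=> Hu; have Xu := sobolev_sub Hu; rewrite -Re_dirichlet_form//.
rewrite sqr_sqrtr ReD -?(sqr_hnorm HX)//.
by rewrite addr_ge0 ?sqr_ge0// (ph_ge0 sobolev_pre_hilbert).
Qed.

Lemma nrm_weak_gradient_le i u : sobolev u ->
  nrm (weak_gradient i u) <= hnorm (energy_ip ip dirichlet_form) u.
Proof.
move=> Hu; apply: ler_of_sqr; first exact: hnorm_ge0.
rewrite sqr_dirichlet_norm// (bigD1 i)//= addrCA lerDl.
by rewrite addr_ge0 ?sqr_ge0// sumr_ge0// => j _; exact: sqr_ge0.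
Qed.

Lemma nrm_le_dirichlet_norm u : sobolev u ->
  nrm u <= hnorm (energy_ip ip dirichlet_form) u.
Proof.
move=> Hu; apply: ler_of_sqr; first exact: hnorm_ge0.
rewrite sqr_dirichlet_norm// lerDl.
by rewrite sumr_ge0// => j _; exact: sqr_ge0.
Qed.

Lemma weak_gradientB i u v : sobolev u -> sobolev v ->
  weak_derivative i (u - v) (weak_gradient i u - weak_gradient i v).
Proof.
move=> Hu Hv; have := weak_derivative_linear (-1) (sobolev_sub Hv) (sobolev_sub Hu)
  (weak_gradientP i Hv) (weak_gradientP i Hu).
by rewrite !scaleN1r ![- _ + _]addrC.
Qed.

Lemma nrm_weak_gradientB i u v : sobolev u -> sobolev v ->
  nrm (weak_gradient i (u - v)) = nrm (weak_gradient i u - weak_gradient i v).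
Proof.
move=> Hu Hv; have Huv := memB sobolev_pre_hilbert Hu Hv.
have XG w := weak_gradient_mem i (u := w).
apply: (eq_hnorm_null HX); [exact: XG|by apply: (memB HX); exact: XG|].
by apply: weak_gradient_unique => //; exact: weak_gradientB.
Qed.

(** Completeness of the first order Sobolev space: the functions and each of their weak derivatives
    converge in [X], and the graph of a weak derivative is closed. *)
Lemma sobolev_closed :
  complete_for sobolev (hnorm (energy_ip ip dirichlet_form)).
Proof.
move=> u Hu cu; have Xu n := sobolev_sub (Hu n).
have Huv m n := memB sobolev_pre_hilbert (Hu m) (Hu n).
have [|v Xv uv] := cX Xu.
  move=> e /cu[n0 hn0]; exists n0 => m n hm hn.
  by apply: le_lt_trans (hn0 m n hm hn); exact: nrm_le_dirichlet_norm.
have hg i : exists g, X g /\ nrm (weak_gradient i (u n) - g) @[n --> \oo] --> 0.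
  have [||g Xg ug] := @cX (fun n => weak_gradient i (u n)).
  - by move=> n; exact: weak_gradient_mem.
  - move=> e /cu[n0 hn0]; exists n0 => m n hm hn.
    apply: le_lt_trans (hn0 m n hm hn).
    by rewrite -nrm_weak_gradientB//; exact: nrm_weak_gradient_le.
  by exists g.
have [g gP] := choice hg.
have vg i : weak_derivative i v (g i).
  apply: (weak_derivative_closed Xu (fun n => weak_gradientP i (Hu n)) Xv _ uv (gP i).2).
  exact: (gP i).1.
have Hv : sobolev v by split=> // i; exists (g i).
exists v => //.
have e n : hnorm (energy_ip ip dirichlet_form) (u n - v) =
    Num.sqrt (nrm (u n - v) ^+ 2 + \sum_i nrm (weak_gradient i (u n) - g i) ^+ 2).
  have Hnv := memB sobolev_pre_hilbert (Hu n) Hv.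
  rewrite -[LHS]ger0_norm ?hnorm_ge0// -sqrtr_sqr sqr_dirichlet_norm//.
  congr (Num.sqrt (_ + _)); apply: eq_bigr => i _; congr (_ ^+ 2).
  have XG w := weak_gradient_mem i (u := w).
  rewrite nrm_weak_gradientB//; apply: (eq_hnorm_null HX).
  - by apply: (memB HX); exact: XG.
  - by apply: (memB HX); [exact: XG|exact: (gP i).1].
  rewrite opprB addrC addrA subrK (hnormBC HX); [|exact: (gP i).1|exact: XG].
  exact: weak_gradient_unique.
have h : (nrm (u n - v) ^+ 2 + \sum_i nrm (weak_gradient i (u n) - g i) ^+ 2)
    @[n --> \oo] --> 0 + (0 : R).
  apply: cvgD; first exact: cvg0_sqr.
  by apply: cvg0_sum => i; apply: cvg0_sqr; exact: (gP i).2.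
rewrite addr0 in h.
under eq_fun do rewrite e.
have h1 : Num.sqrt (nrm (u n - v) ^+ 2 +
    \sum_i nrm (weak_gradient i (u n) - g i) ^+ 2) @[n --> \oo] --> Num.sqrt (0 : R).
  by apply: continuous_cvg h; exact: sqrt_continuous.
by rewrite sqrtr0 in h1.
Qed.

Theorem dirichlet_energy_form : energy_form X sobolev ip dirichlet_form.
Proof.
split=> //; [exact: sobolev_sub|exact: sobolev_pre_hilbert| | |exact: sobolev_closed].
- move=> f Xf hf; apply: (ts_total HT) => // v Tv.
  by apply: hf; exact: test_sobolev.
- move=> z Xz z0; have Hz := sobolev_null Xz z0; split=> //.
  apply/eqP; rewrite -sqrf_eq0 (sqr_hnorm sobolev_pre_hilbert)// Re_dirichlet_form//.
  rewrite big1// => i _; rewrite -[weak_gradient i z]subr0.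
  rewrite weak_gradient_unique ?expr0n//.
  by apply: weak_derivative_null; rewrite ?(hnorm0 HX)//; exact: mem0 HX.
Qed.

Local Notation L := (energy_operator X sobolev ip dirichlet_form).

Lemma test_sum (s : seq I) (F : I -> H) :
  (forall i, T (F i)) -> T (\sum_(i <- s) F i).
Proof.
move=> TF; elim: s => [|i s IH]; first by rewrite big_nil; exact: (ts_0 HT).
by rewrite big_cons -[F i]scale1r; exact: (ts_linear HT).
Qed.

Lemma ip_sum (s : seq I) (F : I -> H) v : (forall i, X (F i)) -> X v ->
  ip (\sum_(i <- s) F i) v = \sum_(i <- s) ip (F i) v.
Proof.
move=> XF Xv.
suff [] : X (\sum_(i <- s) F i) /\
    ip (\sum_(i <- s) F i) v = \sum_(i <- s) ip (F i) v by [].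
elim: s => [|i s [Xs IH]].
  by rewrite !big_nil (ip0l HX)//; split=> //; exact: mem0 HX.
by rewrite !big_cons (ipDl HX)// IH; split=> //; exact: (memD HX).
Qed.

(** The Neumann condition is tested against all of [sobolev]. The weak derivative of [v] is moved
    onto [D i phi], which is itself a test vector, so no boundary term arises. *)
Lemma energy_operator_test phi : T phi -> L phi (\sum_i D i (D i phi)).
Proof.
move=> Tphi; have T2 i : T (D i (D i phi)) by apply/(ts_derive HT)/(ts_derive HT).
split; [exact: test_sobolev|by apply/TX/test_sum|].
move=> v Hv; have Xv := sobolev_sub Hv.
rewrite /dirichlet_form -sumrN ip_sum//; last by move=> i; exact: TX.
apply: eq_bigr => i _; have Xg := weak_gradient_mem i Hv.
have Td := ts_derive HT i Tphi; have Xd := TX Td.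
rewrite (ip_weak_gradient (test_sobolev Tphi) (weak_derivative_test i Tphi))//.
have [_ /(_ _ Td) h] := weak_gradientP i Hv.
rewrite [RHS](ph_conj HX)//; last exact: TX.
by rewrite h conjcN -(ph_conj HX).
Qed.

Lemma opow_test k phi : T phi -> exists2 psi, T psi & opow X ip L k phi psi.
Proof.
elim: k phi => [|k IH] phi Tphi.
  exists phi => //; split; [exact: TX..|].
  by rewrite subrr; exact: hnorm0 HX.
have [psi Tpsi phipsi] := IH phi Tphi.
exists (\sum_i D i (D i psi)).
  by apply: test_sum => i; apply/(ts_derive HT)/(ts_derive HT).
by exists psi => //; exact: energy_operator_test.
Qed.

Lemma test_dense f e : X f -> 0 < e -> exists2 v, T v & nrm (f - v) < e.
Proof.
apply: (orthogonal_dense HX cX TX (ts_0 HT) (ts_linear HT)); exact: (ts_total HT).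
Qed.

End weak_derivatives.

(** * Lebesgue measure on row vectors *)

Section lebesgue_measure_rV.
Context {R : realType} {n : nat}.
Local Notation E := 'rV[R]_n.+1.
Local Notation mu := (@lebesgue_outer R n).
Local Notation ET := (caratheodory_type (@lebesgue_om R n)).
Local Notation lambda := (lebesgue_rV R n).

Lemma lebesgue_outer_le_series (A : set E) (c : nat -> E * E) :
  A `<=` \bigcup_k box (c k) -> (mu A <= \sum_(k <oo) box_volume (c k))%E.
Proof. by move=> Ac; apply: ereal_inf_lbound; exists c. Qed.

Lemma lebesgue_outer_box (c : E * E) : (mu (box c) <= box_volume c)%E.
Proof.
pose c' (k : nat) : E * E := if k is 0%N then c else (0, 0).
have := @lebesgue_outer_le_series (box c) c'.
rewrite nneseries_recl//; last by move=> k _; exact: box_volume_ge0.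
rewrite eseries0 ?adde0; last by case=> // k _ _ /=; exact: box_volume0.
by apply => x cx; exists 0.
Qed.

Lemma lebesgue_outer_translate_le (a : E) (A : set E) :
  (mu [set x : E | A (x + a)%R] <= mu A)%E.
Proof.
apply: le_ereal_inf_tmp => _ [c [_ Ac] <-].
pose c' k : E * E := ((c k).1 - a, (c k).2 - a).
rewrite (_ : (\sum_(k <oo) _)%E = (\sum_(k <oo) box_volume (c' k))%E); last first.
  apply: eq_eseriesr => k _; rewrite /box_volume /=; congr (_%:E).
  by apply: eq_bigr => j _; rewrite !mxE; congr (Num.max _ _); ring.
apply: lebesgue_outer_le_series => x /= /Ac[k _ ck]; exists k => // j.
by have := ck j; rewrite /c' /= !mxE ltrBlDr lerBrDr.
Qed.

Lemma lebesgue_outer_translate (a : E) (A : set E) :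
  mu [set x | A (x + a)] = mu A.
Proof.
apply/eqP; rewrite eq_le lebesgue_outer_translate_le /=.
have := lebesgue_outer_translate_le (- a) [set x | A (x + a)].
by congr (mu _ <= _)%E; apply/seteqP; split=> x /=; rewrite subrK.
Qed.

(* A half-space cuts every box into two boxes whose volumes add up. *)
Lemma half_space_caratheodory (j : 'I_n.+1) (a : R) :
  lebesgue_om.-caratheodory [set x : E | x 0 j <= a].
Proof.
apply: le_caratheodory_measurable => A.
apply: le_ereal_inf_tmp => _ [c [_ Ac] <-].
pose c1 k : E * E := ((c k).1,
  \row_i if i == j then Num.min ((c k).2 0 j) a else (c k).2 0 i).
pose c2 k : E * E :=
  (\row_i if i == j then Num.max ((c k).1 0 j) a else (c k).1 0 i, (c k).2).
apply: (@le_trans _ _ (\sum_(k <oo) box_volume (c1 k) +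
                       \sum_(k <oo) box_volume (c2 k))%E).
  apply: leeD; apply: lebesgue_outer_le_series.
    move=> x [/Ac[k _ ck] /= xa]; exists k => // i; have := ck i.
    rewrite /c1 /= mxE; case: (eqVneq i j) => [->|//].
    by rewrite le_min xa andbT.
  move=> x [/Ac[k _ ck] /= /negP]; rewrite -ltNge => xa; exists k => // i.
  have := ck i; rewrite /c2 /= mxE; case: (eqVneq i j) => [->|//].
  by rewrite gt_max xa andbT.
rewrite -nneseriesD; [|by move=> *; exact: box_volume_ge0..].
apply: lee_nneseries => [k _ _|k _].
  by apply: adde_ge0; exact: box_volume_ge0.
rewrite /box_volume -EFinD lee_fin [X in X + _](bigD1 j)//= [X in _ + X](bigD1 j)//=.
rewrite [leRHS](bigD1 j)//= !mxE eqxx.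
set p := (X in _ + _ * X <= _); set q := (X in _ * X + _ <= _).
set r := (X in _ <= _ * X).
have -> : q = r by apply: eq_bigr => i ij; rewrite mxE (negbTE ij).
have -> : p = r by apply: eq_bigr => i ij; rewrite mxE (negbTE ij).
have r0 : 0 <= r by apply: prodr_ge0 => i _; rewrite le_max lexx.
rewrite -mulrDl ler_wpM2r//.
move: ((c k).1 0 j) ((c k).2 0 j) => l b.
case: (leP b a) => ba; case: (leP l a) => la; rewrite /Num.max;
  do !case: ifPn; rewrite -?leNgt; lra.
Qed.

Lemma measurable_box (c : E * E) : measurable (box c : set ET).
Proof.
have -> : box c = \bigcap_(j in [set: 'I_n.+1])
    ([set x : E | x 0 j <= c.2 0 j] `\` [set x : E | x 0 j <= c.1 0 j]).
  apply/seteqP; split=> x.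
    by move=> cx j _; have /andP[h1 h2] := cx j; split=> //=; apply/negP; rewrite -ltNge.
  by move=> cx j; have [/= -> /negP] := cx j I; rewrite -ltNge => ->.
apply: fin_bigcap_measurable => // j _.
by apply: caratheodory_measurable_setD; exact: half_space_caratheodory.
Qed.

Lemma rV_ballP (x y : E) (e : R) : 0 < e ->
  ball x e y <-> forall j, `|x 0 j - y 0 j| < e.
Proof.
move=> e0; split=> [[_ h] j|h]; first exact: h.
by split=> // i j; rewrite (ord1 i); exact: h.
Qed.

Definition open_box (c : E * E) : set E :=
  [set x | forall j, c.1 0 j < x 0 j < c.2 0 j].

Lemma open_open_box c : open (open_box c).
Proof.
rewrite openE => x cx.
suff : \forall y \near x, forall j, c.1 0 j < (y : E) 0 j < c.2 0 j by [].
apply: (@filter_forall _ _ (fun j (y : E) => is_true (c.1 0 j < y 0 j < c.2 0 j))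
  (nbhs x)) => j.
have cj : (fun y : E => y 0 j) @ x --> x 0 j by exact: coord_continuous.
have /andP[h1 h2] := cx j; near=> y; apply/andP; split.
  by near: y; apply: cvgr_gt h1.
by near: y; apply: cvgr_lt h2.
Unshelve. all: by end_near. Qed.

Definition rat_box (c : 'rV[rat]_n.+1 * 'rV[rat]_n.+1) : E * E :=
  (map_mx ratr c.1, map_mx ratr c.2).

(** Having the closed box inside [U] serves two ends: half-open boxes show that [U] is measurable,
    and bumps on the open box have compact support in [U]. *)
Lemma rat_box_basis (U : set E) x : open U -> U x ->
  exists c, open_box (rat_box c) x /\
    forall y : E, (forall j, (rat_box c).1 0 j <= y 0 j <= (rat_box c).2 0 j) -> U y.
Proof.
move=> oU Ux; have /nbhs_ballP[e e0 eU] : nbhs x U by exact: open_nbhs_nbhs.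
have hl j : exists q : rat, ratr q \in `](x 0 j - e / 2), (x 0 j)[.
  have [|q] := @rat_in_itvoo R (x 0 j - e / 2) (x 0 j).
    by rewrite ltrBlDr ltrDl divr_gt0.
  by exists q.
have hr j : exists q : rat, ratr q \in `](x 0 j), (x 0 j + e / 2)[.
  have [|q] := @rat_in_itvoo R (x 0 j) (x 0 j + e / 2).
    by rewrite ltrDl divr_gt0.
  by exists q.
have [l lP] := choice hl; have [r rP] := choice hr.
exists (\row_j l j, \row_j r j); split=> [j|y hy].
  have := lP j; have := rP j; rewrite !in_itv /= !mxE.
  by move=> /andP[-> _] /andP[_ ->].
apply: eU; apply/rV_ballP => // j.
have := lP j; have := rP j; have := hy j; rewrite !in_itv /= !mxE ltr_norml.
move=> /andP[h1 h2] /andP[h3 h4] /andP[h5 h6].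
have e2 : 0 < e / 2 by rewrite divr_gt0.
rewrite [e]splitr; apply/andP; split; lra.
Qed.

(** Rational boxes are enumerated by [unpickle]; an index without a suitable box receives [(0, 0)],
    whose open box is empty. This explains the alternative in the conclusion. *)
Lemma open_bigcup_boxes (U : set E) : open U ->
  exists c : nat -> E * E,
    (forall k, [set y : E | forall j, (c k).1 0 j <= y 0 j <= (c k).2 0 j] `<=` U
      \/ open_box (c k) = set0) /\ U = \bigcup_k open_box (c k).
Proof.
move=> oU.
pose c k : E * E := if unpickle k is Some q then
    if `[< [set y : E | forall j, (rat_box q).1 0 j <= y 0 j <= (rat_box q).2 0 j]
          `<=` U >] then rat_box q else (0, 0)
  else (0, 0).
have b0 : open_box ((0, 0) : E * E) = set0.
  by apply/seteqP; split=> // x /(_ ord0) /andP[/lt_trans h /h]; rewrite ltxx.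
exists c; split=> [k|].
  rewrite /c; case: (unpickle k) => [q|]; last by right.
  by case: asboolP => qU; [left|right].
apply/seteqP; split=> x.
  move=> /(rat_box_basis oU)[q [qx qU]]; exists (pickle q) => //.
  by rewrite /c pickleK asboolT.
move=> [k _]; rewrite /c; case: (unpickle k) => [q|]; last by rewrite b0.
case: asboolP => qU; last by rewrite b0.
by move=> qx; apply: qU => j; have /andP[/ltW -> /ltW ->] := qx j.
Qed.

Lemma measurable_open (U : set E) : open U -> measurable (U : set ET).
Proof.
move=> oU.
pose D := [set q | [set y : E | forall j,
  (rat_box q).1 0 j <= y 0 j <= (rat_box q).2 0 j] `<=` U].
have -> : U = \bigcup_(q in D) box (rat_box q).
  apply/seteqP; split=> x.
    move=> /(rat_box_basis oU)[q [qx qU]]; exists q => // j.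
    by have /andP[-> /ltW ->] := qx j.
  by move=> [q Dq qx]; apply: Dq => j; have /andP[/ltW -> ->] := qx j.
rewrite bigcup_mkcond; apply: countable_bigcupT_measurable => // q.
by case: ifP => _; [exact: measurable_box|exact: measurable0].
Qed.

Lemma measurable_fun_continuous (f : E -> R) :
  continuous f -> measurable_fun (setT : set ET) (f : ET -> R).
Proof.
move=> cf; apply: (measurability _ (RGenOpens.measurableE R)).
move=> _ [_ [a [b ->] <-]]; rewrite setTI; apply: measurable_open.
apply: open_comp => [x _|]; first exact: cf.
exact: interval_open.
Qed.

(** The Caratheodory condition for the translate of [A] on [X] is the one for [A] on the translate
    of [X], as outer measure is translation invariant. *)
Lemma measurable_translate (a : E) :
  measurable_fun setT ((fun x => x + a) : ET -> ET).
Proof.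
move=> _ A mA; rewrite setTI.
suff h : lebesgue_om.-caratheodory [set x : E | A (x + a)] by exact: h.
move=> X.
have := mA [set x | X (x - a)].
have tr B : lebesgue_om [set x | B (x + a)] = lebesgue_om B.
  exact: lebesgue_outer_translate.
rewrite -(tr [set x | X (x - a)]) -(tr ([set x | X (x - a)] `&` A)).
rewrite -(tr ([set x | X (x - a)] `&` ~` A)).
have e C : [set x | ([set x | X (x - a)] `&` C) (x + a)] = X `&` [set x | C (x + a)].
  by apply/seteqP; split=> x /=; rewrite addrK.
rewrite !e; have -> : [set x | [set x0 | X (x0 - a)] (x + a)] = X.
  by apply/seteqP; split=> x /=; rewrite addrK.
by [].
Qed.

Lemma lebesgue_outer_bounded (A : set E) : bounded_set A -> (mu A < +oo)%E.
Proof.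
move=> [M [_ hM]]; pose M' := Num.max M 0 + 1.
have M'0 : M < M' by rewrite /M' ltr_pwDr// le_max lexx.
have AM x : A x -> forall j, `|x 0 j| <= M'.
  move=> Ax j; apply: le_trans (hM _ M'0 _ Ax).
  rewrite /Num.norm/= mx_normrE.
  by apply: (le_bigmax _ (fun ij : 'I_1 * 'I_n.+1 => `|x ij.1 ij.2|) (0, j)).
(* Boxes are open on the left, hence the additional [- 1]. *)
pose c : E * E := (const_mx (- M' - 1), const_mx M').
apply: (@le_lt_trans _ _ (mu (box c))); last first.
  by apply: le_lt_trans (lebesgue_outer_box c) _; rewrite ltry.
apply: le_outer_measure => x /AM h j; rewrite !mxE.
have := h j; rewrite ler_norml => /andP[h1 ->]; rewrite andbT.
by apply: lt_le_trans h1; rewrite ltrBlDr ltrDl.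
Qed.

(** A half-open box lacks openness at its upper faces only, so these alone are moved; the volume
    depends continuously on the shift. *)
Lemma box_open_enlarge (c : E * E) (e : R) : 0 < e ->
  exists c' : E * E, box c `<=` open_box c' /\
    (box_volume c' <= box_volume c + e%:E)%E.
Proof.
move=> e0; pose F (t : R) := \prod_j Num.max 0 (c.2 0 j + t - c.1 0 j).
have cF : continuous F.
  apply: continuous_big => [x|j _ x]; first exact: mul_continuous.
  have -> : (fun t : R => Num.max 0 (c.2 0 j + t - c.1 0 j)) = (fun t : R =>
      ((c.2 0 j + t - c.1 0 j) + `|c.2 0 j + t - c.1 0 j|) / 2).
    apply/funext => t; move: (_ - _) => s.
    by case: leP => s0; [rewrite ger0_norm|rewrite ltr0_norm]; lra.
  suff h : (fun t : R => c.2 0 j + t - c.1 0 j) @ x --> (c.2 0 j + x - c.1 0 j).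
    by apply: cvgMl; apply: cvgD => //; apply: cvg_norm.
  by apply: cvgB; [apply: cvgD; [exact: cvg_cst|exact: cvg_id]|exact: cvg_cst].
have /cvgrPdist_lt/(_ _ e0) := cF 0.
move=> /nbhs_ballP[t /= t0 ht].
have ht2 : `|F 0 - F (t / 2)| < e.
  apply: ht; rewrite /ball /= sub0r normrN gtr0_norm ?divr_gt0//.
  by rewrite ltr_pdivrMr// ltr_pMr// ltr1n.
exists (c.1, \row_j (c.2 0 j + t / 2)); split.
  move=> x cx j; have /andP[h1 h2] := cx j; rewrite /= mxE h1 /=.
  by rewrite (le_lt_trans h2)// ltrDl divr_gt0.
rewrite /box_volume -EFinD lee_fin /=.
have -> : \prod_j Num.max 0 ((\row_j0 (c.2 0 j0 + t / 2)) 0 j - c.1 0 j) = F (t / 2).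
  by apply: eq_bigr => j _; rewrite mxE.
have -> : \prod_j Num.max 0 (c.2 0 j - c.1 0 j) = F 0.
  by apply: eq_bigr => j _; rewrite addr0.
by move: ht2; rewrite ltr_norml => /andP[h _]; lra.
Qed.

Lemma lebesgue_outer_regular (A : set E) (e : R) :
  (mu A < +oo)%E -> 0 < e ->
  exists U : set E, [/\ open U, A `<=` U & (mu U <= mu A + e%:E)%E].
Proof.
move=> Aoo e0; have e2 : 0 < e / 2 by rewrite divr_gt0.
have fA : mu A \is a fin_num.
  by rewrite ge0_fin_numE//; exact: (cover_outer_ge0 _ _ box_volume_ge0).
have [_ [c [_ Ac] <-] cA] := lb_ereal_inf_adherent e2 fA.
have h k : exists c' : E * E, box (c k) `<=` open_box c' /\
    (box_volume c' <= box_volume (c k) + ((e / 2) / (2 ^ k.+1)%:R)%:E)%E.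
  by apply: box_open_enlarge; rewrite divr_gt0// ltr0n expn_gt0.
have [c' c'P] := choice h.
exists (\bigcup_k open_box (c' k)); split.
- by apply: bigcup_open => k _; exact: open_open_box.
- by move=> x /Ac[k _ ckx]; exists k => //; exact: (c'P k).1.
apply: (@le_trans _ _ (\sum_(k <oo) box_volume (c' k))%E).
  apply: lebesgue_outer_le_series => x [k _ ckx]; exists k => // j.
  by have /andP[-> /ltW ->] := ckx j.
apply: (@le_trans _ _ (\sum_(k <oo) (box_volume (c k) +
    ((e / 2) / (2 ^ k.+1)%:R)%:E))%E).
  apply: lee_nneseries => [k _ _|k _]; first exact: box_volume_ge0.
  exact: (c'P k).2.
apply: (@le_trans _ _ (\sum_(k <oo) box_volume (c k) + (e / 2)%:E)%E).
  by apply: epsilon_trick => [k|]; [exact: box_volume_ge0|exact: ltW].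
apply: (@le_trans _ _ ((mu A + (e / 2)%:E) + (e / 2)%:E)%E).
  by apply: leeD => //; exact: ltW.
by rewrite -addeA -EFinD -splitr.
Qed.

End lebesgue_measure_rV.

(** * Completeness of L2 *)

Section square_integrable.
Context d {T : measurableType d} {R : realType}.
Variables (mu : {measure set T -> \bar R}) (D : set T).
Hypothesis mD : measurable D.
Implicit Types (f g : T -> R) (u v w : T -> R[i]).

Definition sq_integrable f :=
  measurable_fun D f /\ mu.-integrable D (fun x => (f x ^+ 2)%:E).

Lemma integrable_linear (a b : R) f g :
  mu.-integrable D (EFin \o f) -> mu.-integrable D (EFin \o g) ->
  mu.-integrable D (EFin \o (fun x => a * f x + b * g x)).
Proof.
move=> fi gi.
apply: (@eq_integrable _ _ _ mu D mD (fun x => a%:E * (f x)%:E + b%:E * (g x)%:E)%E).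
  by move=> x _ /=.
by apply: integrableD => //; exact: integrableZl.
Qed.

Lemma Rintegral_linear (a b : R) f g :
  mu.-integrable D (EFin \o f) -> mu.-integrable D (EFin \o g) ->
  (\int[mu]_(x in D) (a * f x + b * g x) =
   a * \int[mu]_(x in D) f x + b * \int[mu]_(x in D) g x)%R.
Proof.
move=> fi gi; have h c (h : T -> R) : mu.-integrable D (EFin \o h) ->
    mu.-integrable D (EFin \o (fun x => c * h x)).
  by move=> hi; exact: (@integrableZl _ _ _ mu D mD c _ hi).
by rewrite RintegralD ?RintegralZl//; exact: h.
Qed.

Lemma sq_integrable_mul f g : sq_integrable f -> sq_integrable g ->
  mu.-integrable D (fun x => (f x * g x)%:E).
Proof.
move=> [mf if2] [mg ig2].
apply: (@le_integrable _ _ _ mu D _ _ (fun x => (f x ^+ 2)%:E + (g x ^+ 2)%:E)%E) => //.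
- by apply/measurable_EFinP; exact: measurable_funM.
- move=> x Dx /=; rewrite lee_fin [leRHS]ger0_norm ?addr_ge0 ?sqr_ge0//.
  rewrite ler_norml; have := sqr_ge0 (f x - g x); have := sqr_ge0 (f x + g x).
  by rewrite sqrrB sqrrD => *; apply/andP; split; nra.
- exact: integrableD.
Qed.

Lemma sq_integrableP f : measurable_fun D f ->
  (\int[mu]_(x in D) (f x ^+ 2)%:E < +oo)%E -> sq_integrable f.
Proof.
move=> mf foo; split=> //; apply/integrableP; split.
  by apply/measurable_EFinP; exact: measurable_funX.
by under eq_integral do rewrite gee0_abs ?lee_fin ?sqr_ge0//.
Qed.

Lemma sq_integrable_linear (a b : R) f g : sq_integrable f -> sq_integrable g ->
  sq_integrable (fun x => a * f x + b * g x).
Proof.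
move=> sf sg; have [mf if2] := sf; have [mg ig2] := sg.
have m1 : measurable_fun D (fun x => a * f x + b * g x).
  by apply: measurable_funD; apply: measurable_funM.
split=> //.
have ifg := sq_integrable_mul sf sg.
apply: (@eq_integrable _ _ _ mu D mD (fun x => (a ^+ 2)%:E * (f x ^+ 2)%:E +
   ((a * b + a * b)%:E * (f x * g x)%:E + (b ^+ 2)%:E * (g x ^+ 2)%:E))%E).
  by move=> x _ /=; rewrite -!EFinM -!EFinD; congr (_%:E); ring.
by apply: integrableD => //; [|apply: integrableD => //]; apply: integrableZl.
Qed.

Local Notation L2 := (Defs.L2 mu D).
Local Notation ip := (L2ip mu D).

Lemma L2P u : L2 u <->
  sq_integrable (fun x => complex.Re (u x)) /\
  sq_integrable (fun x => complex.Im (u x)).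
Proof.
split=> [[mR mI uoo]|[[mR iR] [mI iI]]].
  split; apply: sq_integrableP => //; apply: le_lt_trans uoo;
  apply: ge0_le_integral => //.
  - by move=> x _; rewrite lee_fin sqr_ge0.
  - by apply/measurable_EFinP; exact: measurable_funX.
  - apply/measurable_EFinP.
    rewrite (_ : (fun x => _) = (fun x => complex.Re (u x) ^+ 2 + complex.Im (u x) ^+ 2)).
      by apply: measurable_funD; exact: measurable_funX.
    by apply/funext => x; rewrite sqr_cabs.
  - by move=> x _; rewrite lee_fin sqr_cabs lerDl sqr_ge0.
  - by move=> x _; rewrite lee_fin sqr_ge0.
  - by apply/measurable_EFinP; exact: measurable_funX.
  - apply/measurable_EFinP.
    rewrite (_ : (fun x => _) = (fun x => complex.Re (u x) ^+ 2 + complex.Im (u x) ^+ 2)).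
      by apply: measurable_funD; exact: measurable_funX.
    by apply/funext => x; rewrite sqr_cabs.
  - by move=> x _; rewrite lee_fin sqr_cabs lerDr sqr_ge0.
split=> //; under eq_integral do rewrite sqr_cabs EFinD.
by have /integrable_lty := integrableD mD iR iI; apply.
Qed.

Lemma L2_Re_mul u v : L2 u -> L2 v ->
  mu.-integrable D (fun x => (complex.Re (u x * conjc (v x)))%:E).
Proof.
move=> /L2P[uR uI] /L2P[vR vI].
apply: (@eq_integrable _ _ _ mu D mD (fun x => (complex.Re (u x) * complex.Re (v x))%:E +
  (complex.Im (u x) * complex.Im (v x))%:E)%E).
  by move=> x _; rewrite ReM ReJ ImJ mulrN opprK.
by apply: integrableD => //; exact: sq_integrable_mul.
Qed.

Lemma L2_Im_mul u v : L2 u -> L2 v ->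
  mu.-integrable D (fun x => (complex.Im (u x * conjc (v x)))%:E).
Proof.
move=> /L2P[uR uI] /L2P[vR vI].
apply: (@eq_integrable _ _ _ mu D mD (fun x => (complex.Im (u x) * complex.Re (v x))%:E -
  (complex.Re (u x) * complex.Im (v x))%:E)%E).
  by move=> x _; rewrite ImM ReJ ImJ mulrN -EFinB addrC.
by apply: integrableB => //; exact: sq_integrable_mul.
Qed.

Lemma L2ip_ReE u v : complex.Re (ip u v) =
  (\int[mu]_(x in D) complex.Re (u x * conjc (v x)))%R.
Proof. by []. Qed.

Lemma L2ip_ImE u v : complex.Im (ip u v) =
  (\int[mu]_(x in D) complex.Im (u x * conjc (v x)))%R.
Proof. by []. Qed.

Lemma L2_linear (c : R[i]) u v : L2 u -> L2 v -> L2 (c *: u + v).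
Proof.
move=> /L2P[uR uI] /L2P[vR vI]; apply/L2P; split.
  rewrite (_ : (fun x => _) = (fun x => 1 * (complex.Re c * complex.Re (u x) +
      (- complex.Im c) * complex.Im (u x)) + 1 * complex.Re (v x))).
    by apply: sq_integrable_linear => //; exact: sq_integrable_linear.
  by apply/funext => x; rewrite ReD ReM !mul1r mulNr.
rewrite (_ : (fun x => _) = (fun x => 1 * (complex.Re c * complex.Im (u x) +
    complex.Im c * complex.Re (u x)) + 1 * complex.Im (v x))).
  by apply: sq_integrable_linear => //; exact: sq_integrable_linear.
by apply/funext => x; rewrite ImD ImM !mul1r.
Qed.

Lemma L2_0 : L2 0.
Proof.
have h : sq_integrable (fun=> 0).
  by split=> //; rewrite expr0n; exact: integrable0.
by apply/L2P; split.
Qed.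

Lemma L2_pre_hilbert : pre_hilbert L2 ip.
Proof.
split; [exact: L2_0|exact: L2_linear| | |].
- move=> c u v w Lu Lv Lw.
  have iR := L2_Re_mul Lu Lw; have iI := L2_Im_mul Lu Lw.
  have jR := L2_Re_mul Lv Lw; have jI := L2_Im_mul Lv Lw.
  apply: complex_eq; rewrite !(ReD, ImD) !(ReM, ImM) !(L2ip_ReE, L2ip_ImE).
    rewrite -mulNr -Rintegral_linear//.
    rewrite -RintegralD//; last exact: integrable_linear.
    by apply: eq_Rintegral => x _; rewrite !(ReM, ReD, ReJ, ImJ, ImM, ImD); ring.
  rewrite -Rintegral_linear//.
  rewrite -RintegralD//; last exact: integrable_linear.
  by apply: eq_Rintegral => x _; rewrite !(ReM, ReD, ReJ, ImJ, ImM, ImD); ring.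
- move=> u v Lu Lv; have iI := L2_Im_mul Lv Lu.
  apply: complex_eq; rewrite ?(ReJ, ImJ) !(L2ip_ReE, L2ip_ImE).
    by apply: eq_Rintegral => x _; rewrite !(ReM, ReJ, ImJ); ring.
  rewrite -mulN1r -RintegralZl//.
  by apply: eq_Rintegral => x _; rewrite !(ImM, ReJ, ImJ); ring.
- move=> u Lu; rewrite L2ip_ReE; apply: Rintegral_ge0 => x _.
  by rewrite ReM ReJ ImJ mulrN opprK -!expr2 addr_ge0 ?sqr_ge0.
Qed.

Lemma sqr_L2norm u : L2 u ->
  (hnorm ip u ^+ 2)%:E = (\int[mu]_(x in D) (cabs (u x) ^+ 2)%:E)%E.
Proof.
move=> Lu; rewrite (sqr_hnorm L2_pre_hilbert)// L2ip_ReE /Rintegral fineK.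
  by apply: eq_integral => x _; rewrite ReM ReJ ImJ mulrN opprK sqr_cabs.
exact: integrable_fin_num (L2_Re_mul Lu Lu).
Qed.

Lemma measurable_cabs2 u : measurable_fun D (fun x => complex.Re (u x)) ->
  measurable_fun D (fun x => complex.Im (u x)) ->
  measurable_fun D (fun x => (cabs (u x) ^+ 2)%:E).
Proof.
move=> mR mI; apply/measurable_EFinP.
rewrite (_ : (fun x => _) = (fun x => complex.Re (u x) ^+ 2 + complex.Im (u x) ^+ 2)).
  by apply: measurable_funD; exact: measurable_funX.
by apply/funext => x; rewrite sqr_cabs.
Qed.

(** Tailored to integration by parts: under a single integral the two products add up to the
    derivative of a product. *)
Lemma L2ip_eqN u1 v1 u2 v2 : L2 u1 -> L2 v1 -> L2 u2 -> L2 v2 ->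
  (\int[mu]_(x in D) (complex.Re (u1 x * conjc (v1 x)) +
                      complex.Re (u2 x * conjc (v2 x))))%R = 0 ->
  (\int[mu]_(x in D) (complex.Im (u1 x * conjc (v1 x)) +
                      complex.Im (u2 x * conjc (v2 x))))%R = 0 ->
  ip u1 v1 = - ip u2 v2.
Proof.
move=> Lu1 Lv1 Lu2 Lv2 hR hI; apply/eqP; rewrite -addr_eq0; apply/eqP.
apply: complex_eq; rewrite ?ReD ?ImD.
  by rewrite !L2ip_ReE -RintegralD//; exact: L2_Re_mul.
by rewrite !L2ip_ImE -RintegralD//; exact: L2_Im_mul.
Qed.

Lemma sq_integrable_integrable f : (mu D < +oo)%E -> sq_integrable f ->
  mu.-integrable D (EFin \o f).
Proof.
move=> Doo sf; have s1 : sq_integrable (cst 1).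
  apply: sq_integrableP; first exact: measurable_cst.
  rewrite (_ : (fun x => _) = cst 1%E); last by apply/funext => x; rewrite /= expr1n.
  by rewrite integral_cst// mul1e.
have := sq_integrable_mul sf s1.
by apply: eq_integrable => // x _; rewrite /= mulr1.
Qed.

Lemma L2_le_cabs2 u (M : R) :
  measurable_fun D (fun x => complex.Re (u x)) ->
  measurable_fun D (fun x => complex.Im (u x)) ->
  (\int[mu]_(x in D) (cabs (u x) ^+ 2)%:E <= (M ^+ 2)%:E)%E -> 0 <= M ->
  L2 u /\ hnorm ip u <= M.
Proof.
move=> mR mI uM M0; have Lu : L2 u by split=> //; exact: le_lt_trans uM (ltry _).
split=> //; apply: ler_of_sqr => //.
by rewrite -lee_fin sqr_L2norm.
Qed.

Lemma L2_null_ae u v (N : set T) : L2 u -> L2 v -> measurable N ->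
  mu N = 0%E -> (forall x, D x -> ~ N x -> u x = v x) -> hnorm ip (u - v) = 0.
Proof.
move=> Lu Lv mN N0 uv; have Luv := memB L2_pre_hilbert Lu Lv.
apply/eqP; rewrite -sqrf_eq0 -eqe sqr_L2norm//; apply/eqP.
have [mR mI _] := Luv.
rewrite (@negligible_integral _ _ _ mu D N)//; last first.
  apply/integrableP; split; first exact: measurable_cabs2.
  under eq_integral do rewrite gee0_abs ?lee_fin ?sqr_ge0//.
  by have [] := Luv.
apply: integral0_eq => x [Dx Nx]; rewrite (_ : (u - v) x = 0) ?cabs0 ?expr0n//.
by apply/eqP; rewrite subr_eq0; apply/eqP; exact: uv.
Qed.

End square_integrable.

(** * Rapidly Cauchy sequences and the Riesz-Fischer theorem *)

Section L2_complete.
Context d {T : measurableType d} {R : realType}.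
Variables (mu : {measure set T -> \bar R}) (D : set T).
Hypothesis mD : measurable D.
Local Notation L2 := (Defs.L2 mu D).
Local Notation ip := (L2ip mu D).
Local Notation nrm := (hnorm ip).
Let HL := L2_pre_hilbert mu mD.

(** Either [t] is at most [2 ^- k] in modulus, or one factor of its square is more than that. It
    turns weighted square summability into absolute summability, point by point. *)
Lemma abs_le_weighted_sqr (k : nat) (t : R) :
  `|t| <= 2 ^+ k * t ^+ 2 + (2^-1) ^+ k.
Proof.
rewrite exprVn -[t ^+ 2]real_normK ?num_real//.
have p0 : (0 : R) < 2 ^+ k by rewrite exprn_gt0.
have q0 : 0 < (2 ^+ k)^-1 :> R by rewrite invr_gt0.
have pq : 2 ^+ k * (2 ^+ k)^-1 = 1 :> R by rewrite mulfV// gt_eqF.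
move: (2 ^+ k) (2 ^+ k)^-1 p0 q0 pq (normr_ge0 t) => p q p0 q0 pq t0.
have [tq|tq] := leP `|t| q; first by rewrite (le_trans tq)// lerDr mulr_ge0// ?sqr_ge0// ltW.
rewrite (@le_trans _ _ (p * `|t| ^+ 2))// ?lerDl ?(ltW q0)//.
rewrite expr2 mulrA ler_peMl// -pq ler_wpM2l// ltW//.
Qed.

Lemma telescope_cvg (a b : nat -> R) (M : R) :
  (forall k, `|a k.+1 - a k| <= b k) ->
  (forall n, \sum_(0 <= k < n) b k <= M) -> cvgn a.
Proof.
move=> ab bM.
have b0 k : 0 <= b k by apply: le_trans (ab k).
have cb : cvgn (series b).
  apply: nondecreasing_is_cvgn; first by apply: nondecreasing_series => k _ _.
  by exists M => _ [n _ <-]; exact: bM.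
have : cvgn [normed series (telescope a)].
  apply: (series_le_cvg _ b0 ab cb) => k; exact: normr_ge0.
move/normed_cvg => h.
have -> : a = (fun n => a 0%N + series (telescope a) n).
  by apply/funext => n; rewrite seriesEnat/= telescope_sumr// addrC subrK.
by apply: is_cvgD => //; exact: is_cvg_cst.
Qed.

Lemma half_geometric_le1 n : \sum_(0 <= k < n) (2^-1) ^+ k.+1 <= 1 :> R.
Proof.
have -> : \sum_(0 <= k < n) (2^-1) ^+ k.+1 = 1 - (2^-1) ^+ n :> R.
  elim: n => [|n IH]; first by rewrite big_geq// expr0 subrr.
  by rewrite big_nat_recr//= IH exprS; lra.
by rewrite gerBl exprn_ge0.
Qed.

(* [\sum_k 2 ^ k.+1 * cabs (a k.+1 - a k) ^ 2] is finite off a null set. *)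
Lemma L2_fast_cauchy_ae (a : nat -> T -> R[i]) : (forall k, L2 (a k)) ->
  (forall k, nrm (a k.+1 - a k) ^+ 2 <= (4^-1) ^+ k.+1) ->
  exists N : set T, [/\ measurable N, mu N = 0%E &
    forall x, D x -> ~ N x ->
      cvgn (fun k => complex.Re (a k x)) /\ cvgn (fun k => complex.Im (a k x))].
Proof.
move=> La ha.
have Ld k : L2 (a k.+1 - a k) by exact: (memB HL).
pose g k x := (2 ^+ k.+1 * cabs (a k.+1 x - a k x) ^+ 2)%:E.
have g0 k x : (0 <= g k x)%E by rewrite lee_fin mulr_ge0 ?sqr_ge0 ?exprn_ge0.
have mg k : measurable_fun D (g k).
  have [mR mI _] := Ld k; have /measurable_EFinP h := measurable_cabs2 mR mI.
  by apply/measurable_EFinP; apply: measurable_funM.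
pose G x := (\sum_(k <oo) g k x)%E.
have mG : measurable_fun D G by apply: ge0_emeasurable_sum.
have G0 x : (0 <= G x)%E by apply: nneseries_ge0.
have Goo : (\int[mu]_(x in D) G x < +oo)%E.
  rewrite integral_nneseries//.
  (* The weight [2 ^+ k.+1] against the bound [(4^-1) ^+ k.+1] leaves a convergent geometric
     series. *)
  apply: (@le_lt_trans _ _ (\sum_(k <oo) (((2^-1) ^+ k.+1)%:E : \bar R))%E).
    apply: lee_nneseries => [k _ _|k _]; first exact: integral_ge0.
    rewrite /g; under eq_integral do rewrite EFinM.
    have [mR mI _] := Ld k.
    rewrite ge0_integralZl//=.
    - rewrite -(sqr_L2norm mD (Ld k)) -EFinM lee_fin.
      have -> : (2^-1) ^+ k.+1 = 2 ^+ k.+1 * (4^-1) ^+ k.+1 :> R.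
        by rewrite -exprMn; congr (_ ^+ _); field.
      by rewrite ler_wpM2l// exprn_ge0.
    - exact: (measurable_cabs2 mR mI).
    - by move=> x _; rewrite lee_fin sqr_ge0.
  apply: (@le_lt_trans _ _ 1%E); last exact: ltry.
  apply: lime_le.
    by apply: is_cvg_nneseries => k _ _; rewrite lee_fin exprn_ge0.
  by apply: nearW => n; rewrite sumEFin lee_fin half_geometric_le1.
have iG : mu.-integrable D G.
  by apply/integrableP; split=> //; under eq_integral do rewrite gee0_abs//.
have [N [mN N0 hN]] := integrable_ae mD iG.
exists N; split=> // x Dx Nx.
have Gx : G x \is a fin_num.
  by apply: contrapT => h; apply/Nx/hN => /(_ Dx).
have bound n : \sum_(0 <= k < n) (2 ^+ k.+1 * cabs (a k.+1 x - a k x) ^+ 2 +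
    (2^-1) ^+ k.+1) <= fine (G x) + 1.
  rewrite big_split/= lerD ?half_geometric_le1//.
  rewrite -lee_fin fineK// -sumEFin.
  by apply: nneseries_lim_ge => k _ _; exact: g0.
split; apply: telescope_cvg bound => k.
  rewrite -ReN -ReD (le_trans (abs_le_weighted_sqr k.+1 _))//.
  rewrite lerD2r ler_wpM2l ?exprn_ge0// sqr_cabs.
  by rewrite lerDl sqr_ge0.
rewrite -ImN -ImD (le_trans (abs_le_weighted_sqr k.+1 _))//.
rewrite lerD2r ler_wpM2l ?exprn_ge0// sqr_cabs.
by rewrite lerDr sqr_ge0.
Qed.

Lemma cabs2_cvg (z : nat -> R[i]) (l : R[i]) :
  complex.Re (z k) @[k --> \oo] --> complex.Re l ->
  complex.Im (z k) @[k --> \oo] --> complex.Im l ->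
  cabs (z k) ^+ 2 @[k --> \oo] --> cabs l ^+ 2.
Proof.
move=> hR hI; rewrite sqr_cabs.
rewrite (_ : (fun k => _) = (fun k => complex.Re (z k) * complex.Re (z k) +
  complex.Im (z k) * complex.Im (z k))).
  by rewrite !expr2; apply: cvgD; apply: cvgM.
by apply/funext => k; rewrite sqr_cabs !expr2.
Qed.

Lemma limn_einf_le (u : nat -> \bar R) (c : \bar R) (k : nat) :
  (forall m, (k <= m)%N -> (u m <= c)%E) -> (limn_einf u <= c)%E.
Proof.
move=> uc; rewrite limn_einf_lim; apply: lime_le; first exact: is_cvg_einfs.
apply: nearW => n; apply: (@le_trans _ _ (u (maxn k n))).
  by apply: ereal_inf_lbound; exists (maxn k n) => //=; exact: leq_maxr.
by apply: uc; exact: leq_maxl.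
Qed.

(** The candidate [w] is the almost everywhere pointwise limit; its distance to [a k] is estimated
    by Fatou's lemma. *)
Lemma L2_fast_cauchy (a : nat -> T -> R[i]) : (forall k, L2 (a k)) ->
  (forall k m, (k <= m)%N -> nrm (a m - a k) ^+ 2 <= (4^-1) ^+ k.+1) ->
  exists2 w, L2 w & forall k, nrm (a k - w) ^+ 2 <= (4^-1) ^+ k.+1.
Proof.
move=> La ha.
have [|N [mN N0 hN]] := L2_fast_cauchy_ae La; first by move=> k; exact: ha.
(* Setting the functions to 0 on the exceptional set makes them converge everywhere on [D], so that
   the limit is measurable. *)
pose v k x := a k x * (\1_(~` N) x)%:C.
have ReV k x : complex.Re (v k x) = complex.Re (a k x) * \1_(~` N) x.
  by rewrite ReM /= mulr0 subr0.
have ImV k x : complex.Im (v k x) = complex.Im (a k x) * \1_(~` N) x.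
  by rewrite ImM /= mulr0 add0r.
have mI1 : measurable_fun D (\1_(~` N) : T -> R).
  by apply: measurable_indic; exact: measurableC.
have mRv k : measurable_fun D (fun x => complex.Re (v k x)).
  under eq_fun do rewrite ReV.
  by apply: measurable_funM => //; have [] := La k.
have mIv k : measurable_fun D (fun x => complex.Im (v k x)).
  under eq_fun do rewrite ImV.
  by apply: measurable_funM => //; have [] := La k.
have va k x : ~ N x -> v k x = a k x.
  by move=> Nx; rewrite /v indicE mem_set// mulr1.
have vN k x : N x -> v k x = 0.
  by move=> Nx; rewrite /v indicE memNset ?mulr0//; apply.
pose w x := limn (fun k => complex.Re (v k x)) +i* limn (fun k => complex.Im (v k x)).
have cR x : D x -> complex.Re (v k x) @[k --> \oo] --> complex.Re (w x).
  move=> Dx; suff : cvgn (fun k => complex.Re (v k x)) by [].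
  have [Nx|Nx] := pselect (N x).
    by under eq_fun do rewrite vN//; exact: is_cvg_cst.
  by under eq_fun do rewrite va//; have [] := hN x Dx Nx.
have cI x : D x -> complex.Im (v k x) @[k --> \oo] --> complex.Im (w x).
  move=> Dx; suff : cvgn (fun k => complex.Im (v k x)) by [].
  have [Nx|Nx] := pselect (N x).
    by under eq_fun do rewrite vN//; exact: is_cvg_cst.
  by under eq_fun do rewrite va//; have [] := hN x Dx Nx.
have mRw : measurable_fun D (fun x => complex.Re (w x)) := measurable_fun_cvg mRv cR.
have mIw : measurable_fun D (fun x => complex.Im (w x)) := measurable_fun_cvg mIv cI.
have key k : (\int[mu]_(x in D) (cabs (v k x - w x) ^+ 2)%:E <= ((4^-1) ^+ k.+1)%:E)%E.
  have mf m : measurable_fun D (fun x => (cabs (v k x - v m x) ^+ 2)%:E).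
    apply: (@measurable_cabs2 _ _ _ D (fun x => v k x - v m x)).
      by under eq_fun do rewrite ReD ReN; exact: measurable_funB.
    by under eq_fun do rewrite ImD ImN; exact: measurable_funB.
  have f0 m x : D x -> (0 <= (cabs (v k x - v m x) ^+ 2)%:E)%E.
    by rewrite lee_fin sqr_ge0.
  (* Here [k] is fixed and [m] tends to infinity. *)
  have := fatou mu mD mf f0.
  rewrite (@eq_integral _ _ _ mu D (fun x => (cabs (v k x - w x) ^+ 2)%:E)); last first.
    move=> x /[!inE] Dx; apply: (cvg_limn_einf_sup _).1.
    apply: cvg_EFin; first exact: nearW.
    apply: cabs2_cvg; rewrite ?ReD ?ReN ?ImD ?ImN.
      under eq_fun do rewrite ReD ReN.
      by apply: cvgB; [exact: cvg_cst|exact: cR].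
    under eq_fun do rewrite ImD ImN.
    by apply: cvgB; [exact: cvg_cst|exact: cI].
  move=> h; apply: le_trans h _.
  apply: (@limn_einf_le _ _ k) => m km.
  apply: (@le_trans _ _ (\int[mu]_(x in D) (cabs ((a m - a k) x) ^+ 2)%:E)%E).
    have [mR mI _] := memB HL (La m) (La k).
    apply: ge0_le_integral => //; [by move=> x _; rewrite lee_fin sqr_ge0|
      exact: measurable_cabs2|].
    move=> x Dx; rewrite lee_fin; have [Nx|Nx] := pselect (N x).
      by rewrite !vN// subrr cabs0 expr0n sqr_ge0.
    rewrite !va// !sqr_cabs !(ReD, ReN, ImD, ImN).
    by rewrite -sqrrN -[X in _ + X]sqrrN !opprB.
  rewrite -(sqr_L2norm mD); last exact: (memB HL).
  by rewrite lee_fin ha.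
have Lv k : L2 (v k).
  split=> //; have [mR mI aoo] := La k; apply: le_lt_trans aoo.
  apply: ge0_le_integral => //; [by move=> x _; rewrite lee_fin sqr_ge0|
    exact: measurable_cabs2..|].
  move=> x Dx; rewrite lee_fin; have [Nx|Nx] := pselect (N x); last by rewrite va.
  by rewrite vN// cabs0 expr0n sqr_ge0.
have key' k : L2 (v k - w) /\ nrm (v k - w) <= (2^-1) ^+ k.+1.
  apply: (L2_le_cabs2 mD); last by rewrite exprn_ge0.
  - by under eq_fun do rewrite ReD ReN; exact: measurable_funB.
  - by under eq_fun do rewrite ImD ImN; exact: measurable_funB.
  - apply: le_trans (key k) _; rewrite lee_fin -exprM mulnC exprM.
    by rewrite (_ : (2^-1) ^+ 2 = 4^-1)//; field.
have Lw : L2 w.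
  rewrite (_ : w = v 0%N - (v 0%N - w)); last by rewrite subKr.
  by apply: (memB HL) => //; exact: (key' 0%N).1.
exists w => // k.
have va0 : nrm (a k - v k) = 0.
  by apply: (L2_null_ae mD _ _ mN N0) => // x Dx Nx; rewrite va.
have : nrm (a k - w) <= (2^-1) ^+ k.+1.
  apply: le_trans (ler_hnormB_add HL (La k) (Lv k) Lw) _.
  by rewrite va0 add0r (key' k).2.
have : 0 <= nrm (a k - w) by exact: hnorm_ge0.
have -> : (4^-1) ^+ k.+1 = ((2^-1) ^+ k.+1) ^+ 2 :> R.
  by rewrite -exprM mulnC exprM (_ : (2^-1) ^+ 2 = 4^-1)//; field.
by move=> h1 h2; rewrite ler_pXn2r// nnegrE// exprn_ge0.
Qed.

Theorem L2_complete : complete_for L2 nrm.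
Proof.
move=> u Lu cu.
have hN k : exists n0, forall m n, (n0 <= m)%N -> (n0 <= n)%N ->
    nrm (u m - u n) < (2^-1) ^+ k.+1.
  by apply: cu; rewrite exprn_gt0.
have [n0 n0P] := choice hN.
(* Summing makes the index [s m] exceed [n0 k] for every [k <= m], although [n0] may fail to be
   monotone. *)
pose s k := \sum_(i < k.+1) n0 i.
have ns k m : (k <= m)%N -> (n0 k <= s m)%N.
  by move=> km; rewrite /s (bigD1 (inord k))//= inordK// leq_addr.
have [||w Lw hw] := @L2_fast_cauchy (fun k => u (s k)).
- by move=> k; exact: Lu.
- move=> k m km.
  have -> : (4^-1) ^+ k.+1 = ((2^-1) ^+ k.+1) ^+ 2 :> R.
    by rewrite -exprM mulnC exprM (_ : (2^-1) ^+ 2 = 4^-1)//; field.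
  rewrite ler_pXn2r// ?nnegrE ?hnorm_ge0 ?exprn_ge0//.
  by apply/ltW/n0P; exact: ns.
exists w => //; apply/cvg0P => [n|e e0]; first exact: hnorm_ge0.
have : (2^-1) ^+ k @[k --> \oo] --> (0 : R).
  by apply: cvg_expr; rewrite ger0_norm ?invr_ge0// invf_lt1// ltr1n.
move=> /cvg0P h; have [|k hk] := h _ e e0; first by move=> k; exact: exprn_ge0.
have hk1 := hk k (leqnn k).
exists (n0 k) => n nk.
apply: le_lt_trans (ler_hnormB_add HL (Lu n) (Lu (s k)) Lw) _.
have h1 := n0P k _ _ nk (ns k k (leqnn k)).
have h2 : nrm (u (s k) - w) <= (2^-1) ^+ k.+1.
  apply: ler_of_sqr; first exact: exprn_ge0.
  by rewrite (le_trans (hw k))// -exprM mulnC exprM (_ : (2^-1) ^+ 2 = 4^-1)//; field.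
apply: lt_trans hk1; apply: (lt_le_trans (ltr_leD h1 h2)).
by rewrite exprS; lra.
Qed.

End L2_complete.

(** * Test functions *)

Section smooth_functions.
Context {R : realType} {d : nat}.
Local Notation E := 'rV[R]_d.+1.
Implicit Types (f g h : E -> R) (m : nat) (i : 'I_d.+1).
Local Notation "''d_' i" := (fun h : E -> R => fun x => 'D_(unit_vec i) h x)
  (at level 0, i at level 0).

Definition smooth_real h := forall m, Cn m h.

Lemma Cn0 h : Cn 0 h = continuous h.
Proof. by []. Qed.

Lemma CnS m h : Cn m.+1 h = forall i,
  (forall x, derivable h x (unit_vec i)) /\ Cn m ('d_i h).
Proof. by []. Qed.

Lemma Cn_cst m (a : R) : Cn m (cst a : E -> R).
Proof.
elim: m a => [|m IH] a; first by rewrite Cn0 => x; exact: cst_continuous.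
rewrite CnS => i; split=> [x|]; first exact: derivable_cst.
rewrite (_ : 'd_i _ = cst 0); first exact: IH.
by apply/funext => x; exact: derive_cst.
Qed.

Lemma CnD m f g : Cn m f -> Cn m g -> Cn m (f + g).
Proof.
elim: m f g => [|m IH] f g.
  by rewrite !Cn0 => cf cg x; apply: continuousD; [exact: cf|exact: cg].
rewrite !CnS => hf hg i; have [df ddf] := hf i; have [dg ddg] := hg i.
split=> [x|]; first exact: derivableD.
rewrite (_ : 'd_i _ = 'd_i f + 'd_i g); first exact: IH.
by apply/funext => x; rewrite deriveD.
Qed.

Lemma CnZ m (a : R) f : Cn m f -> Cn m (a \*: f).
Proof.
elim: m f => [|m IH] f.
  by rewrite !Cn0 => cf x; apply: continuousZr; exact: cf.
rewrite !CnS => hf i; have [df ddf] := hf i.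
split=> [x|]; first exact: derivableZ.
rewrite (_ : 'd_i _ = a \*: 'd_i f); first exact: IH.
by apply/funext => x; rewrite deriveZ.
Qed.

Lemma smooth_real_derive i h : smooth_real h -> smooth_real ('d_i h).
Proof. by move=> sh m; have [] := sh m.+1 i. Qed.

Lemma smooth_real_derivable i h x : smooth_real h -> derivable h x (unit_vec i).
Proof. by move=> sh; have [] := sh 1%N i. Qed.

Lemma smooth_real_continuous h : smooth_real h -> continuous h.
Proof. by move=> sh; exact: sh 0%N. Qed.

Lemma smooth_real_cst (a : R) : smooth_real (cst a).
Proof. by move=> m; exact: Cn_cst. Qed.

Lemma smooth_realD f g : smooth_real f -> smooth_real g -> smooth_real (f + g).
Proof. by move=> sf sg m; exact: CnD. Qed.

Lemma smooth_realZ (a : R) f : smooth_real f -> smooth_real (a \*: f).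
Proof. by move=> sf m; exact: CnZ. Qed.

Lemma derive_realM i f g : smooth_real f -> smooth_real g ->
  'd_i (f * g) = f * 'd_i g + g * 'd_i f.
Proof.
move=> sf sg; apply/funext => x.
by rewrite deriveM//; exact: smooth_real_derivable.
Qed.

(** The induction keeps the factors smooth: the Leibniz rule contains the undifferentiated factors,
    and [Cn m.+1] does not have [Cn m] as a clause. *)
Lemma smooth_realM f g : smooth_real f -> smooth_real g -> smooth_real (f * g).
Proof.
move=> sf sg m; elim: m f g sf sg => [|m IH] f g sf sg.
  have := sf 0%N; have := sg 0%N; rewrite !Cn0 => cg cf x.
  by apply: continuousM; [exact: cf|exact: cg].
rewrite CnS => i; split=> [x|].
  by apply: derivableM; exact: smooth_real_derivable.
rewrite derive_realM//; apply: CnD; apply: IH => //; exact: smooth_real_derive.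
Qed.

Lemma smooth_real_prod (I : Type) (s : seq I) (F : I -> E -> R) :
  (forall j, smooth_real (F j)) -> smooth_real (fun x => \prod_(i <- s) F i x).
Proof.
move=> sF; elim: s => [|a s IH].
  rewrite (_ : (fun x => _) = cst 1); first exact: smooth_real_cst.
  by apply/funext => x; rewrite big_nil.
rewrite (_ : (fun x => _) = F a * (fun x => \prod_(i <- s) F i x)).
  exact: smooth_realM.
by apply/funext => x; rewrite big_cons.
Qed.

(** Passing to the line through [x] brings in one-variable calculus: this direction serves the mean
    value theorem, [derive_line] the computation of partial derivatives. *)
Lemma is_derive_line h (x v : E) (s : R) : derivable h (s *: v + x) v ->
  is_derive s 1 (fun t : R => h (t *: v + x)) ('D_v h (s *: v + x)).
Proof.
move=> dh.
have e : (fun t : R => t^-1 *: (((fun t : R => h (t *: v + x)) \o shift s) (t *: 1)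
    - h (s *: v + x))) =
  (fun t : R => t^-1 *: ((h \o shift (s *: v + x)) (t *: v) - h (s *: v + x))).
  apply/funext => t /=; congr (_ *: (h _ - _)).
  by rewrite [t *: 1]mulr1 scalerDl addrA.
by split; [rewrite /derivable e|rewrite /derive e].
Qed.

Lemma derive_line h (x v : E) (l : R) :
  is_derive (0 : R) 1 (fun t : R => h (t *: v + x)) l ->
  derivable h x v /\ 'D_v h x = l.
Proof.
move=> [dh <-].
have e : (fun t : R => t^-1 *: ((h \o shift x) (t *: v) - h x)) =
  (fun t : R => t^-1 *: (((fun t : R => h (t *: v + x)) \o shift 0) (t *: 1)
    - h (0 *: v + x))).
  by apply/funext => t /=; rewrite [t *: 1]mulr1 addr0 scale0r add0r.
by split; [rewrite /derivable e|rewrite /derive e].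
Qed.

End smooth_functions.

(** * Smooth one-variable functions that are flat at the origin *)

Section flat_functions.
Context {R : realType}.

(* The family [t ^ - n * exp (- 1 / t)], extended by 0 to [t <= 0], is closed
   under differentiation. *)
Definition flat (n : nat) (t : R) : R :=
  if 0 < t then (t^-1) ^+ n * expR (- t^-1) else 0.

Lemma flat_le0 n t : t <= 0 -> flat n t = 0.
Proof. by rewrite /flat ltNge => ->. Qed.

Lemma flat_ge0 n t : 0 <= flat n t.
Proof.
rewrite /flat; case: ifPn => // t0.
by rewrite mulr_ge0 ?expR_ge0// exprn_ge0// invr_ge0 ltW.
Qed.

Lemma flat_mulV n t : t^-1 * flat n t = flat n.+1 t.
Proof.
by rewrite /flat; case: ifPn => t0; rewrite ?mulr0// mulrA -exprS.
Qed.

(** With [s = t^-1], the estimate [expR s = expR (s / n.+1%:R) ^+ n.+1 >= (s / n.+1%:R) ^+ n.+1]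
    beats the power [s ^+ n] by one factor [s]. *)
Lemma flat_le n t : 0 < t -> flat n t <= n.+1%:R ^+ n.+1 * t.
Proof.
move=> t0; rewrite /flat t0; set s := t^-1; have s0 : 0 < s by rewrite invr_gt0.
have -> : t = s^-1 by rewrite invrK.
rewrite ler_pdivlMr// expRN mulrAC -exprSr ler_pdivrMr ?expR_gt0//.
have n0 : (0 : R) < n.+1%:R by rewrite ltr0n.
have -> : expR s = expR (s / n.+1%:R) ^+ n.+1.
  by rewrite -expRM_natl mulrC divfK// gt_eqF.
rewrite -exprMn lerXn2r ?nnegrE ?mulr_ge0 ?expR_ge0 ?(ltW s0) ?(ltW n0)//.
rewrite -ler_pdivrMl// mulrC.
by apply: le_trans (expR_ge1Dx _); rewrite lerDr.
Qed.

Lemma flat_norm_le n t : `|flat n t| <= n.+1%:R ^+ n.+1 * `|t|.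
Proof.
rewrite ger0_norm ?flat_ge0//; have [t0|t0] := leP t 0.
  by rewrite flat_le0// mulr_ge0// exprn_ge0.
by rewrite gtr0_norm// flat_le.
Qed.

Lemma flat_cvg0 n : flat n t @[t --> (0 : R)] --> (0 : R).
Proof.
apply/norm_cvg0P; apply: (@squeeze_cvgr _ _ _ _ (fun=> 0)
  (fun t => n.+1%:R ^+ n.+1 * `|t|)).
- by apply: nearW => t; rewrite normr_ge0 flat_norm_le.
- exact: cvg_cst.
- rewrite -[X in _ --> X](mulr0 (n.+1%:R ^+ n.+1)); apply: cvgMr.
  by rewrite -[X in _ --> X](@normr0 _ R); apply: cvg_norm; exact: cvg_id.
Qed.

Lemma is_derive_flat n (t : R) :
  is_derive t 1 (flat n) (- n%:R * flat n.+1 t + flat n.+2 t).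
Proof.
have [t0|t0|->] := ltgtP t 0.
- rewrite !flat_le0 ?(ltW t0)// mulr0 addr0.
  have h : is_derive t 1 (cst 0 : R -> R) 0 by exact: is_derive_cst.
  apply: near_eq_is_derive h.
  near=> s; have s0 : s < 0 by near: s; exact: lt_nbhsl.
  by rewrite flat_le0// ltW.
- have tn0 : t != 0 by rewrite gt_eqF.
  have dV : is_derive t 1 (fun s : R => s^-1) (- t ^- 2 *: 1) by exact: is_deriveV.
  have d1 : is_derive t 1 (-%R \o (fun s : R => s^-1)) (- 1 * (- t ^- 2 *: 1)).
    exact: is_derive1_comp.
  have dE : is_derive t 1 (expR \o (-%R \o (fun s => s^-1)))
      (expR (- t^-1) * (- 1 * (- t ^- 2 *: 1))).
    exact: (@is_derive1_comp _ expR).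
  have := is_deriveM (is_deriveX n dV) dE.
  move=> h; apply: (@near_eq_is_derive _ _ _
      ((fun s : R => s^-1) ^+ n * (expR \o (-%R \o (fun s : R => s^-1))))).
    near=> s; have s0 : 0 < s by near: s; exact: lt_nbhsr.
    rewrite /flat s0.
    by rewrite [LHS]/GRing.mul /= exprfctE.
  apply: (is_derive_eq h); rewrite /flat t0 /= exprfctE /= /GRing.scale /=.
  case: n {h} => [|n]; first by rewrite !expr0 !exprS exprVn; field.
  by rewrite /= !exprS; field.
- rewrite !flat_le0// mulr0 addr0.
  (* At the origin the difference quotient of [flat n] is [flat n.+1] itself, which tends to 0. *)
  have e : (fun h : R => h^-1 *: ((flat n \o shift 0) (h *: 1) - flat n 0)) = flat n.+1.
    apply/funext => h /=; rewrite (flat_le0 n (lexx 0)) subr0 addr0 [h *: 1]mulr1.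
    exact: flat_mulV.
  have c0 : flat n.+1 h @[h --> 0^'] --> (0 : R).
    by apply: cvg_within_filter; exact: flat_cvg0.
  split; rewrite /derivable /derive e; first by apply: cvgP c0.
  exact: cvg_lim c0.
Unshelve. all: by end_near. Qed.

End flat_functions.

(** * Compactly supported smooth functions and the approximation of open sets *)

Section test_functions.
Context {R : realType} {d : nat}.
Local Notation E := 'rV[R]_d.+1.
Implicit Types (f g h : E -> R) (U : set E).
Local Notation "''d_' i" := (fun h : E -> R => fun x => 'D_(unit_vec i) h x)
  (at level 0, i at level 0).

Lemma continuous_flat n : continuous (flat n : R -> R).
Proof.
move=> t; have [dt _] := is_derive_flat n t.
by apply: differentiable_continuous; apply/derivable1_diffP.
Qed.

(** The induction on [m] runs for all [n] at once, because a derivative of [flat n] brings in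
    [flat n.+1] and [flat n.+2] at the same affine argument. *)
Lemma Cn_flat_affine m n j (a b : R) :
  Cn m (fun x : E => flat n (a * x 0 j + b)).
Proof.
elim: m n => [|m IH] n.
  rewrite Cn0 => x.
  apply: (@continuous_comp _ _ _ (fun x : E => a * x 0 j + b) (flat n));
    last exact: continuous_flat.
  have cj : continuous (fun y : E => y 0 j) by exact: coord_continuous.
  apply: continuousD; last exact: cst_continuous.
  by apply: continuousM; [exact: cst_continuous|exact: cj].
rewrite CnS => i.
pose c := a * (unit_vec i : E) 0 j.
have D x : is_derive (0 : R) 1
    (fun t : R => flat n (a * (t *: unit_vec i + x : E) 0 j + b))
    ((- n%:R * flat n.+1 (a * x 0 j + b) + flat n.+2 (a * x 0 j + b)) * c).
  rewrite (_ : (fun t => _) = flat n \o (fun t : R => c * t + (a * x 0 j + b))).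
    apply: is_derive1_comp.
      by rewrite mulr0 add0r; exact: is_derive_flat.
    have h : is_derive (0 : R) 1 (c \*: (id : R -> R) + cst (a * x 0 j + b)) (c *: 1 + 0).
      by apply: is_deriveD; apply: is_deriveZ.
    by apply: (is_derive_eq h); rewrite addr0 [LHS]mulr1.
  by apply/funext => t /=; rewrite !mxE /c mxE; congr (flat _ _); ring.
pose h (x : E) := flat n (a * x 0 j + b).
split=> [x|]; first by have [] := @derive_line _ _ h _ _ _ (D x).
rewrite (_ : 'd_i _ = c \*: (- n%:R \*: (fun x : E => flat n.+1 (a * x 0 j + b)) +
  (fun x : E => flat n.+2 (a * x 0 j + b)))).
  by apply: CnZ; apply: CnD; [apply: CnZ|]; exact: IH.
by apply/funext => x; have [_ ->] := @derive_line _ _ h _ _ _ (D x); rewrite mulrC.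
Qed.

(** Vanishing off some compact part of [U] behaves better under sums, products and derivatives than
    a condition on the closure of the support. *)
Definition test_fun U h := smooth_real h /\
  exists K : set E, [/\ compact K, K `<=` U & forall x, ~ K x -> h x = 0].

Lemma test_funS U V h : U `<=` V -> test_fun U h -> test_fun V h.
Proof.
move=> UV [sh [K [cK KU hK]]]; split=> //.
by exists K; split=> //; exact: subset_trans UV.
Qed.

Lemma test_fun_smooth U h : test_fun U h -> smooth_real h.
Proof. by case. Qed.

Lemma test_fun_out U h x : test_fun U h -> ~ U x -> h x = 0.
Proof. by move=> [_ [K [_ KU hK]]] Ux; apply: hK => /KU. Qed.

Lemma test_fun0 U : test_fun U (cst 0).
Proof.
by split; [exact: smooth_real_cst|exists set0; split=> //; exact: compact0].
Qed.

Lemma test_funD U f g : test_fun U f -> test_fun U g -> test_fun U (f + g).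
Proof.
move=> [sf [K [cK KU fK]]] [sg [L [cL LU gL]]].
split; first exact: smooth_realD.
exists (K `|` L); split; [exact: compactU|by move=> x [/KU|/LU]|].
by move=> x /not_orP[xK xL]; rewrite [LHS]/GRing.add /= fK// gL// addr0.
Qed.

Lemma test_funM U f g : test_fun U f -> smooth_real g -> test_fun U (f * g).
Proof.
move=> [sf [K [cK KU fK]]] sg; split; first exact: smooth_realM.
by exists K; split=> // x xK; rewrite [LHS]/GRing.mul /= fK// mul0r.
Qed.

Lemma test_funZ U (a : R) f : test_fun U f -> test_fun U (a \*: f).
Proof.
move=> [sf [K [cK KU fK]]]; split; first exact: smooth_realZ.
by exists K; split=> // x xK; rewrite /= fK// scaler0.
Qed.

Lemma compact_closed_rV (K : set E) : compact K -> closed K.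
Proof. by apply: compact_closed; exact: norm_hausdorff. Qed.

Lemma derive_near0 i h (K : set E) x : closed K ->
  (forall y, ~ K y -> h y = 0) -> ~ K x -> 'D_(unit_vec i) h x = 0.
Proof.
move=> cK hK xK; rewrite -(derive_cst (0 : R) x (unit_vec i)).
apply: near_eq_derive.
have oK : open (~` K) by exact: closed_openC.
by apply: filterS (open_nbhs_nbhs (conj oK xK)) => y /hK.
Qed.

Lemma test_fun_derive U i h : test_fun U h -> test_fun U ('d_i h).
Proof.
move=> [sh [K [cK KU hK]]]; split; first exact: smooth_real_derive.
exists K; split=> // x; apply: derive_near0 => //; exact: compact_closed_rV.
Qed.

Lemma compact_closed_box (c : E * E) :
  compact [set x : E | forall j, c.1 0 j <= x 0 j <= c.2 0 j].
Proof.
have := @rV_compact R d.+1 (fun j => `[c.1 0 j, c.2 0 j]%classic)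
  (fun j => @segment_compact _ _ _).
by congr (compact _); apply/seteqP; split=> x h j; have := h j;
  rewrite /= in_itv.
Qed.

(** Inside the open box both arguments grow linearly in [n], and [flat 0] tends to 1 at infinity.
    The arguments are spelled out in the affine shape of [Cn_flat_affine]. *)
Definition bump (c : E * E) (n : nat) (x : E) : R :=
  \prod_(j <- index_enum 'I_d.+1)
    (flat 0 (n.+1%:R * x 0 j + - (n.+1%:R * c.1 0 j)) *
     flat 0 (- n.+1%:R * x 0 j + n.+1%:R * c.2 0 j)).

Lemma smooth_bump c n : smooth_real (bump c n).
Proof.
apply: smooth_real_prod => j.
by apply: (@smooth_realM _ _
  (fun x : E => flat 0 (n.+1%:R * x 0 j + - (n.+1%:R * c.1 0 j)))
  (fun x : E => flat 0 (- n.+1%:R * x 0 j + n.+1%:R * c.2 0 j))) => m;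
  exact: Cn_flat_affine.
Qed.

Lemma flat0_le1 (t : R) : flat 0 t <= 1.
Proof.
rewrite /flat; case: ifP => // t0; rewrite expr0 mul1r -[leRHS]expR0 ler_expR.
by rewrite oppr_le0 invr_ge0 ltW.
Qed.

Lemma bump_ge0 c n x : 0 <= bump c n x.
Proof. by apply: prodr_ge0 => j _; rewrite mulr_ge0 ?flat_ge0. Qed.

Lemma bump_le1 c n x : bump c n x <= 1.
Proof.
by apply: prodr_ile1 => j _; rewrite mulr_ge0 ?flat_ge0//= mulr_ile1
  ?flat_ge0 ?flat0_le1.
Qed.

Lemma bump_out c n x : ~ open_box c x -> bump c n x = 0.
Proof.
move=> /existsNP[j /negP]; rewrite negb_and -!leNgt => xj.
rewrite /bump (bigD1_seq j) ?mem_index_enum ?index_enum_uniq//=.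
have n0 : (0 : R) <= n.+1%:R by rewrite ler0n.
case/orP: xj => xj; first rewrite (@flat_le0 _ 0 (_ + - _)) ?mul0r//.
  by rewrite subr_le0 ler_wpM2l.
rewrite (@flat_le0 _ 0 (- _ * _ + _)) ?mulr0 ?mul0r//.
by rewrite mulNr addrC subr_le0 ler_wpM2l.
Qed.

Lemma flat0_cvg1 (y : R) : 0 < y -> flat 0 (n.+1%:R * y) @[n --> \oo] --> (1 : R).
Proof.
move=> y0; have h : (n.+1%:R^-1 : R) * y^-1 @[n --> \oo] --> 0 * y^-1.
  by apply: cvgMl; exact: cvg_harmonic.
rewrite mul0r in h.
have h1 : - (n.+1%:R^-1 * y^-1 : R) @[n --> \oo] --> - (0 : R) by exact: cvgN.
rewrite oppr0 in h1.
have h2 : expR (- (n.+1%:R^-1 * y^-1)) @[n --> \oo] --> expR (0 : R).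
  by apply: continuous_cvg h1; exact: continuous_expR.
rewrite expR0 in h2.
rewrite (_ : (fun n => _) = (fun n : nat => expR (- (n.+1%:R^-1 * y^-1))))//.
by apply/funext => n; rewrite /flat mulr_gt0// expr0 mul1r invfM.
Qed.

Lemma cvg_prod1 (I : Type) (s : seq I) (F : I -> nat -> R) :
  (forall j, F j n @[n --> \oo] --> (1 : R)) ->
  \prod_(j <- s) F j n @[n --> \oo] --> (1 : R).
Proof.
move=> hF; elim: s => [|j s IH].
  by under eq_fun do rewrite big_nil; exact: cvg_cst.
rewrite (_ : (fun n => _) = (fun n => F j n * \prod_(i <- s) F i n)).
  have h : (fun n => F j n * \prod_(i <- s) F i n) @ \oo --> (1 : R) * 1.
    by apply: cvgM.
  by rewrite mulr1 in h.
by apply/funext => n; rewrite big_cons.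
Qed.

Lemma bump_cvg1 c x : open_box c x -> bump c n x @[n --> \oo] --> (1 : R).
Proof.
move=> cx; apply: cvg_prod1 => j; have /andP[h1 h2] := cx j.
have l1 : 0 < x 0 j - c.1 0 j by rewrite subr_gt0.
have l2 : 0 < c.2 0 j - x 0 j by rewrite subr_gt0.
have h : (fun n : nat => flat 0 (n.+1%:R * (x 0 j - c.1 0 j)) *
  flat 0 (n.+1%:R * (c.2 0 j - x 0 j))) @ \oo --> (1 : R) * 1.
  by apply: cvgM; exact: flat0_cvg1.
rewrite mulr1 in h; rewrite (_ : (fun n => _) = (fun n : nat =>
  flat 0 (n.+1%:R * (x 0 j - c.1 0 j)) * flat 0 (n.+1%:R * (c.2 0 j - x 0 j))))//.
by apply/funext => n; rewrite !mulrBr mulNr [in X in _ * X]addrC.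
Qed.

Lemma test_fun_bump U (c : E * E) n :
  [set y : E | forall j, c.1 0 j <= y 0 j <= c.2 0 j] `<=` U \/ open_box c = set0 ->
  test_fun U (bump c n).
Proof.
move=> hU; split; first exact: smooth_bump.
case: hU => hU; last first.
  exists set0; split=> //; first exact: compact0.
  by move=> x _; apply: bump_out; rewrite hU.
exists [set y : E | forall j, c.1 0 j <= y 0 j <= c.2 0 j].
split=> //; first exact: compact_closed_box.
move=> x hx; apply: bump_out => ox; apply: hx => j.
by have /andP[/ltW -> /ltW ->] := ox j.
Qed.

(* [1 - \prod_(k < m) (1 - bump (c k) n)] *)
Fixpoint bump_union (c : nat -> E * E) (n m : nat) : E -> R :=
  if m is m'.+1 then
    bump_union c n m' + bump (c m') n + (-1) \*: (bump (c m') n * bump_union c n m')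
  else cst 0.

Lemma bump_unionS c n m x : bump_union c n m.+1 x =
  bump_union c n m x + bump (c m) n x - bump (c m) n x * bump_union c n m x.
Proof. by rewrite /= -[in RHS]mulN1r. Qed.

Lemma bump_union01 c n m x : 0 <= bump_union c n m x <= 1.
Proof.
elim: m => [|m IH]; first by rewrite /= lexx ler01.
rewrite bump_unionS; have := bump_ge0 (c m) n x; have := bump_le1 (c m) n x.
by move: IH => /andP[]; move: (bump_union _ _ _ _) (bump _ _ _) => p t *;
  apply/andP; split; nra.
Qed.

Lemma bump_union_ge c n m k x : (k < m)%N -> bump (c k) n x <= bump_union c n m x.
Proof.
elim: m => // m IH; rewrite ltnS leq_eqVlt bump_unionS => km.
have /andP[p0 p1] := bump_union01 c n m x.
have := bump_ge0 (c m) n x; have := bump_le1 (c m) n x.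
case/orP: km => [/eqP ->|/IH]; move: (bump_union _ _ _ _) p0 p1 => p p0 p1;
  move: (bump (c m) n x) => t; nra.
Qed.

(** Diagonal choice: the [n]-th function uses the first [n] boxes with steepness [n]. At a point of
    the [k]-th box it lies between [bump (c k) n] and 1 as soon as [k < n]. *)
Lemma open_approx U : open U -> exists phi : nat -> E -> R,
  [/\ forall n, test_fun U (phi n), forall n x, 0 <= phi n x <= 1 &
      forall x, phi n x @[n --> \oo] --> (\1_U x : R)].
Proof.
move=> oU; have [c [cU Uc]] := open_bigcup_boxes oU.
have tU n m : test_fun U (bump_union c n m).
  elim: m => [|m IH]; first exact: test_fun0.
  have tb := test_fun_bump n (cU m).
  apply: test_funD; first exact: test_funD.
  by apply: test_funZ; apply: test_funM => //; exact: test_fun_smooth IH.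
exists (fun n => bump_union c n n); split=> // [n x|x].
  exact: bump_union01.
have [Ux|Ux] := pselect (U x); last first.
  rewrite indicE memNset//; under eq_fun do rewrite (test_fun_out (tU _ _) Ux).
  exact: cvg_cst.
rewrite indicE mem_set//; move: (Ux); rewrite Uc => -[k _ ckx].
apply: (@squeeze_cvgr _ _ _ _ (fun n => bump (c k) n x) (fun=> 1)).
- exists k.+1 => // n /= kn; rewrite bump_union_ge//=.
  by have /andP[] := bump_union01 c n n x.
- exact: bump_cvg1.
- exact: cvg_cst.
Qed.

End test_functions.

(** * Integrals of derivatives of test functions *)

Section integration_by_parts.
Context {R : realType} {d : nat}.
Local Notation E := 'rV[R]_d.+1.
Local Notation ET := (caratheodory_type (@lebesgue_om R d)).
Local Notation lambda := (lebesgue_rV R d).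
Implicit Types (f g h : E -> R) (U : set E).
Local Notation "''d_' i" := (fun h : E -> R => fun x => 'D_(unit_vec i) h x)
  (at level 0, i at level 0).

Lemma measurable_norm_le (r : R) : measurable ([set x : E | `|x| <= r] : set ET).
Proof.
rewrite -[X in measurable X]setCK; apply: measurableC; apply: measurable_open.
have -> : ~` [set x : E | `|x| <= r] = [set x | r < `|x|].
  by apply/seteqP; split=> x /=; [move/negP; rewrite -ltNge|rewrite ltNge => /negP].
have -> : [set x : E | r < `|x|] = (fun x : E => `|x|) @^-1` [set y | r < y] by [].
apply: open_comp => [x _|]; [exact: norm_continuous|exact: open_gt].
Qed.

Lemma bounded_norm_le (r : R) : bounded_set [set x : E | `|x| <= r].
Proof.
exists r; split; first exact: num_real.
by move=> s rs x /= xr; rewrite (le_trans xr)// ltW.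
Qed.

Lemma integrable_norm_le_indic (M r : R) :
  lambda.-integrable setT (fun x : ET => (M * \1_[set y : E | `|y| <= r] x)%:E).
Proof.
rewrite (_ : (fun x => _) = (fun x : ET => M%:E * (\1_[set y : E | `|y| <= r] x)%:E)%E).
  have mB := measurable_norm_le r.
  apply: integrableZl => //; apply/integrableP; split; first exact/measurable_EFinP.
  rewrite (eq_integral (fun x : ET => (\1_[set y : E | `|y| <= r] x)%:E)).
    rewrite integral_indic// setIT.
    by apply: lebesgue_outer_bounded; exact: bounded_norm_le.
  by move=> x _; rewrite gee0_abs// lee_fin.
by apply/funext.
Qed.

Lemma le_bounded_support f (M r : R) : (forall x, `|f x| <= M) ->
  (forall x, r < `|x| -> f x = 0) ->
  forall x, `|f x| <= M * \1_[set y : E | `|y| <= r] x.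
Proof.
move=> fM f0 x; have [xr|xr] := leP `|x| r.
  by rewrite indicE mem_set ?mulr1.
rewrite indicE memNset ?mulr0 ?f0 ?normr0//.
by move=> /=; rewrite leNgt xr.
Qed.

Lemma bounded_support_integrable f (M r : R) :
  measurable_fun setT (f : ET -> R) -> (forall x, `|f x| <= M) ->
  (forall x, r < `|x| -> f x = 0) ->
  lambda.-integrable setT (fun x : ET => (f x)%:E).
Proof.
move=> mf fM f0; apply: (le_integrable _ _ _ (integrable_norm_le_indic M r)) => //.
  exact/measurable_EFinP.
move=> x _ /=; rewrite lee_fin.
apply: le_trans (le_bounded_support fM f0 x) _; exact: ler_norm.
Qed.

Lemma test_fun_bounds U h : test_fun U h ->
  exists M r, [/\ 0 <= M, forall x, `|h x| <= M & forall x, r < `|x| -> h x = 0].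
Proof.
move=> [sh [K [cK _ hK]]].
have [r [_ hr]] := compact_bounded cK.
have ch : compact (h @` K).
  apply: continuous_compact => //; apply: continuous_subspaceT.
  exact: smooth_real_continuous.
have [M [_ hM]] := compact_bounded ch.
exists (Num.max (M + 1) 0), (r + 1); split=> [|x|x xr].
- by rewrite le_max lexx orbT.
- have [Kx|Kx] := pselect (K x); last by rewrite hK// normr0 le_max lexx orbT.
  rewrite le_max; apply/orP; left; apply: (hM (M + 1)); first by rewrite ltrDl.
  by exists x.
- apply: hK => Kx; have := hr (r + 1); rewrite ltrDl ltr01 => /(_ isT _ Kx) /=.
  by rewrite leNgt xr.
Qed.

Lemma smooth_real_measurable h : smooth_real h -> measurable_fun setT (h : ET -> R).
Proof.
by move=> sh; apply: measurable_fun_continuous; exact: smooth_real_continuous.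
Qed.

Lemma test_fun_integrable U h : test_fun U h ->
  lambda.-integrable setT (fun x : ET => (h x)%:E).
Proof.
move=> th; have [M [r [_ hM hr]]] := test_fun_bounds th.
apply: bounded_support_integrable hM hr.
exact/smooth_real_measurable/(test_fun_smooth th).
Qed.

Lemma integral_translate (f : E -> R) (a : E) : measurable_fun setT (f : ET -> R) ->
  lambda.-integrable setT (fun x : ET => (f (x + a))%:E) ->
  (\int[lambda]_x (f (x + a))%:E = \int[lambda]_x (f x)%:E)%E.
Proof.
move=> mf fi.
have mt := measurable_translate a.
have mf' : measurable_fun setT (fun x : ET => (f x)%:E) by apply/measurable_EFinP.
have := @integral_pushforward _ _ _ _ _ _ mt lambda setT (fun x => (f x)%:E) mf'.
rewrite preimage_setT => /(_ fi measurableT) <-.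
apply: eq_measure_integral => A mA _; have := lebesgue_outer_translate a A.
by move=> e; exact: e.
Qed.

Lemma difference_quotient_cvg h (v x : E) : derivable h x v ->
  (n.+1%:R * (h (n.+1%:R^-1 *: v + x) - h x)) @[n --> \oo] --> 'D_v h x.
Proof.
move=> dh.
have h0 : (fun n : nat => n.+1%:R^-1 : R) @ \oo --> (0 : R)^'.
  move=> A /= [e e0 eA].
  have /cvgrPdist_lt/(_ e e0)[N _ hN] := @cvg_harmonic R.
  exists N => // n /= Nn; apply: eA; first by have := hN n Nn.
  by rewrite invr_eq0 pnatr_eq0.
have := cvg_comp _ _ h0 dh.
by apply: cvg_trans; apply: near_eq_cvg; apply: nearW => n /=; rewrite invrK.
Qed.

Lemma mean_value_bound h (v x : E) (M t : R) : 0 < t ->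
  (forall y, derivable h y v) -> (forall y, `|'D_v h y| <= M) ->
  `|h (t *: v + x) - h x| <= M * t.
Proof.
move=> t0 dh hM.
pose k s := h (s *: v + x).
have dk (s : R) : is_derive s 1 k ('D_v h (s *: v + x)) by exact: is_derive_line.
have ck : {within `[0, t], continuous k}.
  apply: derivable_within_continuous => s _; by have [] := dk s.
have [c _] := MVT t0 (fun s _ => dk s) ck.
rewrite /k scale0r add0r subr0 => ->; rewrite normrM (gtr0_norm t0).
by rewrite ler_wpM2r// ltW.
Qed.

Lemma norm_unit_vec i : `|(unit_vec i : E)| <= 1.
Proof.
rewrite /Num.norm/= mx_normrE; apply/bigmax_leP; split=> // j _.
by rewrite mxE; case: andP => _; rewrite ?normr1 ?normr0.
Qed.

(* Translation invariance makes the integral of every difference quotient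
   vanish. *)
Lemma integral_derive_test_fun U i h : test_fun U h ->
  (\int[lambda]_x ('D_(unit_vec i) h x)%:E = 0)%E.
Proof.
move=> th; have [_ [r [_ _ hr]]] := test_fun_bounds th.
have [M [_ [M0 hM _]]] := test_fun_bounds (test_fun_derive i th).
have sh := test_fun_smooth th.
have dh y : derivable h y (unit_vec i) by exact: smooth_real_derivable.
pose q (n : nat) (x : E) : R := n.+1%:R * (h (n.+1%:R^-1 *: unit_vec i + x) - h x).
have mh := smooth_real_measurable sh.
have mhn n : measurable_fun setT ((fun x => h (n.+1%:R^-1 *: unit_vec i + x)) : ET -> R).
  apply: measurable_fun_continuous => x.
  apply: (@continuous_comp _ _ _ (fun x : E => n.+1%:R^-1 *: unit_vec i + x) h).
    by apply: continuousD; [exact: cst_continuous|exact: cvg_id].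
  exact: smooth_real_continuous.
have mq n : measurable_fun setT (q n : ET -> R).
  exact: (measurable_funM (measurable_cst _) (measurable_funB (mhn n) mh)).
(* The shift has norm at most 1, so all difference quotients vanish outside the ball of radius
   [r + 1]. *)
have tn n (x : E) : r + 1 < `|x| -> r < `|n.+1%:R^-1 *: unit_vec i + x|.
  move=> xr; set c := n.+1%:R^-1 *: _.
  have c1 : `|c| <= 1.
    rewrite /c normrZ ger0_norm ?invr_ge0// mulr_ile1 ?norm_unit_vec ?invr_ge0//.
    by rewrite invf_le1 ?ltr0n// ler1n.
  have := ler_normD (c + x) (- c); rewrite addrAC subrr add0r normrN => h1.
  by rewrite -(ltrD2r 1) (lt_le_trans xr)// (le_trans h1)// lerD2l.
have hi := test_fun_integrable th.
have hin n : lambda.-integrable setT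
    (fun x : ET => (h (n.+1%:R^-1 *: unit_vec i + x))%:E).
  have [M1 [_ [_ hM1 _]]] := test_fun_bounds th.
  by apply: (@bounded_support_integrable _ M1 (r + 1)) => // x /tn /hr.
have q0 n : (\int[lambda]_x (q n x)%:E = 0)%E.
  rewrite /q; under eq_integral do rewrite EFinM EFinB.
  rewrite (integralZl measurableT (integrableB measurableT (hin n) hi)).
  rewrite (integralB measurableT (hin n) hi).
  have e := @integral_translate h (n.+1%:R^-1 *: unit_vec i) mh.
  under [X in (_ * (X - _))%E]eq_integral do rewrite addrC.
  rewrite e; last first.
    rewrite (_ : (fun x => _) = (fun x : ET => (h (n.+1%:R^-1 *: unit_vec i + x))%:E))//.
    by apply/funext => x; rewrite addrC.
  by rewrite subee ?mule0//; exact: integrable_fin_num hi.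
(* The mean value theorem supplies a dominating function independent of [n]. *)
have qb n x : `|q n x| <= M * \1_[set y : E | `|y| <= r + 1] x.
  apply: le_bounded_support => {}x.
    rewrite normrM ger0_norm// mulrC -ler_pdivlMr ?ltr0n//.
    by apply: mean_value_bound.
  move=> xr; rewrite /q !hr ?subrr ?mulr0//; last exact: tn.
  by apply: lt_trans xr; rewrite ltrDl.
have [|||||_ _] := @dominated_convergence _ _ _ lambda setT measurableT
  (fun n (x : ET) => (q n x)%:E) (fun x : ET => ('D_(unit_vec i) h x)%:E)
  (fun x : ET => (M * \1_[set y : E | `|y| <= r + 1] x)%:E).
- by move=> n; apply/measurable_EFinP.
- apply/measurable_EFinP; apply: smooth_real_measurable.
  exact: smooth_real_derive.
- apply: aeW => x _; apply: cvg_EFin; first exact: nearW.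
  exact: difference_quotient_cvg.
- exact: integrable_norm_le_indic.
- by apply: aeW => x n _; rewrite lee_fin qb.
under eq_fun do rewrite q0.
by move=> /cvg_lim <-//; rewrite lim_cst.
Qed.

End integration_by_parts.

(** * The fundamental lemma of the calculus of variations *)

Section fundamental_lemma.
Context {R : realType} {d : nat}.
Local Notation E := 'rV[R]_d.+1.
Local Notation ET := (caratheodory_type (@lebesgue_om R d)).
Local Notation lambda := (lebesgue_rV R d).
Variables (Omega : set E) (r : E -> R).
Hypothesis oO : open Omega.
Hypothesis finO : (lambda Omega < +oo)%E.
Hypothesis ri : lambda.-integrable setT (EFin \o (r : ET -> R)).
Hypothesis r_out : forall x, ~ Omega x -> r x = 0.
Hypothesis r_test : forall phi, test_fun Omega phi ->
  (\int[lambda]_x (r x * phi x)%:E = 0)%E.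

Let mr : measurable_fun setT (r : ET -> R).
Proof. by apply/measurable_EFinP; exact: measurable_int ri. Qed.

(** Test functions approximate the indicator of the part of [U] in [Omega], with [|r|] as dominating
    function; off [Omega] the integrand vanishes. *)
Let integral_open0 (U : set E) : open U -> (\int[lambda]_(x in U) (r x)%:E = 0)%E.
Proof.
move=> oU; have [phi [tphi phi01 phi1]] := open_approx (openI oU oO).
have tO n : test_fun Omega (phi n) by apply: test_funS (tphi n) => x [].
have mphi n : measurable_fun setT (phi n : ET -> R).
  exact: smooth_real_measurable (test_fun_smooth (tphi n)).
have m1 : measurable_fun setT (\1_(U `&` Omega) : ET -> R).
  by apply: measurable_indic; apply: measurable_open; exact: openI.
have [|||||_ _] := @dominated_convergence _ _ _ lambda setT measurableT
  (fun n (x : ET) => (r x * phi n x)%:E)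
  (fun x : ET => (r x * \1_(U `&` Omega) x)%:E) (fun x : ET => `|(r x)%:E|%E).
- by move=> n; apply/measurable_EFinP; exact: (measurable_funM mr (mphi n)).
- by apply/measurable_EFinP; exact: (measurable_funM mr m1).
- apply: aeW => x _; apply: cvg_EFin; first exact: nearW.
  by apply: cvgMr; exact: phi1.
- exact: (integrable_abse ri).
- apply: aeW => x n _; rewrite /= lee_fin normrM ler_piMr//.
  by have /andP[p0 p1] := phi01 n x; rewrite ger0_norm.
under eq_fun do rewrite (r_test (tO _)).
move=> h.
have e0 : (\int[lambda]_x (r x * \1_(U `&` Omega) x)%:E)%E = 0%E.
  by move/cvg_lim: h => <-//; rewrite lim_cst.
rewrite -[RHS]e0 [LHS]integral_mkcond; apply: eq_integral => x _.
rewrite patchE indicE /=; case: ifPn => xU.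
  have [xO|xO] := pselect (Omega x); last by rewrite r_out ?mul0r.
  by rewrite mem_set ?mulr1//; split=> //; rewrite inE in xU.
by rewrite memNset ?mulr0//; move=> [xU' _]; move/negP: xU; apply; rewrite inE.
Qed.

(** The part of [A] in [Omega] has finite measure, so an open [U] exceeds it by little. The integral
    over [U] is 0, and the one over the excess is small by absolute continuity of the integral. *)
Let integral_measurable0 (A : set E) : measurable (A : set ET) ->
  (\int[lambda]_(x in A) (r x)%:E = 0)%E.
Proof.
move=> mA.
have mO : measurable (Omega : set ET) by exact: measurable_open.
have mAO : measurable (A `&` Omega : set ET) by exact: measurableI.
have -> : (\int[lambda]_(x in A) (r x)%:E)%E =
    (\int[lambda]_(x in (A `&` Omega : set ET)) (r x)%:E)%E.
  rewrite integral_mkcond [RHS]integral_mkcond; apply: eq_integral => x _.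
  rewrite !patchE in_setI; case: (x \in A) => //=.
  case: ifPn => // /negP xO; rewrite /= r_out//.
  by move=> Ox; apply: xO; rewrite inE.
have riB (B : set ET) : measurable B -> lambda.-integrable B (EFin \o r).
  by move=> mB; exact: (integrableS measurableT mB (@subsetT _ _) ri).
suff : (\int[lambda]_(x in (A `&` Omega : set ET)) r x)%R = 0.
  move=> e0; rewrite -[LHS]fineK; last exact: integrable_fin_num (riB _ mAO).
  by congr (_%:E).
apply/eqP; rewrite -normr_eq0 eq_le normr_ge0 andbT; apply/ler_addgt0Pl => e e0.
rewrite addr0.
have [t [t0 ht]] := integral_normr_continuous ri e0.
have t2 : 0 < t / 2 by rewrite divr_gt0.
have AOoo : (lebesgue_outer (A `&` Omega) < +oo)%E.
  by apply: le_lt_trans finO; apply: le_outer_measure; exact: subIsetr.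
have [U [oU AU mU]] := lebesgue_outer_regular AOoo t2.
have mU' : measurable (U : set ET) by exact: measurable_open.
set B := A `&` Omega in mAO AOoo AU mU *.
have mUB : measurable (U `\` B : set ET) by exact: measurableD.
have UBE : B `|` (U `\` B) = U by rewrite setDUK.
have lamUB : (lambda (U `\` B : set ET) < t%:E)%E.
  have := @measureU _ _ _ lambda B (U `\` B) mAO mUB.
  rewrite setDIK => /(_ erefl); rewrite UBE => e1.
  have fB : lambda B \is a fin_num by rewrite ge0_fin_numE.
  have : (lambda B + lambda (U `\` B : set ET) <= lambda B + (t / 2)%:E)%E.
    by rewrite -e1.
  rewrite leeD2lE// => /le_lt_trans; apply.
  by rewrite lte_fin ltr_pdivrMr// ltr_pMr// ltr1n.
have eB : (\int[lambda]_(x in (B : set ET)) r x)%R =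
    - (\int[lambda]_(x in (U `\` B : set ET)) r x)%R.
  apply/eqP; rewrite -addr_eq0 -Rintegral_setU//.
  - by rewrite UBE /Rintegral integral_open0.
  - by rewrite UBE; exact: riB.
  - by apply/disj_setPS => x [Bx [_ /(_ Bx)]].
rewrite eB normrN; apply: ltW; apply: le_lt_trans (ht _ mUB lamUB).
by apply: le_normr_Rintegral => //; exact: riB.
Qed.

(** Integrating over the set where [r] is positive and over its complement shows that the integral
    of [|r|] is 0. *)
Lemma test_fun_orthogonal_ae0 : exists N : set ET,
  [/\ measurable N, lambda N = 0%E & forall x, ~ N x -> r x = 0].
Proof.
pose A : set ET := [set x | 0 < r x].
have mA : measurable A.
  have := mr measurableT (measurable_itv `]0, +oo[).
  rewrite setTI; congr measurable; apply/seteqP; split=> x /=;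
  by rewrite in_itv/= andbT.
have mrE := measurable_int lambda ri.
have e0 : (\int[lambda]_x `|(r x)%:E| = 0)%E.
  have mabs : measurable_fun setT (fun x : ET => `|(r x)%:E|%E) by exact: measurableT_comp.
  rewrite -(setUv A) ge0_integral_setU//; last 3 first.
  - exact: measurableC.
  - by rewrite setUv.
  - by apply/disj_setPS => x [].
  rewrite (@eq_integral _ _ _ lambda A (fun x => (r x)%:E)); last first.
    by move=> x; rewrite inE /A /= => xA; rewrite gtr0_norm.
  rewrite integral_measurable0// add0e.
  rewrite (@eq_integral _ _ _ lambda (~` A) (fun x => (-1)%:E * (r x)%:E)%E); last first.
    move=> x; rewrite inE /A /= => /negP; rewrite -leNgt => xA.
    by rewrite ler0_norm// -EFinM mulN1r.
  have riA := integrableS measurableT (measurableC mA) (@subsetT _ _) ri.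
  rewrite (integralZl (measurableC mA) riA).
  by rewrite integral_measurable0 ?mule0//; exact: measurableC.
have /(ae_eq_integral_abs lambda measurableT mrE) [N [mN N0 hN]] := e0.
exists N; split=> // x Nx; apply: contrapT => rx; apply/Nx/hN => /(_ Logic.I).
by move=> /= [].
Qed.

End fundamental_lemma.

(** * The Neumann Laplacian *)

Section neumann_laplacian.
Context {R : realType} {d : nat}.
Local Notation E := 'rV[R]_d.+1.
Local Notation ET := (caratheodory_type (@lebesgue_om R d)).
Local Notation lambda := (lebesgue_rV R d).
Variable Omega : set E.
Hypothesis oO : open Omega.
Hypothesis bO : bounded_set Omega.
Local Notation X := (L2O Omega).
Local Notation ip := (ipO Omega).
Local Notation nrm := (hnorm ip).
Local Notation Cc := (Cc_infty Omega).
Implicit Types (u v f g phi : E -> R[i]) (i : 'I_d.+1).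

Let mO : measurable (Omega : set ET).
Proof. exact: measurable_open. Qed.

Let finO : (lambda Omega < +oo)%E.
Proof. exact: lebesgue_outer_bounded. Qed.

Let HX : pre_hilbert X ip.
Proof. exact: (L2_pre_hilbert lambda mO). Qed.

Lemma Cc_inftyP phi : Cc phi <->
  test_fun Omega (fun x => complex.Re (phi x)) /\
  test_fun Omega (fun x => complex.Im (phi x)).
Proof.
split=> [[sphi cK KO]|].
  have out x : ~ closure [set x | phi x != 0] x -> phi x = 0.
    by move=> nx; apply/eqP/negPn/negP => h; apply/nx/subset_closure.
  split; split; try by move=> m; have [] := sphi m.
    by exists (closure [set x | phi x != 0]); split=> // x /out ->.
  by exists (closure [set x | phi x != 0]); split=> // x /out ->.
move=> [[sR [K [cK KO hK]]] [sI [L [cL LO hL]]]].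
have cKL : compact (K `|` L) by exact: compactU.
have sub : closure [set x | phi x != 0] `<=` K `|` L.
  rewrite [X in _ `<=` X](proj1 (closure_id _) (compact_closed_rV cKL)).
  apply: closureS => x /= phix; apply: contrapT => /not_orP[xK xL].
  by move/eqP: phix; apply; apply: complex_eq; [exact: hK|exact: hL].
split; first by move=> m; split; [exact: sR|exact: sI].
  by apply: subclosed_compact sub => //; exact: closed_closure.
by move=> x /sub[/KO|/LO].
Qed.

Lemma Cc_real (h : E -> R) : test_fun Omega h -> Cc (fun x => (h x)%:C).
Proof. by move=> th; apply/Cc_inftyP; split=> //; exact: test_fun0. Qed.

Lemma Cc_pderiv i phi : Cc phi -> Cc (pderiv i phi).
Proof.
move=> /Cc_inftyP[tR tI]; apply/Cc_inftyP.
by split; [exact: (test_fun_derive i tR)|exact: (test_fun_derive i tI)].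
Qed.

Lemma Cc_infty0 : Cc 0.
Proof. by apply/Cc_inftyP; split; exact: test_fun0. Qed.

Lemma Cc_infty_linear (c : R[i]) phi psi : Cc phi -> Cc psi -> Cc (c *: phi + psi).
Proof.
move=> /Cc_inftyP[tR tI] /Cc_inftyP[sR sI]; apply/Cc_inftyP; split.
  rewrite (_ : (fun x => _) = (complex.Re c \*: (fun x => complex.Re (phi x)) +
    (- complex.Im c) \*: (fun x => complex.Im (phi x))) + (fun x => complex.Re (psi x))).
    by apply: test_funD => //; apply: test_funD; exact: test_funZ.
  by apply/funext => x; rewrite ReD ReM -mulNr.
rewrite (_ : (fun x => _) = (complex.Re c \*: (fun x => complex.Im (phi x)) +
  complex.Im c \*: (fun x => complex.Re (phi x))) + (fun x => complex.Im (psi x))).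
  by apply: test_funD => //; apply: test_funD; exact: test_funZ.
by apply/funext => x; rewrite ImD ImM.
Qed.

Lemma test_fun_sq_integrable (h : E -> R) : test_fun Omega h ->
  sq_integrable lambda Omega h.
Proof.
move=> th; have sh := test_fun_smooth th; split.
  apply: (@measurable_funS _ _ _ _ setT) => //.
  exact: smooth_real_measurable.
have thh : test_fun Omega (h * h) by exact: test_funM.
have := integrableS measurableT mO (@subsetT _ _) (test_fun_integrable thh).
by apply: eq_integrable => // x _; rewrite expr2.
Qed.

Lemma Cc_L2 : Cc `<=` X.
Proof.
move=> phi /Cc_inftyP[tR tI]; apply/(L2P lambda mO).
by split; exact: test_fun_sq_integrable.
Qed.

Lemma Rintegral_derive_test_fun i (h : E -> R) : test_fun Omega h ->
  (\int[lambda]_(x in Omega) 'D_(unit_vec i) h x)%R = 0.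
Proof.
move=> th; rewrite Rintegral_mkcond.
rewrite (_ : _ \_ _ = (fun x => 'D_(unit_vec i) h x)).
  by rewrite /Rintegral (integral_derive_test_fun i th).
apply/funext => x; rewrite patchE; case: ifPn => // /negP xO.
rewrite (test_fun_out (test_fun_derive i th))// => Ox.
by apply: xO; rewrite inE.
Qed.

(** The functions [h1] and [h2] are the real and imaginary parts of [phi * conjc psi]; their
    derivatives integrate to 0. *)
Lemma Cc_integration_by_parts i phi psi : Cc phi -> Cc psi ->
  ip phi (pderiv i psi) = - ip (pderiv i phi) psi.
Proof.
move=> cphi cpsi.
have [aR aI] := (Cc_inftyP phi).1 cphi; have [bR bI] := (Cc_inftyP psi).1 cpsi.
have Lphi := Cc_L2 cphi; have Lpsi := Cc_L2 cpsi.
have Ldphi := Cc_L2 (Cc_pderiv i cphi); have Ldpsi := Cc_L2 (Cc_pderiv i cpsi).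
have [saR saI sbR sbI] := And4 (test_fun_smooth aR) (test_fun_smooth aI)
  (test_fun_smooth bR) (test_fun_smooth bI).
pose h1 : E -> R := (fun x => complex.Re (phi x)) * (fun x => complex.Re (psi x)) +
  (fun x => complex.Im (phi x)) * (fun x => complex.Im (psi x)).
pose h2 : E -> R := (fun x => complex.Im (phi x)) * (fun x => complex.Re (psi x)) +
  (-1) \*: ((fun x => complex.Re (phi x)) * (fun x => complex.Im (psi x))).
have t1 : test_fun Omega h1 by apply: test_funD; exact: test_funM.
have t2 : test_fun Omega h2.
  by apply: test_funD; [|apply: test_funZ]; exact: test_funM.
have dM (a b : E -> R) x : smooth_real a -> smooth_real b ->
    'D_(unit_vec i) (a * b) x = a x * 'D_(unit_vec i) b x + b x * 'D_(unit_vec i) a x.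
  by move=> sa sb; rewrite deriveM//; exact: smooth_real_derivable.
apply: (L2ip_eqN mO Lphi Ldpsi Ldphi Lpsi).
  rewrite -[RHS](Rintegral_derive_test_fun i t1); apply: eq_Rintegral => x _.
  rewrite deriveD; [|by apply: smooth_real_derivable; exact: smooth_realM..].
  by rewrite !dM// !(ReM, ReJ, ImJ) /=; ring.
rewrite -[RHS](Rintegral_derive_test_fun i t2); apply: eq_Rintegral => x _.
rewrite deriveD; [|apply: smooth_real_derivable; exact: smooth_realM|
  by apply: smooth_real_derivable; apply: smooth_realZ; exact: smooth_realM].
rewrite deriveZ; last by apply: smooth_real_derivable; exact: smooth_realM.
by rewrite !dM// /GRing.scale /= !(ImM, ReJ, ImJ) /=; ring.
Qed.

(** Since [Omega] has finite measure, [h] is integrable, and its extension by zero falls under the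
    fundamental lemma. *)
Lemma sq_integrable_orthogonal_ae0 (h : E -> R) : sq_integrable lambda Omega h ->
  (forall phi : E -> R, test_fun Omega phi ->
    (\int[lambda]_(x in Omega) (h x * phi x))%R = 0) ->
  exists N : set ET, [/\ measurable N, lambda N = 0%E &
    forall x, Omega x -> ~ N x -> h x = 0].
Proof.
move=> sh hphi.
have ih : lambda.-integrable setT (EFin \o ((h \_ Omega) : ET -> R)).
  rewrite (_ : EFin \o _ = (EFin \o h) \_ Omega); last first.
    by apply/funext => x; rewrite /= !patchE; case: ifP.
  by apply/(integrable_mkcond _ mO); exact: (sq_integrable_integrable mO finO sh).
have [|phi tphi|N [mN N0 hN]] := test_fun_orthogonal_ae0 oO finO ih.
- by move=> x Ox; rewrite patchE memNset.
- have i1 : lambda.-integrable Omega (fun x : ET => (h x * phi x)%:E).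
    by apply: (sq_integrable_mul mO) => //; exact: test_fun_sq_integrable.
  have e0 := hphi _ tphi.
  have -> : (\int[lambda]_x ((h \_ Omega) x * phi x)%:E =
      \int[lambda]_(x in Omega) (h x * phi x)%:E)%E.
    rewrite [RHS]integral_mkcond; apply: eq_integral => x _.
    by rewrite !patchE; case: ifP => // _; rewrite mul0r.
  rewrite -[LHS]fineK; last exact: integrable_fin_num i1.
  by congr (_%:E).
exists N; split=> // x Ox Nx; have := hN x Nx.
by rewrite patchE mem_set.
Qed.

Lemma L2_orthogonal_Cc f : X f -> (forall phi, Cc phi -> ip f phi = 0) -> nrm f = 0.
Proof.
move=> Xf hf; have [sR sI] := (L2P lambda mO f).1 Xf.
have [|N1 [mN1 N10 h1]] := sq_integrable_orthogonal_ae0 sR.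
  move=> phi tphi; have := congr1 (@complex.Re R) (hf _ (Cc_real tphi)).
  rewrite L2ip_ReE => e; apply: (etrans _ e).
  by apply: eq_Rintegral => x _; rewrite ReM ReJ ImJ /= oppr0 mulr0 subr0.
have [|N2 [mN2 N20 h2]] := sq_integrable_orthogonal_ae0 sI.
  move=> phi tphi; have := congr1 (@complex.Im R) (hf _ (Cc_real tphi)).
  rewrite L2ip_ImE => e; apply: (etrans _ e).
  by apply: eq_Rintegral => x _; rewrite ImM ReJ ImJ /= oppr0 mulr0 add0r.
rewrite -[f]subr0; apply: (L2_null_ae mO Xf (mem0 HX) (measurableU _ _ mN1 mN2)).
  exact: null_set_setU.
move=> x Ox /not_orP[xN1 xN2]; apply: complex_eq; [exact: h1|exact: h2].
Qed.

Lemma Cc_test_space : test_space X ip Cc (@pderiv R d).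
Proof.
split; [exact: Cc_L2|exact: Cc_infty0|exact: Cc_infty_linear|exact: Cc_pderiv|
  exact: Cc_integration_by_parts|exact: L2_orthogonal_Cc].
Qed.

Lemma neumann_energy_form : energy_form X (H1 Omega) ip (ip_grad Omega).
Proof.
exact: (dirichlet_energy_form HX (L2_complete mO) Cc_test_space).
Qed.

Lemma neumann_formE k :
  neumann_form Omega k = opow_form X (H1 Omega) ip (ip_grad Omega) k.
Proof. by []. Qed.

End neumann_laplacian.

(** * Vanishing functions in L2 of an arbitrary set *)

Section L2_vanishing.
Context d {T : measurableType d} {R : realType}.
Variables (mu : {measure set T -> \bar R}) (D : set T).

(** Stated for arbitrary [D] with a view to the boundary under Hausdorff measure, whose Caratheodory
    measurability is not established here. *)
Lemma L2_zero : L2 mu D 0.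
Proof.
split; [exact: measurable_cst|exact: measurable_cst|].
rewrite integral0_eq ?ltry// => x _.
by rewrite /cabs /= !expr0n addr0 sqrtr0 expr0n.
Qed.

Lemma L2_hnorm_eq0 (u : T -> R[i]) : (forall x, D x -> u x = 0) ->
  hnorm (L2ip mu D) u = 0.
Proof.
move=> u0; rewrite /hnorm /= -[RHS]sqrtr0 /Rintegral; congr Num.sqrt.
rewrite integral0_eq// => x Dx.
by rewrite u0// mul0r.
Qed.

End L2_vanishing.

(** * The space [Hs] at exponent 1 and the trace of test functions *)

Section trace_zero.
Context {R : realType} {d : nat}.
Local Notation E := 'rV[R]_d.+1.
Variable Omega : set E.
Hypothesis oO : open Omega.
Hypothesis bO : bounded_set Omega.

Lemma Hs1 (u : E -> R[i]) : Hs Omega 1 u <-> H1 Omega u.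
Proof. by rewrite /Hs /= ltxx; split=> [[]|]. Qed.

Lemma Hs_norm1 (u : E -> R[i]) : H1 Omega u ->
  Hs_norm Omega 1 u = hnorm (energy_ip (ipO Omega) (ip_grad Omega)) u.
Proof.
move=> Hu; rewrite /Hs_norm ltxx eqxx addr0.
rewrite -(sqr_energy_norm (neumann_energy_form oO bO))//.
by rewrite sqrtr_sqr ger0_norm// hnorm_ge0.
Qed.

Lemma Cc_infty_bdry0 phi x : Cc_infty Omega phi -> bdry Omega x -> phi x = 0.
Proof.
move=> [_ _ sO] [_ nx]; apply/eqP/negPn/negP => h; apply: nx.
by rewrite (interior_id Omega).1//; apply/sO/subset_closure.
Qed.

Lemma Cc_infty_trace0 : Cc_infty Omega `<=` trace0 Omega.
Proof.
move=> phi cphi; have Hphi := test_sobolev (Cc_test_space oO bO) cphi.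
have Hnull := hnorm0 (energy_pre_hilbert (neumann_energy_form oO bO)).
have H0 := mem0 (ef_V (neumann_energy_form oO bO)).
have bdry0 : L2bdry_norm Omega (phi - 0) = 0.
  apply: L2_hnorm_eq0 => x bx.
  by rewrite subr0; exact: Cc_infty_bdry0 cphi bx.
have Hs0 : Hs_norm Omega 1 (phi - phi) = 0.
  by rewrite subrr; apply: (etrans (Hs_norm1 H0)); exact: Hnull.
have s1 : 2^-1 + 2^-1 = 1 :> R by rewrite -div1r -splitr.
exists 2^-1; split; first by apply/andP; split; lra.
rewrite s1; split; [exact: ((Hs1 phi).2 Hphi)|exact: L2_zero|].
(* A test function is smooth and vanishes on the boundary, so the constant sequence realizes its
   trace 0. *)
exists (fun=> phi); split.
- move=> n; split; first by have [] := cphi.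
  exact: ((Hs1 phi).2 Hphi).
- by rewrite Hs0; exact: cvg_cst.
- by rewrite bdry0; exact: cvg_cst.
Qed.

End trace_zero.

Theorem proposition5p1 (R : realType) (d : nat) (Omega : set 'rV[R]_d.+1)
    (k : nat) :
  bounded_lipschitz_domain Omega -> (0 < k)%N ->
  let b := neumann_form Omega k in
  [/\ admissible Omega b,
      (forall u f, B_N Omega b u f <-> neumann_pow Omega (2 * k) u f),
      Cc_infty Omega `<=` odom (B_N Omega b) `&` odom (B_D Omega b) &
      dense_in (L2O Omega) (ipO Omega)
        (odom (B_D Omega b) `&` odom (B_N Omega b))].
Proof.
(* The successor form of the exponent gives a first application of [L], which places the form domain
   inside [H1]. *)
move=> [oO _ _ bO _]; case: k => [k0|k _]; first by discriminate k0.
have EO := neumann_energy_form oO bO.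
have TO := Cc_test_space oO bO.
have HX := ef_X EO.
have cX := ef_complete EO.
rewrite neumann_formE; set b := opow_form _ _ _ _ _.
have BN u f : B_N Omega b u f <-> neumann_pow Omega (2 * k.+1) u f.
  exact: (associated_opow_form EO _ _ _).
have CcP j phi : Cc_infty Omega phi -> exists2 psi, Cc_infty Omega psi &
    neumann_pow Omega j phi psi.
  by move=> cphi; exact: (opow_test HX TO j cphi).
have CcN : Cc_infty Omega `<=` odom (B_N Omega b) `&` odom (B_D Omega b).
  move=> phi cphi; have [f _ phif] := CcP (2 * k.+1)%N _ cphi.
  have [bphi Xf hf] := (BN phi f).2 phif.
  split; exists f; first exact: ((BN phi f).2 phif).
  (* The restricted form has fewer test vectors, so the same [f] represents it once [phi] is known
     to have trace 0. *)
  split; [|exact: Xf|by move=> v [bv _]; exact: (hf v bv)].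
  by split; [exact: bphi|exact: (Cc_infty_trace0 oO bO cphi)].
split; [|exact: BN|exact: CcN|].
- have sE : (2^-1 + 2^-1 : R) = 1 by rewrite -div1r -splitr.
  split; [exact: (opow_form_generating EO _)|exact: (@opow_form_symmetric _ _ _ _ _ _ EO k.+1)|].
  exists 2^-1; first by apply/andP; split; lra.
  cbv zeta; rewrite sE; split.
  + by move=> phi /(CcP k.+1)[psi _ phipsi]; exists psi.
  + by move=> u du; apply: (Hs1 Omega u).2; exact: (odom_opow_form EO du).
  + exists 0, 2; split; first exact: (@opow_form_semibounded _ _ _ _ _ _ EO k.+1).
    move=> u du; have Hu := odom_opow_form EO du.
    by rewrite (Hs_norm1 oO bO Hu); exact: (energy_norm_le_fnorm EO du).
  + move=> u e Hu e0; have [v dv uv] := opow_energy_dense EO k ((Hs1 Omega u).1 Hu) e0.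
    exists v; first exact: dv.
    rewrite (Hs_norm1 oO bO); first exact: uv.
    apply: (memB (ef_V EO)); [exact: ((Hs1 Omega u).1 Hu)|exact: (odom_opow_form EO dv)].
- split=> [u [_ [f [du _ _]]]|u e Xu e0].
    exact: (odom_opow_sub EO du).
  have [v cv uv] := test_dense HX cX TO Xu e0.
  exists v; last exact: uv.
  by have [? ?] := CcN _ cv.
Qed.
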